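(* Assume $n-\sigma\geq 35$. Then the singular series $\mathfrak{S}$ is absolutely convergent. Furthermore, there is some $\phi>0$ such that \[\mathfrak{S}(R)=\mathfrak{S} +O_{\phi}(R^{-\phi}).\]
   Context: $F,G\in\mathbb{Z}[x_1,\dots,x_n]$ are cubic forms, $e_q(x):=e^{2\pi i x/q}$, and \[\mathfrak{S}(R):=\sum_{q=1}^R q^{-n}\sum_{\substack{{\underline{a}}=(a_1,a_2)\bmod q\\ \gcd(a_1,a_2,q)=1}} \sum_{\underline{x}\bmod q} e_q(a_1F(\underline{x})+a_2G(\underline{x})),\qquad \mathfrak{S}:=\lim_{R\to\infty}\mathfrak{S}(R).\] $\sigma:=\dim\{\underline{x}\in\mathbb{P}^{n-1}_{\mathbb{C}}:F(\underline{x})=G(\underline{x})=0,\ \mathrm{Rank}(\nabla F(\underline{x}),\nabla G(\underline{x}))<2\}$ is the dimension of the singular locus of the complete intersection $X=\{F=G=0\}$ (equal to $-1$ if $X$ is non-singular). *)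

(* Defs.v *)
From HB Require Import structures.
From mathcomp Require Import all_boot all_order all_algebra complex.
From mathcomp Require Import boolp classical_sets reals topology normedtype.
From mathcomp Require Import sequences exp trigo.
(* The notations of mpoly clash with those of topology; the few that are used
   here are re-declared below. *)
From mathcomp Require Import -(notations) mpoly.

Set Implicit Arguments.
Unset Strict Implicit.
Unset Printing Implicit Defensive.

Import Order.TTheory GRing.Theory Num.Theory.
Import numFieldNormedType.Exports.

Local Open Scope classical_set_scope.
Local Open Scope complex_scope.
Local Open Scope ring_scope.

Notation "{ 'mpoly' T [ n ] }" := (mpoly n T) : type_scope.
Notation "p .@[ v ]" := (@meval _ _ v p) : ring_scope.

Definition homogeneous (n : nat) (K : nzRingType) (d : nat) (p : {mpoly K[n]}) :
  Prop := p \is ishomog1 d mdeg.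

Section ProjectiveSpace.
Variables (K : fieldType) (n : nat).

(* A subset of P^{n-1}(K) is represented by the set of all its homogeneous
   coordinate vectors, i.e. by a set of nonzero vectors of K^n that is stable
   under nonzero scalars. *)
Definition proj_closed (Z : set 'rV[K]_n) : Prop :=
  exists2 I : set {mpoly K[n]},
    (forall p, I p -> exists d, homogeneous d p) &
    Z = [set x : 'rV[K]_n | x != 0 /\ forall p, I p -> p.@[x 0] = 0].

Definition proj_irreducible (Z : set 'rV[K]_n) : Prop :=
  [/\ proj_closed Z, Z !=set0 &
      forall A B, proj_closed A -> proj_closed B -> Z = A `|` B ->
        Z = A \/ Z = B].

(* Y 0 < Y 1 < ... < Y k are irreducible closed subsets of Z. *)
Definition irreducible_chain (Z : set 'rV[K]_n) (k : nat) : Prop :=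
  exists Y : nat -> set 'rV[K]_n,
    (forall i, (i <= k)%N -> proj_irreducible (Y i) /\ Y i `<=` Z) /\
    (forall i, (i < k)%N -> Y i `<` Y i.+1).

(* Z has (Krull) dimension d, for Z closed; the empty set has dimension -1. *)
Definition has_proj_dim (Z : set 'rV[K]_n) (d : int) : Prop :=
  (Z = set0 /\ d = -1) \/
  (exists k : nat, [/\ d = k%:Z, irreducible_chain Z k &
    forall m, irreducible_chain Z m -> (m <= k)%N]).

Definition gradient (p : {mpoly K[n]}) (x : 'rV[K]_n) : 'rV[K]_n :=
  \row_j (mderiv j p).@[x 0].

Definition singular_locus (p r : {mpoly K[n]}) : set 'rV[K]_n :=
  [set x : 'rV[K]_n | [/\ x != 0, p.@[x 0] = 0, r.@[x 0] = 0 &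
    (\rank (col_mx (gradient p x) (gradient r x)) < 2)%N]].

End ProjectiveSpace.

Section SingularSeries.
Variables (R : realType) (n : nat) (F G : {mpoly int[n]}).

Definition over_complex (p : {mpoly int[n]}) : {mpoly R[i][n]} :=
  map_mpoly intr p.

Definition complex_singular_locus : set 'rV[R[i]]_n :=
  singular_locus (over_complex F) (over_complex G).

(* e_q(z) = exp (2 pi i z / q) *)
Definition e_ (q : nat) (z : int) : R[i] :=
  let t : R := 2 * pi * z%:~R / q%:R in cos t +i* sin t.

Definition eval_res (q : nat) (p : {mpoly int[n]}) (x : {ffun 'I_n -> 'I_q}) :
  int := p.@[fun j => (x j : nat)%:Z].

Definition exp_sum (q a1 a2 : nat) : R[i] :=
  \sum_(x : {ffun 'I_n -> 'I_q})
    e_ q (a1%:Z * eval_res F x + a2%:Z * eval_res G x).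

Definition singular_term (q : nat) : R[i] :=
  (q%:R ^- n) *
  \sum_(a : 'I_q * 'I_q | gcdn (gcdn a.1 a.2) q == 1%N) exp_sum q a.1 a.2.

Definition singular_partial (N : nat) : R[i] :=
  \sum_(1 <= q < N.+1) singular_term q.

(* R[i]^o carries the topology defined by the complex modulus. *)
Definition singular_series : R[i] := limn (singular_partial : nat -> R[i]^o).

Definition singular_series_abs_cvg : Prop :=
  cvgn ((fun N => \sum_(1 <= q < N.+1) `|singular_term q|) : nat -> R[i]^o).

End SingularSeries.

Arguments complex_singular_locus R {n} F G.

(* Main.v *)
Require Import Defs.
From mathcomp Require Import all_boot all_order all_algebra complex.
From mathcomp Require Import boolp classical_sets reals topology normedtype.
From mathcomp Require Import sequences exp trigo.
From mathcomp Require Import -(notations) mpoly.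
From mathcomp Require Import zify ring lra.
Import Order.TTheory GRing.Theory Num.Theory.
Import numFieldNormedType.Exports.
Local Open Scope complex_scope.
Local Open Scope ring_scope.
Set Implicit Arguments.
Unset Strict Implicit.
Unset Printing Implicit Defensive.

(* Write f_a = a1 F + a2 G, let B_a be its system of n bilinear forms, and let
   S(a; q) be the complete exponential sum.  Two Weyl steps bound S(a; q) by the
   number of pairs (h, k) modulo q with B_a(h, k) = 0.

   Hyperplane sections and the Nullstellensatz give sigma + 1 integral linear
   forms such that F, G, the 2 x 2 minors of the two gradients and these forms
   generate an ideal containing a multiple of a power of each variable.  On the
   diagonal B_a(h, k) is twice the gradient of f_a, so the scheme B_a = 0 is
   finite over the affine space with coordinates h - k, the linear forms and G
   (or F).  Hence it has O(P^(n + sigma + 2)) points in a grid of side P, and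
   this is uniform in a, over Q and over F_p for all but finitely many p.

   A pigeonhole argument shrinks h and k to integers of size q^(1/4), and
   replaces a by a multiple b modulo q of size q^(1/2); then B_b(h, k) = 0 holds
   over Z, and S(a; q) = O(q^(n - 33/16)).  For q = p^r one also uses that, for h
   outside a set of density O(p^-8), the kernel of B_a(h, .) is small modulo p
   and therefore modulo q.  Together these give
     S(a; q) = O(q^n (q^-4 + p^-2 q^(-33/16))),
   and the Euler product of the resulting bounds converges even after
   multiplication by q^(1/32). *)

(** * Noetherian property of projective closed sets *)

(** The obstacle is the sum over a. There are up to q^2 pairs, so summing term by term needs a
    saving of more than q^3 in S(a; q), and differencing saves only q^(33/16). This number is the
    origin of 35: n - sigma >= 35 says 2n - (n + sigma + 2) >= 33, so boxes of side q^(1/4) save a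
    factor q^(33/4) in the number of pairs (h, k), and the two squarings leave its fourth root. The
    excess of 33/16 over 2 is 1/16: enough to sum over the powers of one prime, not over the primes.
    The factor p^-2 closes this gap. It is the fourth root of the density p^-8 of the residues with
    large kernel, brought in by Cauchy-Schwarz. Of the margin 1/16 one half is spent on the sum over
    powers of p and the other half, 1/32, becomes the rate of convergence.

    Uniformity in a and p shapes the geometric part: all that is used of the dimension is a set of
    integral identities with one multiplier M, which can be read over Q and over F_p for p prime to
    6M. *)

Section Noetherian.
Local Open Scope classical_set_scope.

(** From any k, jump to an index beyond k at which the tail of [u] attains its minimum. Later jumps
    land in the same tail, so the values cannot drop. *)
Lemma nondecreasing_subseq (u : nat -> nat) : exists f : nat -> nat,
  (forall i, f i < f i.+1)%N /\ (forall i, u (f i) <= u (f i.+1))%N.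
Proof.
have minP k : exists j, (k < j)%N /\ forall l, (k < l)%N -> (u j <= u l)%N.
  have [v] := ubnP (u k.+1); have: (k < k.+1)%N by [].
  move: {2 3}k.+1 => l; elim: v l => // v IH l kl lev.
  have [[l' [kl' ul']]|H] := pselect (exists l', (k < l')%N /\ (u l' < u l)%N).
    by apply: IH kl' _; rewrite ltnS in lev; apply: leq_trans ul' lev.
  exists l; split => // l' kl'; rewrite leqNgt; apply/negP => ul'.
  by apply: H; exists l'.
have [g gP] := choice minP.
exists (fun i => iter i.+1 g 0%N); split => i.
  by rewrite [ltnRHS]iterS; have [] := gP (iter i.+1 g 0%N).
rewrite [iter i.+1 g 0%N]iterS; have [_] := gP (iter i g 0%N); apply.
apply: (@ltn_trans (iter i.+1 g 0%N)); rewrite [ltnRHS]iterS.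
  by have [] := gP (iter i g 0%N).
by have [] := gP (iter i.+1 g 0%N).
Qed.

Lemma strict_incr_leq (f : nat -> nat) (hf : forall i, (f i < f i.+1)%N) i j :
  (i < j)%N -> (f i < f j)%N.
Proof.
elim: j => // j IH; rewrite ltnS leq_eqVlt => /orP[/eqP->//|/IH h].
exact: ltn_trans h (hf j).
Qed.

Lemma step_leq (u : nat -> nat) (hu : forall i, (u i <= u i.+1)%N) i j :
  (i <= j)%N -> (u i <= u j)%N.
Proof.
elim: j => [|j IH]; first by rewrite leqn0 => /eqP->.
rewrite leq_eqVlt => /orP[/eqP->//|]; rewrite ltnS => /IH h.
exact: leq_trans h (hu j).
Qed.

(** Dickson's lemma. The coordinates are treated one at a time, each by passing to a subsequence;
    coordinates already treated stay monotone along it. *)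
Lemma dickson n (m : nat -> multinom n) :
  exists i j, (i < j)%N /\ lem (m i) (m j).
Proof.
suff [f [f1 f2]] : exists f : nat -> nat, (forall i, f i < f i.+1)%N /\
    (forall c, c \in enum 'I_n -> forall i, m (f i) c <= m (f i.+1) c)%N.
  exists (f 0%N), (f 1%N); split; first exact: f1.
  by apply/mnm_lepP => c; apply: f2; rewrite mem_enum.
elim: (enum 'I_n) => [|c s [f [f1 f2]]]; first by exists id.
have [g [g1 g2]] := nondecreasing_subseq (fun i => m (f i) c).
exists (f \o g); split => [i|c' ]; first by apply: strict_incr_leq (g1 i).
rewrite inE => /orP[/eqP->//|c's i /=].
by apply: (@step_leq (fun i => m (f i) c') (f2 _ c's)); apply: ltnW.
Qed.

(** Hilbert's basis theorem through leading monomials. Pick in each [I i.+1] outside [I i] an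
    element with minimal leading monomial. By [dickson] one of these monomials divides a later one,
    and cancelling the later leading term gives a new element that is smaller still. *)
Lemma ideal_chain_stationary (K : fieldType) n (I : nat -> set {mpoly K[n]}) :
    (forall i, I i 0) ->
    (forall i p q r, I i p -> I i q -> I i (p + r * q)) ->
    (forall i, I i `<=` I i.+1) ->
  ~ (forall i, exists p, I i.+1 p /\ ~ I i p).
Proof.
move=> I0 Ilin Imono /[dup] grow _.
have minP i : exists p, [/\ I i.+1 p, ~ I i p &
    forall q, I i.+1 q -> ~ I i q -> ~~ (mlead q < mlead p)%O].
  have [p [p1 p2]] := grow i; move: {2}(mlead p) (erefl (mlead p)) => m.
  elim/(well_founded_ind (@ltom_wf n)): m p p1 p2 => m IH p p1 p2 pm.
  have [[q [q1 q2 qp]]|H] :=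
    pselect (exists q, [/\ I i.+1 q, ~ I i q & (mlead q < mlead p)%O]).
    by apply: (IH (mlead q)) q1 q2 erefl; rewrite -pm.
  by exists p; split=> // q q1 q2; apply/negP => qp; apply: H; exists q.
have Ile i j : (i <= j)%N -> I i `<=` I j.
  elim: j => [|j IH]; first by rewrite leqn0 => /eqP->.
  rewrite leq_eqVlt => /orP[/eqP->//|]; rewrite ltnS => /IH h.
  exact: subset_trans h (Imono j).
have [p pP] := choice minP.
have [i [j [ij le_ij]]] := dickson (fun i => mlead (p i)).
have [pi1 pi2 _] := pP i; have [pj1 pj2 pj3] := pP j.
have nz k : p k != 0.
  by apply/eqP => pk; have [_ + _] := pP k; rewrite pk; apply.
set mi := mlead (p i) in le_ij *; set mj := mlead (p j) in le_ij *.
set c := (mcoeff mj (p j) / mcoeff mi (p i)) *: mpolyX K (mnm_sub mj mi).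
pose q := p j - c * p i.
have Ipi : I j (p i) by apply: Ile pi1.
have q1 : I j.+1 q.
  rewrite /q -mulNr; apply: Ilin => //; exact: Imono.
have q2 : ~ I j q.
  move=> Iq; apply: pj2; rewrite (_ : p j = q + c * p i); last by rewrite subrK.
  exact: Ilin.
have := pj3 _ q1 q2; rewrite -leNgt => le_q.
have ci : mcoeff mi (p i) != 0 by rewrite mleadc_eq0 nz.
have q_mj : mcoeff mj q = 0.
  rewrite /q mcoeffB /c -scalerAl mcoeffZ mulrC.
  have -> : mcoeff mj (mpolyX K (mnm_sub mj mi) * p i) = mcoeff mi (p i).
    by rewrite -{1}(submK le_ij) mulrC mcoeffMX.
  by rewrite mulrCA divff // mulr1 subrr.
have q_le : (mlead q <= mj)%O.
  rewrite /q; apply: le_trans (mleadB_le _ _) _; rewrite leUx lexx /=.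
  rewrite /c -scalerAl; apply: le_trans (mleadZ_le _ _) _.
  by apply: le_trans (mleadM_le _ _) _; rewrite mleadXm submK.
have qmj : mlead q = mj by apply/eqP; rewrite eq_le q_le le_q.
apply: q2; suff -> : q = 0 by [].
by apply/eqP; rewrite -mleadc_eq0 qmj q_mj.
Qed.

(** Noetherian induction: an infinite strictly descending chain would make the vanishing ideals grow
    forever, since a point that is lost violates some equation of the next set. *)
Lemma proj_closed_ind (K : fieldType) n (P : set 'rV[K]_n -> Prop) :
    (forall Z, proj_closed Z ->
      (forall Z', proj_closed Z' -> Z' `<` Z -> P Z') -> P Z) ->
  forall Z, proj_closed Z -> P Z.
Proof.
move=> step Z0 cZ0; apply: contrapT => nP0.
pose bad := {Z : set 'rV[K]_n | proj_closed Z /\ ~ P Z}.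
have next (Z : bad) : exists Z' : bad, sval Z' `<` sval Z.
  case: Z => Z [cZ nP] /=; apply: contrapT => H; apply: nP.
  apply: step => // Z' cZ' Z'Z; apply: contrapT => nP'; apply: H.
  by exists (exist _ Z' (conj cZ' nP')).
have [g gP] := choice next.
pose z : bad := exist _ Z0 (conj cZ0 nP0).
pose Zs i := sval (iter i g z).
have Zs_lt i : Zs i.+1 `<` Zs i by apply: gP.
apply: (@ideal_chain_stationary K n
  (fun i => [set p | forall x : 'rV[K]_n, Zs i x -> p.@[x 0] = 0])) => /=.
- by move=> i x _; rewrite meval0.
- by move=> i p q r hp hq x Zx; rewrite mevalD mevalM hp // hq // mulr0 addr0.
- by move=> i p hp x Zx; apply: hp; have [+ _] := Zs_lt i; apply.
move=> i; have [sub nsub] := Zs_lt i.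
have [/= [I hI ZI] _] := svalP (iter i.+1 g z).
have ZsE : Zs i.+1 = [set x : 'rV[K]_n | x != 0 /\ forall p, I p -> p.@[x 0] = 0] := ZI.
have [x [Zx nx]] : exists x, Zs i x /\ ~ Zs i.+1 x.
  apply: contrapT => H; apply: nsub => x Zx.
  by apply: contrapT => nx; apply: H; exists x.
have x0 : x != 0.
  move: Zx; have [[J _ ->] _] : proj_closed (Zs i) /\ ~ P (Zs i) := svalP (iter i g z).
  by move=> [].
have [p [Ip px]] : exists p, I p /\ p.@[x 0] <> 0.
  apply: contrapT => H; apply: nx; rewrite ZsE; split => // p Ip.
  by apply: contrapT => px; apply: H; exists p.
exists p; split => [y|]; first by rewrite ZsE => -[_]; apply.
by move=> /(_ x Zx).
Qed.

End Noetherian.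

(** * Hyperplane sections *)

Section LinearSections.
Local Open Scope classical_set_scope.

Lemma proj_closedI (K : fieldType) n (A B : set 'rV[K]_n) :
  proj_closed A -> proj_closed B -> proj_closed (A `&` B).
Proof.
move=> [I hI ->] [J hJ ->]; exists (I `|` J); first by move=> p [/hI|/hJ].
apply/seteqP; split => x /=.
  by move=> [[x0 Ix] [_ Jx]]; split => // p [/Ix|/Jx].
by move=> [x0 IJx]; do 2!split=> //; move=> p ?; apply: IJx; [left|right].
Qed.

Lemma proj_reducible (K : fieldType) n (Z : set 'rV[K]_n) :
    proj_closed Z -> Z !=set0 -> ~ proj_irreducible Z ->
  exists A B, [/\ proj_closed A, proj_closed B, Z = A `|` B, A `<` Z & B `<` Z].
Proof.
move=> cZ Z0 nirr; apply: contrapT => H; apply: nirr; split => // A B cA cB ZAB.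
apply: contrapT => /not_orP[ZA ZB]; apply: H; exists A, B; split => //.
- split; first by rewrite ZAB => x; left.
  by move=> ZsubA; apply: ZA; apply/seteqP; split => // x Ax; rewrite ZAB; left.
- split; first by rewrite ZAB => x; right.
  by move=> ZsubB; apply: ZB; apply/seteqP; split => // x Bx; rewrite ZAB; right.
Qed.

Lemma exists_proj_irreducible (K : fieldType) n (Z : set 'rV[K]_n) :
  proj_closed Z -> Z !=set0 -> exists2 Y, proj_irreducible Y & Y `<=` Z.
Proof.
move=> cZ; move: Z cZ; apply: proj_closed_ind => Z cZ IH Z0.
have [irr|nirr] := pselect (proj_irreducible Z); first by exists Z.
have [A [B [cA cB ZAB ltA ltB]]] := proj_reducible cZ Z0 nirr.
case: Z0 => x; rewrite {1}ZAB => -[Ax|Bx].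
  by have [|Y iY YA] := IH A cA ltA; [exists x|exists Y => // y /YA; case: ltA => + _; apply].
by have [|Y iY YB] := IH B cB ltB; [exists x|exists Y => // y /YB; case: ltB => + _; apply].
Qed.

(* The witnesses pick one point on each irreducible component of Z. *)
Lemma component_points (K : fieldType) n (Z : set 'rV[K]_n) : proj_closed Z ->
  exists zs : seq 'rV[K]_n, (forall z, z \in zs -> z != 0) /\
    forall Y, proj_irreducible Y -> Y `<=` Z ->
    exists Y', [/\ proj_irreducible Y', Y `<=` Y', Y' `<=` Z &
      exists2 z, z \in zs & Y' z].
Proof.
move=> cZ; move: Z cZ; apply: proj_closed_ind => Z cZ IH.
have [Z0|Z0] := pselect (Z !=set0); last first.
  exists [::]; split => // Y [_ [y Yy] _] YZ.
  by exfalso; apply: Z0; exists y; apply: YZ.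
have [irr|nirr] := pselect (proj_irreducible Z).
  case: Z0 => z Zz; exists [:: z]; split.
    move=> z'; rewrite inE => /eqP->.
    by case: cZ Zz => I _ -> [].
  move=> Y _ YZ; exists Z; split => //.
  by exists z => //; rewrite inE.
have [A [B [cA cB ZAB ltA ltB]]] := proj_reducible cZ Z0 nirr.
have [za [za0 zaP]] := IH A cA ltA; have [zb [zb0 zbP]] := IH B cB ltB.
exists (za ++ zb); split.
  by move=> z; rewrite mem_cat => /orP[/za0|/zb0].
move=> Y irrY YZ; have [cY Y0 Ysplit] := irrY.
have AZ : A `<=` Z by case: ltA.
have BZ : B `<=` Z by case: ltB.
have [|YA|YB] := Ysplit (Y `&` A) (Y `&` B) (proj_closedI cY cA) (proj_closedI cY cB).
- apply/seteqP; split => [y Yy|y [[]|[]]//].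
  by have := YZ _ Yy; rewrite ZAB => -[?|?]; [left|right].
- have [|Y' [iY' YY' Y'A [z zza Yz]]] := zaP Y irrY; first by rewrite YA => y [].
  exists Y'; split => //; first exact: subset_trans Y'A AZ.
  by exists z => //; rewrite mem_cat zza.
- have [|Y' [iY' YY' Y'B [z zzb Yz]]] := zbP Y irrY; first by rewrite YB => y [].
  exists Y'; split => //; first exact: subset_trans Y'B BZ.
  by exists z => //; rewrite mem_cat zzb orbT.
Qed.

Definition lform n (v : 'I_n -> int) : {mpoly int[n]} :=
  \sum_i v i *: mpolyX int (mnm1 i).

Lemma map_homog (R S : nzRingType) (f : {rmorphism R -> S}) n d (p : {mpoly R[n]}) :
  homogeneous d p -> homogeneous d (map_mpoly f p).
Proof.
move=> /dhomogP hp; apply/dhomogP => m; rewrite mcoeff_msupp mcoeff_map_mpoly => pm.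
by apply: hp; rewrite mcoeff_msupp; apply: contraNneq pm => ->; apply/eqP; exact: rmorph0.
Qed.

Lemma lform_homog n (v : 'I_n -> int) : homogeneous 1 (lform v).
Proof.
rewrite /homogeneous /lform; apply: rpred_sum => i _; apply: rpredZ.
by rewrite dhomogX /= mdeg1.
Qed.

Lemma meval_lform (K : comNzRingType) n (v : 'I_n -> int) (x : 'I_n -> K) :
  (map_mpoly intr (lform v)).@[x] = \sum_i (v i)%:~R * x i.
Proof.
rewrite /lform (raddf_sum (map_mpoly intr)) (raddf_sum (meval x)) /=.
apply: eq_bigr => i _.
by rewrite map_mpolyZ map_mpolyX mevalZ mevalXU.
Qed.

(** The coefficients are sought on the moment curve, [v i = j ^ i]. The form at z is then the
    polynomial with coefficients z evaluated at j, and the product of these nonzero polynomials has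
    a non-root among the naturals. *)
Lemma generic_lform (K : numFieldType) n (zs : seq 'rV[K]_n) :
    (forall z, z \in zs -> z != 0) ->
  exists v : 'I_n -> int, forall z, z \in zs -> \sum_i (v i)%:~R * z 0 i != 0.
Proof.
move=> zs0.
pose pz (z : 'rV[K]_n) : {poly K} := \sum_(i < n) z 0 i *: 'X^i.
have pz0 z : z \in zs -> pz z != 0.
  move=> /zs0; apply: contraNneq => pz0; apply/eqP/rowP => i; rewrite mxE.
  have /(congr1 (fun p : {poly K} => p`_i)) := pz0.
  rewrite /pz coef_sum coef0 (bigD1 i) //= coefZ coefXn eqxx mulr1 big1 ?addr0 //.
  by move=> j ji; rewrite coefZ coefXn eq_sym (inj_eq val_inj) (negPf ji) mulr0.
pose P := \prod_(z <- zs) pz z.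
have P0 : P != 0 by rewrite prodf_seq_neq0; apply/allP => z zzs; exact: pz0.
have [j Pj] : exists j : nat, ~~ root P j%:R.
  apply: contrapT => H.
  have := @max_poly_roots _ P [seq j%:R | j <- iota 0 (size P)] P0.
  rewrite size_map size_iota ltnn => few; suff: false by []; apply: few.
    apply/allP => _ /mapP[j _ ->]; apply: contrapT => /negP nr.
    by apply: H; exists j.
  by rewrite map_inj_uniq ?iota_uniq //; apply: mulrIn; rewrite oner_eq0.
exists (fun i => (j ^ i)%:Z) => z zzs.
apply: contraNneq Pj => E; rewrite /P /root horner_prod.
rewrite prodf_seq_eq0; apply/hasP; exists z => //=.
rewrite /pz horner_sum -[X in _ == X]E; apply/eqP/eq_bigr => i _.
by rewrite hornerZ hornerXn mulrC -natrX.
Qed.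

(** The hypothesis encodes dimension below [t], with [t = 0] for the empty set. A generic form is
    nonzero at a point of every component, so each chain in the section extends by a component of
    [Z]; every form therefore lowers the dimension. *)
Lemma linear_section (K : numFieldType) n t (Z : set 'rV[K]_n) :
    proj_closed Z -> (forall m, irreducible_chain Z m -> (m < t)%N) ->
  exists ls : seq {mpoly int[n]}, [/\ size ls = t,
    (forall l, l \in ls -> homogeneous 1 l) &
    forall x, Z x -> exists2 l, l \in ls & (map_mpoly intr l).@[x 0] != 0].
Proof.
elim: t Z => [|t IH] Z cZ chainZ.
  exists [::]; split => // x Zx.
  have [|Y iY YZ] := exists_proj_irreducible cZ; first by exists x.
  by have := chainZ 0%N; rewrite ltn0 => H; case: notF; apply: H; exists (fun=> Y).
have [zs [zs0 zsP]] := component_points cZ.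
have [v vP] := generic_lform zs0.
pose H := [set x : 'rV[K]_n | x != 0 /\
  forall p, [set map_mpoly intr (lform v)] p -> p.@[x 0] = 0].
have cH : proj_closed H.
  exists [set map_mpoly intr (lform v)] => // _ ->; exists 1%N.
  exact: map_homog (lform_homog v).
have [|ls [szls hls lsP]] := IH (Z `&` H) (proj_closedI cZ cH).
  move=> m [Y [Y1 Y2]]; rewrite -ltnS; apply: chainZ.
  have [iYm YmZH] := Y1 m (leqnn m).
  have [|Y' [iY' YmY' Y'Z [z zzs Y'z]]] := zsP _ iYm; first by move=> y /YmZH[].
  (* The new top [Y'] contains the point [z] off the hyperplane, hence is strictly larger than
     [Y m]. *)
  exists (fun i => if (i <= m)%N then Y i else Y'); split => i.
    rewrite leq_eqVlt => /orP[/eqP->|]; first by rewrite ltnn.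
    rewrite ltnS => im; rewrite im; have [iY YZH] := Y1 i im; split => //.
    by move=> y /YZH[].
  rewrite ltnS => im; rewrite im; case: ltnP => [im'|mi]; first exact: Y2.
  have -> : i = m by apply/eqP; rewrite eqn_leq im mi.
  split => // sub; have := YmZH _ (sub _ Y'z) => -[_ [_ /(_ _ erefl)]].
  by move/eqP; apply/negP; rewrite meval_lform; apply: vP.
exists (lform v :: ls); split => /=; first by rewrite szls.
  by move=> l; rewrite inE => /orP[/eqP->|/hls//]; apply: lform_homog.
move=> x Zx; have x0 : x != 0 by case: cZ Zx => I _ -> [].
have [lx|lx] := eqVneq (map_mpoly intr (lform v)).@[x 0] 0.
  have [|l lls lx'] := lsP x; first by split => //; split => // _ ->.
  by exists l => //; rewrite inE lls orbT.
by exists (lform v) => //; rewrite inE eqxx.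
Qed.

End LinearSections.

(** * The homogeneous Nullstellensatz *)

Section Nullstellensatz.
Local Open Scope classical_set_scope.

Definition ideal_set (A : comNzRingType) (I : set A) :=
  I 0 /\ forall p q r, I p -> I q -> I (p + r * q).

Lemma idealM (A : comNzRingType) (I : set A) p r : ideal_set I -> I p -> I (r * p).
Proof. by move=> [I0 hI] Ip; rewrite -[r * p]add0r; apply: hI. Qed.

Lemma idealD (A : comNzRingType) (I : set A) p q :
  ideal_set I -> I p -> I q -> I (p + q).
Proof. by move=> [_ hI] Ip Iq; rewrite -[q]mul1r; apply: hI. Qed.

Lemma idealN (A : comNzRingType) (I : set A) p : ideal_set I -> I p -> I (- p).
Proof. by move=> hI Ip; rewrite -mulN1r; apply: idealM. Qed.

Lemma ideal_sum (A : comNzRingType) (I : set A) (T : Type) (s : seq T) (P : pred T)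
  (F : T -> A) : ideal_set I -> (forall i, P i -> I (F i)) -> I (\sum_(i <- s | P i) F i).
Proof.
move=> hI hF; elim/big_ind: _ => [|p q|//]; last exact: idealD.
by case: hI.
Qed.

Definition radical_set (A : comNzRingType) (I : set A) : set A :=
  [set p | exists N, I (p ^+ N)].

Lemma ideal_expr (A : comNzRingType) (I : set A) p N M :
  ideal_set I -> (N <= M)%N -> I (p ^+ N) -> I (p ^+ M).
Proof. by move=> hI NM IpN; rewrite -(subnK NM) exprD; apply: idealM. Qed.

Lemma radical_ideal (A : comNzRingType) (I : set A) :
  ideal_set I -> ideal_set (radical_set I).
Proof.
move=> hI; split=> [|p q r [N pN] [M qM]].
  by exists 1%N; rewrite expr1; case: hI.
exists (N + M)%N; rewrite exprDn; apply: ideal_sum => // i _.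
rewrite -mulr_natr mulrC; apply: idealM => //.
have [iM|Mi] := leqP i M.
  rewrite mulrC; apply: idealM => //; apply: ideal_expr pN => //.
  by lia.
apply: idealM => //; rewrite exprMn; apply: idealM => //.
by apply: ideal_expr qM => //; apply: ltnW.
Qed.

(* Elimination: a zero of the contraction of II to A lifts, because if the
   specialisation of II contained 1 = f(T), then the determinant of
   multiplication by f modulo the monic polynomial P would lie in the
   contraction and specialise to 1. *)
Lemma elimination_lift (A : comNzRingType) (K : closedFieldType)
    (ev : {rmorphism A -> K}) (II : set {poly A}) (P : {poly A}) :
    (forall c, exists r, ev r = c) -> ideal_set II -> II P -> P \is monic ->
    (forall r, II r%:P -> ev r = 0) ->
  exists a, forall f, II f -> (map_poly ev f).[a] = 0.
Proof.
move=> ev_surj hII IIP Pmonic evII.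
pose D := [set g : {poly K} | exists2 f, II f & map_poly ev f = g].
have ev_poly (g : {poly K}) : exists f, map_poly ev f = g.
  have [h hP] := choice ev_surj.
  exists (\poly_(i < size g) h g`_i); apply/polyP => i.
  rewrite coef_map coef_poly /=; case: ltnP => [_|ig]; first exact: hP.
  by rewrite rmorph0 nth_default.
have DP g h r : D g -> D h -> D (g - r * h).
  move=> [f1 If1 <-] [f2 If2 <-]; have [f <-] := ev_poly r.
  exists (f1 - f * f2); last by rewrite rmorphB rmorphM.
  by apply: idealD => //; apply: idealN => //; apply: idealM.
have D1 : ~ D 1.
  move=> [f IIf f1].
  have d0 : (0 < (size P).-1)%N.
    rewrite lt0n; apply/eqP => sz; have := evII 1; rewrite !rmorph1 => H.
    suff P1 : P = 1.
      by have /eqP := H (eq_ind _ II IIP _ P1); rewrite oner_eq0.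
    have : (size P <= 1)%N by case: (size P) sz => [//|[]].
    move=> /size1_polyC PE; have := monicP Pmonic.
    by rewrite {1}PE lead_coefC => P0; rewrite PE P0.
  set d := (size P).-1 in d0; have szP : size P = d.+1.
    by move: d0; rewrite /d; case: (size P).
  pose Q j := Pdiv.Ring.rdivp ('X^j * f) P.
  pose m j := Pdiv.Ring.rmodp ('X^j * f) P.
  have mE j : 'X^j * f = Q j * P + m j by apply: Pdiv.RingMonic.rdivp_eq.
  have szm j : (size (m j) <= d)%N.
    by rewrite -ltnS -szP; apply: Pdiv.Ring.ltn_rmodpN0; rewrite monic_neq0.
  have IIm j : II (m j).
    have -> : m j = 'X^j * f - Q j * P by rewrite mE addrC addKr.
    by apply: idealD => //; [|apply: idealN => //]; apply: idealM.
  pose M : 'M[A]_d := \matrix_(j, k) (m j)`_k.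
  (* Row 0 of the identity [\adj M *m M = (\det M)%:M]: the combination of the [m j] with these
     cofactors has constant coefficient [\det M] and no other coefficient. *)
  have IIdet : II (\det M)%:P.
    have -> : (\det M)%:P = \sum_j ((\adj M) (Ordinal d0) j)%:P * m j.
      apply/polyP => k; rewrite coef_sum.
      under eq_bigr do rewrite coefCM.
      have [kd|dk] := ltnP k d; last first.
        rewrite coefC gtn_eqF ?(leq_trans d0) // big1 // => j _.
        by rewrite nth_default ?mulr0 // (leq_trans (szm j)).
      have /matrixP/(_ (Ordinal d0) (Ordinal kd)) := mul_adj_mx M.
      rewrite !mxE => E; rewrite coefC.
      transitivity (\det M *+ (Ordinal d0 == Ordinal kd)).
        by rewrite -val_eqE /= [in RHS]eq_sym; case: eqP.
      by rewrite -E; apply: eq_bigr => j _; rewrite !mxE.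
    by apply: ideal_sum => // j _; apply: idealM.
  (* After specialisation f is 1, and 'X^j with j < d is its own remainder modulo the monic image of
     P. So M specialises to the identity matrix. *)
  have evm (j : 'I_d) : map_poly ev (m j) = 'X^j.
    have := congr1 (map_poly ev) (mE j).
    rewrite rmorphM /= f1 mulr1 map_polyXn rmorphD rmorphM /=.
    set q := map_poly ev (Q j) => E.
    have szPe : size (map_poly ev P) = d.+1 by rewrite size_map_poly_id0 // (monicP Pmonic) rmorph1 oner_eq0.
    have [q0|q0] := eqVneq q 0; first by rewrite E q0 mul0r add0r.
    have : size (q * map_poly ev P) = size ('X^j - map_poly ev (m j)).
      by rewrite E addrK.
    have sz1 : (size ('X^j - map_poly ev (m j))%R <= d)%N.
      apply: leq_trans (size_polyD _ _) _; rewrite geq_max size_polyXn ltn_ord.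
      by rewrite size_polyN (leq_trans (size_poly _ _)).
    have Pe0 : map_poly ev P != 0 by rewrite -size_poly_eq0 szPe.
    rewrite size_mul // szPe addnS /= => sq.
    by move: sz1; rewrite -sq -{2}[d]add0n leq_add2r leqn0 size_poly_eq0 (negPf q0).
  have : ev (\det M) = 0 by apply: evII.
  rewrite -det_map_mx (_ : map_mx ev M = 1%:M) ?det1; first by apply/eqP; rewrite oner_eq0.
  apply/matrixP => j k; rewrite !mxE -coef_map evm coefXn.
  by rewrite eq_sym.
(* [D] is an ideal of K[T] because [ev] is onto. An element of least degree generates it and is not
   constant by [D1], so it has a root, which is the required lift. *)
have [g [Dg g0 gmin]] : exists g, [/\ D g, g != 0 &
    forall h, D h -> h != 0 -> (size g <= size h)%N].
  have Dex : exists s, `[< exists g, [/\ D g, g != 0 & size g = s] >].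
    exists (size (map_poly ev P)); apply/asboolP; exists (map_poly ev P); split=> //.
      by exists P.
    by rewrite map_poly_eq0_id0 ?monic_neq0 // (monicP Pmonic) rmorph1 oner_eq0.
  have [s /asboolP[g [Dg g0 <-]] smin] := ex_minnP Dex.
  exists g; split => // h Dh h0; apply: smin; apply/asboolP; by exists h.
have gdvd h : D h -> g %| h.
  move=> Dh; rewrite /dvdp; apply/negPn/negP => r0.
  have := gmin (h %% g); rewrite leqNgt ltn_modp g0 /= => /(_ _ r0) H.
  suff : false by []. apply: H.
  have -> : h %% g = h - (h %/ g) * g by rewrite {2}(divp_eq h g) addrC addKr.
  exact: DP.
have sg : size g != 1%N.
  apply/eqP => /eqP/size_poly1P[c c0 gE]; apply: D1.
  have -> : 1 = 0 - (- (c^-1)%:P) * g.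
    by rewrite gE sub0r mulNr opprK -polyCM mulVf.
  by apply: DP => //; exists 0; rewrite ?rmorph0 //; case: hII.
have /closed_rootP[a ga] := sg.
exists a => f IIf; apply/eqP; rewrite -[_ == 0]/(root _ a).
by rewrite -dvdp_XsubCl; apply: (@dvdp_trans _ g); [rewrite dvdp_XsubCl|apply: gdvd; exists f].
Qed.

End Nullstellensatz.

Section HomogeneousNullstellensatz.
Local Open Scope classical_set_scope.
Local Notation widen := (widen_ord (leqnSn _)).

Definition mnm_restr n (m : multinom n.+1) : multinom n :=
  Multinom [tuple m (widen i) | i < n].

Lemma mnm_restrK n (m : multinom n.+1) :
  m = mnm_add (mnmwiden (mnm_restr m)) (mnm_muln (mnm1 ord_max) (m ord_max)).
Proof.
apply/mnmP => i; rewrite mnmDE mulmnE mnm1E.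
have [->|[j ->]] : i = ord_max \/ exists j : 'I_n, i = widen j.
    case: (unliftP ord_max i) => [j ->|->]; [right; exists j|by left].
    by apply: val_inj; exact: lift_max.
  by rewrite mnmwiden_ordmax eqxx mul1n.
rewrite mnmwiden_widen mnmE -val_eqE /= gtn_eqF //.
by rewrite mul0n addn0.
Qed.

Section LastVariable.
Variables (K : comNzRingType) (n : nat).
Implicit Types (p : {mpoly K[n.+1]}) (f : {poly {mpoly K[n]}}).

(** Undoes [muni]: the polynomial variable becomes the last variable again. It pulls an ideal in n +
    1 variables back to a set of univariate polynomials, as [elimination_lift] requires. *)
Definition meta f : {mpoly K[n.+1]} :=
  (map_poly (@mwiden n K) f).[mpolyX K (mnm1 ord_max)].

Lemma metaD f g : meta (f + g) = meta f + meta g.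
Proof. by rewrite /meta rmorphD hornerD. Qed.

Lemma metaM f g : meta (f * g) = meta f * meta g.
Proof. by rewrite /meta rmorphM hornerM. Qed.

Lemma metaC (r : {mpoly K[n]}) : meta r%:P = mwiden r.
Proof. by rewrite /meta map_polyC hornerC. Qed.

Lemma muniK : cancel (@muni n K) meta.
Proof.
move=> p; rewrite {2}[p]mpolyE muniE /meta (raddf_sum (map_poly _)) horner_sum.
apply: eq_bigr => m _; rewrite /= map_polyZ /= map_polyXn hornerZ hornerXn.
rewrite mwidenZ mwidenX -scalerAl mpolyXn -mpolyXD -mnm_restrK //.
Qed.

Lemma meval_muni (x : 'I_n.+1 -> K) p :
  p.@[x] = (map_poly (meval (fun i => x (widen i))) (muni p)).[x ord_max].
Proof.
rewrite {1}[p]mpolyE muniE (raddf_sum (map_poly _)) (raddf_sum (meval _)) horner_sum.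
apply: eq_bigr => m _; rewrite /= map_polyZ /= map_polyXn hornerZ hornerXn.
rewrite !mevalZ !mevalX big_ord_recr /= mulrA; congr (_ * _ * _).
by apply: eq_bigr => i _; rewrite mnmE.
Qed.

End LastVariable.

Definition homog_ideal (K : comNzRingType) n (I : set {mpoly K[n]}) :=
  ideal_set I /\ forall p d, I p -> I (pihomog mdeg d p).

Lemma pihomog_mwiden (K : comNzRingType) n d (p : {mpoly K[n]}) :
  pihomog mdeg d (mwiden p) = mwiden (pihomog mdeg d p).
Proof.
have dm m : mdeg (@mnmwiden n m) = mdeg m.
  rewrite !mdegE big_ord_recr /= mnmwiden_ordmax addn0.
  by apply: eq_bigr => i _; rewrite mnmwiden_widen.
rewrite {1}[p]mpolyE (raddf_sum (@mwiden _ _)) (raddf_sum (pihomog mdeg d)) /=.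
rewrite [pihomog _ _ p]pihomogE (raddf_sum (@mwiden _ _)) [RHS]big_mkcond /=.
apply: eq_bigr => m _; rewrite mwidenZ mwidenX linearZ /= pihomogX /= dm.
by case: ifP => _; rewrite ?scaler0.
Qed.

Lemma mnm_last n d (m : multinom n.+1) : mdeg m = d ->
  (forall i, i != ord_max -> m i = 0%N) -> m = mnm_muln (mnm1 ord_max) d.
Proof.
rewrite mdegE (bigD1 ord_max) //= => + m0; rewrite big1 ?addn0 => [md|]; last by [].
apply/mnmP => i; rewrite mulmnE mnm1E.
have [->|im] := eqVneq i ord_max; first by rewrite mul1n.
by rewrite m0 // mul0n.
Qed.

Lemma mnm_last_le n d (m : multinom n.+1) : mdeg m = d ->
  (m ord_max <= d)%N /\ (m ord_max = d -> m = mnm_muln (mnm1 ord_max) d).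
Proof.
move=> md; have := md; rewrite mdegE (bigD1 ord_max) //= => E.
split; first by rewrite -E leq_addr.
move=> md'; apply: mnm_last => // i im; move: E; rewrite md' -[RHS]addn0 => /addnI/eqP.
by rewrite sum_nat_eq0 => /forallP/(_ i); rewrite im /= => /eqP.
Qed.

(** In a form of degree d, the coefficient of the d-th power of the last variable has degree 0, so
    it is a scalar and can be divided out. *)
Lemma muni_homog_monic (K : fieldType) n d (P : {mpoly K[n.+1]}) :
  let c := mcoeff (mnm_muln (mnm1 ord_max) d) P in
  homogeneous d P -> c != 0 -> (mpolyC n c^-1)%:P * muni P \is monic.
Proof.
move=> c Pd c0.
have coefP k : (muni P)`_k = \sum_(m <- msupp P)
    mcoeff m P *: mpolyX K (mnm_restr m) * (k == m ord_max)%:R.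
  rewrite muniE coef_sum; apply: eq_bigr => m _.
  by rewrite coefZ coefXn.
have Pd_m m : m \in msupp P -> mdeg m = d by move=> mP; have /dhomogP := Pd; apply.
have fd : (muni P)`_d = mpolyC n c.
  rewrite coefP; transitivity (\sum_(m <- msupp P) (m == mnm_muln (mnm1 ord_max) d)%:R * mpolyC n c).
    apply: eq_big_seq => m /Pd_m/mnm_last_le[md1 md2].
    have [md|md] := eqVneq d (m ord_max); last first.
      rewrite mulr0; case: eqP => [E|_]; last by rewrite mul0r.
      by rewrite E mulmnE mnm1E eqxx mul1n eqxx in md.
    rewrite -md2 // eqxx mul1r mulr1 /c -md2 //.
    rewrite (_ : mnm_restr m = mnm0); last first.
      apply/mnmP => i; rewrite mnmE mnm0E md2 // mulmnE mnm1E -val_eqE /=.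
      by rewrite gtn_eqF.
    by rewrite mpolyX0 -alg_mpolyC.
  rewrite -mulr_suml (bigID (pred1 (mnm_muln (mnm1 ord_max) d))) /=.
  rewrite (eq_bigr (fun=> 1)); last by move=> m /eqP->; rewrite eqxx.
  rewrite [X in _ + X]big1 ?addr0; last by move=> m /negPf->.
  rewrite -big_filter filter_pred1_uniq ?msupp_uniq ?big_seq1 ?mul1r //.
  by rewrite mcoeff_msupp.
have szf : size (muni P) = d.+1.
  apply/eqP; rewrite eqn_leq; apply/andP; split.
    apply/leq_sizeP => k dk; rewrite coefP big_seq big1 // => m /Pd_m/mnm_last_le[md _].
    by rewrite gtn_eqF ?mulr0 // (leq_ltn_trans md).
  rewrite ltnNge; apply/negP => /leq_sizeP/(_ d (leqnn d))/eqP.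
  by rewrite fd mpolyC_eq0 (negPf c0).
rewrite monicE lead_coefE mul_polyC coefZ size_scale ?mpolyC_eq0 ?invr_eq0 //.
by rewrite szf fd -mpolyCM mulVf.
Qed.

(** Induction on the number of variables. A zero of the contraction to the first n variables lifts
    to a zero of [I], hence is 0; so these variables lie in the radical, and a form of [I] monic in
    the last variable brings in that one too. *)
Theorem homog_nullstellensatz (K : closedFieldType) n (I : set {mpoly K[n]}) :
    homog_ideal I ->
    (forall x : 'I_n -> K, (forall p, I p -> p.@[x] = 0) -> forall i, x i = 0) ->
  forall i, exists N, I (mpolyX K (mnm1 i) ^+ N).
Proof.
elim: n I => [|n IH] I [idI homI] I0 i; first by case: i.
have [P [d [IP Pd Pc]]] : exists P d, [/\ I P, homogeneous d P &
    mcoeff (mnm_muln (mnm1 ord_max) d) P != 0].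
  (* The point (0, ..., 0, 1) is not a common zero of [I]. A homogeneous component not vanishing
     there contains a pure power of the last variable. *)
  pose e (i : 'I_n.+1) : K := (i == ord_max)%:R.
  have [p [Ip pe]] : exists p, I p /\ p.@[e] <> 0.
    apply: contrapT => H; have := I0 e _ ord_max.
    rewrite /e eqxx => /(_ _)/eqP; rewrite oner_eq0 -/e.
    move=> H'; suff: false by []; apply: H' => p Ip.
    by apply: contrapT => pe; apply: H; exists p.
  have [d ped] : exists d, (pihomog mdeg d p).@[e] != 0.
    apply: contrapT => H; apply: pe.
    rewrite (pihomog_partitionE (leqnn (msize p))) (raddf_sum (meval e)) big1 // => d _.
    by apply/eqP; apply: contrapT => /negP pd; apply: H; exists d.
  exists (pihomog mdeg d p), d; split; [exact: homI|exact: pihomogP|].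
  apply: contraNneq ped => c0; rewrite mevalE big_seq big1 // => m mp.
  have md : mdeg m = d by have /dhomogP := pihomogP mdeg d p; apply.
  have [/forallP m0|] := boolP [forall i, (i != ord_max) ==> (m i == 0%N)].
    rewrite (mnm_last md) ?c0 ?mul0r // => i' im.
    by have := m0 i'; rewrite im => /eqP.
  rewrite negb_forall => /existsP[j]; rewrite negb_imply => /andP[jm mj].
  by rewrite (bigD1 j) //= /e (negPf jm) expr0n (negPf mj) mul0r mulr0.
pose J : set {mpoly K[n]} := [set p | I (mwiden p)].
have idJ : ideal_set J.
  split=> [|p q r]; rewrite /J /= ?mwiden0 ?mwidenD ?mwidenM; first by case: idI.
  by case: idI => _; apply.
have rI := radical_ideal idI.
have wi (j : 'I_n) : radical_set I (mpolyX K (mnm1 (widen j))).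
  have [| |N] := IH J _ _ j.
  - by split => // p d'; rewrite /J /= -pihomog_mwiden; apply: homI.
  - move=> x' x'0; pose f := (mpolyC n (mcoeff (mnm_muln (mnm1 ord_max) d) P)^-1)%:P * muni P.
    have [| | | | |a aP] := @elimination_lift _ _ (meval x') [set f | I (meta f)] f.
    + by move=> c; exists (mpolyC n c); exact: mevalC.
    + split=> [|p q r] /=; rewrite ?metaD ?metaM ?/meta ?rmorph0 ?horner0; first by case: idI.
      by case: idI => _; apply.
    + by rewrite /= /f metaM muniK; apply: idealM.
    + exact: muni_homog_monic.
    + by move=> r /=; rewrite metaC => Jr; apply: x'0.
    pose x (i : 'I_n.+1) := oapp x' a (unlift ord_max i).
    have xw k : x (widen k) = x' k.
      rewrite /x (_ : widen k = lift ord_max k) ?liftK //.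
      by apply: val_inj; rewrite /= /bump leqNgt ltn_ord.
    move=> k; rewrite -xw; apply: I0 => p Ip; rewrite meval_muni.
    have -> : x ord_max = a by rewrite /x unlift_none.
    rewrite -(aP (muni p)) /= ?muniK //; congr (_.[a]).
    by apply: eq_map_poly => q; apply: meval_eq => k'; rewrite xw.
  - by rewrite /J /= rmorphXn /= mwidenX mnmwiden1; exists N.
suff : radical_set I (mpolyX K (mnm1 i)) by [].
case: (unliftP ord_max i) => [j ->|->].
  by have := wi j; congr (radical_set I (mpolyX K (mnm1 _))); apply: val_inj; rewrite /= /bump leqNgt ltn_ord.
set c := mcoeff _ P in Pc.
have Pr : radical_set I P by exists 1%N.
(* Every other monomial of P contains one of the first n variables, already known to lie in the
   radical. *)
have [N XN] : radical_set I (mpolyX K (mnm1 ord_max) ^+ d).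
  pose M := mnm_muln (@mnm1 n.+1 ord_max) d.
  have -> : mpolyX K (mnm1 ord_max) ^+ d = mpolyC _ c^-1 * (P - (P - c *: mpolyX K M)).
    rewrite opprB addrC subrK mul_mpolyC scalerA mulVf // scale1r.
    by rewrite mpolyXn.
  apply: idealM => //; apply: idealD => //; apply: idealN => //.
  have -> : P - c *: mpolyX K M = \sum_(m <- msupp P | m != M) mcoeff m P *: mpolyX K m.
    rewrite {1}[P]mpolyE (bigID (pred1 M)) /= -big_filter filter_pred1_uniq ?msupp_uniq //.
      by rewrite big_seq1 -[mcoeff M P]/c addrAC subrr add0r.
    by rewrite mcoeff_msupp.
  rewrite big_seq_cond; apply: ideal_sum => // m /andP[mP mM].
  have md : mdeg m = d by have /dhomogP := Pd; apply.
  have [j [jm mj]] : exists j, j != ord_max /\ m j != 0%N.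
    apply: contrapT => H; move/eqP: mM; apply; apply: mnm_last => // j jm.
    by apply/eqP; apply: contrapT => /negP mj; apply: H; exists j.
  rewrite -mul_mpolyC; apply: idealM => //.
  have -> : m = mnm_add (mnm_sub m (mnm1 j)) (mnm1 j).
    by rewrite submK // lep1mP.
  rewrite mpolyXD; apply: idealM => //.
  case: (unliftP ord_max j) jm => [k -> _|->]; last by rewrite eqxx.
  by have := wi k; congr (radical_set I (mpolyX K (mnm1 _))); apply: val_inj; rewrite /= /bump leqNgt ltn_ord.
by exists (d * N)%N; rewrite exprM.
Qed.

End HomogeneousNullstellensatz.

(** * Certificates with integral coefficients *)

Section IntegralCertificate.
Local Open Scope classical_set_scope.

Lemma common_denominator (I : finType) (c : I -> rat) :
  exists2 M : int, M != 0 & forall i, exists z : int, M%:~R * c i = z%:~R.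
Proof.
exists (\prod_i denq (c i)); first by apply/prodf_neq0 => i _; rewrite denq_eq0.
move=> i; exists (\prod_(j | j != i) denq (c j) * numq (c i)).
rewrite (bigD1 i) //= !intrM numqE.
by rewrite mulrC mulrA mulrC.
Qed.

(** Comparing coefficients gives a linear system with rational data. Membership in a row space is
    insensitive to field extension, so a solution over K yields one over Q, whose denominators are
    cleared by M. *)
Lemma int_span_descent (K : numFieldType) n (I : finType)
    (Q : I -> {mpoly int[n]}) (q : {mpoly int[n]}) (a : I -> K) :
    map_mpoly intr q = \sum_i a i *: map_mpoly intr (Q i) ->
  exists M (z : I -> int), M != 0 /\ M *: q = \sum_i z i *: Q i.
Proof.
move=> qE; pose b := maxn (msize q) (\max_i msize (Q i)).
pose cf (p : {mpoly int[n]}) : 'rV[rat]_#|{: bmultinom n b}| :=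
  \row_k (mcoeff (val (enum_val k)) p)%:~R.
pose A : 'M[rat]_(#|I|, #|{: bmultinom n b}|) :=
  \matrix_(j, k) cf (Q (enum_val j)) 0 k.
have : (cf q <= A)%MS.
  rewrite -(map_submx (@ratr K)); apply/submxP.
  exists (\row_j a (enum_val j)); apply/rowP => k; rewrite !mxE /= ratr_int.
  rewrite -mcoeff_map_mpoly qE (raddf_sum (mcoeff _)) (reindex_onto enum_val enum_rank) /=; last first.
    by move=> i _; rewrite enum_rankK.
  rewrite (eq_bigl predT); last by move=> i; rewrite enum_valK eqxx.
  by apply: eq_bigr => j _; rewrite mcoeffZ mcoeff_map_mpoly !mxE /= ratr_int.
move=> /submxP[u uE].
pose c i := u 0 (enum_rank i).
have [M M0 /choice[z zP]] := common_denominator c.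
exists M, z; split => //; apply/mpolyP => m.
have [mb|bm] := ltnP (mdeg m) b; last first.
  rewrite !memN_msupp_eq0 //; apply: contraL bm; rewrite -ltnNge.
    move=> /(msupp_sum_le (F := fun i => z i *: Q i))/flattenP[/= _ /mapP[i _ ->]].
    move=> /msuppZ_le/msize_mdeg_lt/leq_trans; apply.
    by rewrite leq_max; apply/orP; right; apply: (leq_bigmax i).
  by move=> /msuppZ_le/msize_mdeg_lt/leq_trans; apply; rewrite leq_maxl.
apply: (@intr_inj rat); rewrite mcoeffZ (raddf_sum (mcoeff m)) rmorphM rmorph_sum /=.
have /rowP/(_ (enum_rank (BMultinom mb))) := uE; rewrite !mxE enum_rankK /= => ->.
rewrite mulr_sumr (reindex_onto enum_rank enum_val) /=; last first.
  by move=> i _; rewrite enum_valK.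
rewrite (eq_bigl predT); last by move=> i; rewrite enum_rankK eqxx.
apply: eq_bigr => i _; rewrite !mxE !enum_rankK /= mulrA -/(c i) zP.
by rewrite mcoeffZ rmorphM.
Qed.

Lemma pihomogM (K : comNzRingType) n d e (p q : {mpoly K[n]}) : homogeneous e q ->
  pihomog mdeg d (p * q) = if (e <= d)%N then pihomog mdeg (d - e) p * q else 0.
Proof.
move=> qe; rewrite {1}[p]mpolyE mulr_suml (raddf_sum (pihomog mdeg d)) /=.
have E m : pihomog mdeg d (mcoeff m p *: mpolyX K m * q) =
    if mdeg m + e == d then mcoeff m p *: mpolyX K m * q else 0.
  have hm : homogeneous (mdeg m + e) (mcoeff m p *: mpolyX K m * q).
    by apply: dhomogM => //; apply: dhomogZ; rewrite dhomogX.
  have [<-|md] := eqVneq (mdeg m + e)%N d; first exact: pihomog_dE.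
  exact: pihomog_ne0 md hm.
under eq_bigr => m _ do rewrite E.
rewrite -big_mkcond /=; case: leqP => [ed|de].
  rewrite pihomogE mulr_suml; apply: eq_bigl => m.
  by rewrite -[in RHS](eqn_add2r e) subnK.
rewrite big_pred0 // => m; apply/negbTE; apply: contraL de => /eqP <-.
by rewrite -leqNgt leq_addl.
Qed.

(** The Nullstellensatz over K gives cofactors; their coefficients are treated as unknowns and made
    integral by [int_span_descent]. The degrees recorded here are what the point count later depends
    on. *)
Lemma integral_certificate (K : numClosedFieldType) n (T : finType)
    (P : T -> {mpoly int[n]}) (d : T -> nat) :
    (forall j, homogeneous (d j) (P j)) ->
    (forall x : 'I_n -> K, (forall j, (map_mpoly intr (P j)).@[x] = 0) ->
       forall i, x i = 0) ->
  forall i, exists N M (A : T -> {mpoly int[n]}), [/\ M != 0,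
    (forall j, (A j == 0) || (d j <= N)%N && (A j \is ishomog1 (N - d j) mdeg)) &
    M *: mpolyX int (mnm1 i) ^+ N = \sum_j A j * P j].
Proof.
move=> hP P0 i.
pose PK j : {mpoly K[n]} := map_mpoly intr (P j).
have hPK j : homogeneous (d j) (PK j) by apply: map_homog.
pose I := [set p | exists A : T -> {mpoly K[n]}, p = \sum_j A j * PK j].
have hI : homog_ideal I.
  split; first split.
  - by exists (fun=> 0); rewrite big1 // => j _; rewrite mul0r.
  - move=> p q r [A ->] [B ->]; exists (fun j => A j + r * B j).
    by rewrite mulr_sumr -big_split /=; apply: eq_bigr => j _; rewrite mulrDl mulrA.
  - move=> p e [A ->]; exists (fun j => if (d j <= e)%N then pihomog mdeg (e - d j) (A j) else 0).
    rewrite (raddf_sum (pihomog mdeg e)); apply: eq_bigr => j _.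
    by rewrite /= (pihomogM _ _ (hPK j)); case: ifP; rewrite // mul0r.
have IPK j : I (PK j).
  exists (fun k => (k == j)%:R); rewrite (bigD1 j) //= eqxx mul1r big1 ?addr0 //.
  by move=> k /negPf->; rewrite mul0r.
have PK0 (x : 'I_n -> K) : (forall p, I p -> p.@[x] = 0) -> forall i, x i = 0.
  by move=> Ix i'; apply: P0 => j; exact: Ix (IPK j).
have [N [A AE]] := homog_nullstellensatz hI PK0 i.
pose b := \max_j msize (A j).
have [|M [z [M0 zE]]] := @int_span_descent K n (T * bmultinom n b)%type
  (fun jm => mpolyX int (val jm.2) * P jm.1) (mpolyX int (mnm1 i) ^+ N)
  (fun jm => mcoeff (val jm.2) (A jm.1)).
  rewrite rmorphXn /= map_mpolyX AE.
  rewrite -(pair_bigA _ (fun j m => mcoeff (val m) (A j) *: map_mpoly intr (mpolyX int (val m) * P j))) /=.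
  apply: eq_bigr => j _; rewrite {1}[A j](@mpolywE _ _ b); last exact: (leq_bigmax j).
  rewrite mulr_suml; apply: eq_bigr => m _.
  by rewrite rmorphM /= map_mpolyX scalerAl.
pose A' j := \sum_m z (j, m) *: mpolyX int (val m).
have A'E : M *: mpolyX int (mnm1 i) ^+ N = \sum_j A' j * P j.
  rewrite zE; transitivity (\sum_j \sum_m z (j, m) *: (mpolyX int (val m) * P j)).
    by rewrite pair_bigA; apply: eq_bigr => -[].
  by apply: eq_bigr => j _; rewrite mulr_suml; apply: eq_bigr => m _; rewrite scalerAl.
(* Taking the component of degree N of the identity makes the cofactors homogeneous; those attached
   to a form of degree above N disappear. *)
exists N, M, (fun j => if (d j <= N)%N then pihomog mdeg (N - d j) (A' j) else 0).
split => // [j|]; first by case: ifP => //= _; rewrite ?eqxx // pihomogP orbT.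
have /(congr1 (pihomog mdeg N)) := A'E.
rewrite pihomog_dE; last first.
  by apply: dhomogZ; rewrite mpolyXn dhomogX /= mdegMn mdeg1 mul1n.
move=> ->; rewrite (raddf_sum (pihomog mdeg N)); apply: eq_bigr => j _.
by rewrite /= (pihomogM _ _ (hP j)); case: ifP; rewrite // mul0r.
Qed.

End IntegralCertificate.

(** * Cubic forms and their polarisations *)

Section CubicTensors.

(** No symmetry is imposed: the coefficient of a monomial is put at one ordered triple of indices,
    so that no denominators occur. *)
Definition tensor n := 'I_n -> 'I_n -> 'I_n -> int.

Definition mpoly_of_tensor n (c : tensor n) : {mpoly int[n]} :=
  \sum_i \sum_j \sum_k
    c i j k *: (mpolyX int (mnm1 i) * mpolyX int (mnm1 j) * mpolyX int (mnm1 k)).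

Lemma cubic_tensor n (F : {mpoly int[n]}) : homogeneous 3 F ->
  exists c, F = mpoly_of_tensor c.
Proof.
move=> hF.
have mon m : mdeg m = 3%N -> exists i j k : 'I_n,
    m = mnm_add (mnm_add (mnm1 i) (mnm1 j)) (mnm1 k).
  have pick m' d : mdeg m' = d.+1 -> exists i m'', m' = mnm_add m'' (mnm1 i) /\ mdeg m'' = d.
    move=> md; have [i mi] : exists i, m' i != 0%N.
      apply: contrapT => H; have : mdeg m' == 0%N.
        rewrite mdeg_eq0; apply/eqP/mnmP => i; rewrite mnm0E.
        by have [//|mi] := eqVneq (m' i) 0%N; case: H; exists i.
      by rewrite md.
    exists i, (mnm_sub m' (mnm1 i)).
    have E : m' = mnm_add (mnm_sub m' (mnm1 i)) (mnm1 i) by rewrite submK // lep1mP.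
    split => //; have := congr1 mdeg E; rewrite mdegD mdeg1 md addn1 => -[].
    by move->.
  move=> /pick[k [m1 [-> /pick[j [m2 [-> /pick[i [m3 [-> /eqP]]]]]]]]].
  rewrite mdeg_eq0 => /eqP->; exists i, j, k; congr (mnm_add (mnm_add _ _) _).
  by apply/mnmP => a; rewrite mnmDE mnm0E.
suff [c cE] : exists c, \sum_(m <- msupp F) mcoeff m F *: mpolyX int m = mpoly_of_tensor c.
  by exists c; rewrite -cE -mpolyE.
have : {subset msupp F <= [pred m | mdeg m == 3%N]}.
  by move=> m mF; apply/eqP; have /dhomogP := hF; apply.
elim: (msupp F) => [|m s IH] hs.
  exists (fun _ _ _ => 0); rewrite big_nil /mpoly_of_tensor.
  by do 3!(rewrite big1 // => ? _); rewrite scale0r.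
have [|c cE] := IH; first by move=> m' m's; apply: hs; rewrite inE m's orbT.
have [|i0 [j0 [k0 mE]]] := mon m; first by apply/eqP/hs; rewrite inE eqxx.
exists (fun i j k => mcoeff m F * ((i == i0) && (j == j0) && (k == k0))%:R + c i j k).
rewrite big_cons cE /mpoly_of_tensor.
under [RHS]eq_bigr => i _ do under eq_bigr => j _ do under eq_bigr => k _ do rewrite scalerDl.
under [RHS]eq_bigr => i _ do under eq_bigr => j _ do rewrite big_split.
under [RHS]eq_bigr => i _ do rewrite big_split.
rewrite big_split /=; congr (_ + _).
rewrite (bigD1 i0) //= [X in _ + X]big1 ?addr0; last first.
  move=> i /negPf ii; do 2!(rewrite big1 // => ? _).
  by rewrite ii mulr0 scale0r.
rewrite (bigD1 j0) //= [X in _ + X]big1 ?addr0; last first.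
  by move=> j /negPf jj; rewrite big1 // => ? _; rewrite jj andbF mulr0 scale0r.
rewrite (bigD1 k0) //= [X in _ + X]big1 ?addr0; last first.
  by move=> k /negPf kk; rewrite kk andbF mulr0 scale0r.
by rewrite !eqxx mulr1 mE !mpolyXD.
Qed.

Section Forms.
Variables (K : comNzRingType) (n : nat) (c : tensor n).
Implicit Types x y z h : 'I_n -> K.

Definition cub x : K := \sum_i \sum_j \sum_k (c i j k)%:~R * (x i * x j * x k).

(** Full polarisation of [cub]: the six orders of the three arguments are summed and not averaged,
    so [tri x x x] is [6 * cub x] and integrality is kept. *)
Definition tri x y z : K := \sum_i \sum_j \sum_k (c i j k)%:~R *
  (x i * (y j * z k + z j * y k) + x j * (y i * z k + z i * y k)
   + x k * (y i * z j + z i * y j)).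

Definition unitv (l : 'I_n) : 'I_n -> K := fun i => (i == l)%:R.

Definition bil h k l : K := tri (unitv l) h k.

Lemma sum3_eq (f g : 'I_n -> 'I_n -> 'I_n -> K) : (forall i j k, f i j k = g i j k) ->
  \sum_i \sum_j \sum_k f i j k = \sum_i \sum_j \sum_k g i j k.
Proof. by move=> E; do 3!(apply: eq_bigr => ? _). Qed.

Lemma sum3D (f g : 'I_n -> 'I_n -> 'I_n -> K) :
  \sum_i \sum_j \sum_k f i j k + \sum_i \sum_j \sum_k g i j k =
  \sum_i \sum_j \sum_k (f i j k + g i j k).
Proof.
rewrite -big_split; apply: eq_bigr => i _; rewrite -big_split.
by apply: eq_bigr => j _; rewrite -big_split.
Qed.

Lemma sum3M a (f : 'I_n -> 'I_n -> 'I_n -> K) :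
  a * \sum_i \sum_j \sum_k f i j k = \sum_i \sum_j \sum_k a * f i j k.
Proof.
rewrite mulr_sumr; apply: eq_bigr => i _; rewrite mulr_sumr.
by apply: eq_bigr => j _; rewrite mulr_sumr.
Qed.

Lemma sum3N (f : 'I_n -> 'I_n -> 'I_n -> K) :
  - \sum_i \sum_j \sum_k f i j k = \sum_i \sum_j \sum_k - f i j k.
Proof. by rewrite -mulN1r sum3M; apply: sum3_eq => i j k; rewrite mulN1r. Qed.

Lemma sum3_exchange (f : 'I_n -> 'I_n -> 'I_n -> 'I_n -> K) :
  \sum_l \sum_i \sum_j \sum_k f l i j k = \sum_i \sum_j \sum_k \sum_l f l i j k.
Proof.
rewrite exchange_big; apply: eq_bigr => i _; rewrite exchange_big.
by apply: eq_bigr => j _; rewrite exchange_big.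
Qed.

Lemma tri_polar x h k :
  cub (fun i => x i + h i + k i) - cub (fun i => x i + h i)
    - cub (fun i => x i + k i) + cub x =
  tri x h k + (cub (fun i => h i + k i) - cub h - cub k).
Proof.
by rewrite /cub /tri !sum3N !sum3D; apply: sum3_eq => i j l; ring.
Qed.

Lemma tri_bil x h k : tri x h k = \sum_l x l * bil h k l.
Proof.
have unitE i : x i = \sum_l x l * unitv l i.
  rewrite (bigD1 i) //= /unitv eqxx mulr1 big1 ?addr0 // => j /negPf.
  by rewrite eq_sym => ->; rewrite mulr0.
under [RHS]eq_bigr => l _ do rewrite /bil /tri sum3M.
rewrite sum3_exchange; apply: sum3_eq => i j l.
rewrite [x i]unitE [x j]unitE [x l]unitE !mulr_suml -!big_split mulr_sumr /=.
by apply: eq_bigr => a _; ring.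
Qed.

Lemma bilBr h k k' l : bil h (fun i => k i - k' i) l = bil h k l - bil h k' l.
Proof.
by rewrite /bil /tri sum3N sum3D; apply: sum3_eq => i j m; ring.
Qed.

Lemma bilC h k l : bil h k l = bil k h l.
Proof. by rewrite /bil /tri; apply: sum3_eq => i j m; ring. Qed.

Lemma bilBl h h' k l : bil (fun i => h i - h' i) k l = bil h k l - bil h' k l.
Proof. by rewrite bilC bilBr !(bilC k). Qed.

Lemma bilZr a h k l : bil h (fun i => a * k i) l = a * bil h k l.
Proof. by rewrite /bil /tri sum3M; apply: sum3_eq => i j m; ring. Qed.

Lemma bil_unitv h k l : bil h k l = \sum_m k m * bil h (unitv m) l.
Proof.
transitivity (tri k (unitv l) h).
  by rewrite /bil /tri; apply: sum3_eq => i j m; ring.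
rewrite tri_bil; apply: eq_bigr => m _; congr (_ * _).
by rewrite /bil /tri; apply: sum3_eq => i j a; ring.
Qed.

Lemma euler_tensor x : 6%:R * cub x = \sum_l x l * bil x x l.
Proof. by rewrite -tri_bil /cub /tri sum3M; apply: sum3_eq => i j k; ring. Qed.

Lemma meval_tensor x : (map_mpoly intr (mpoly_of_tensor c)).@[x] = cub x.
Proof.
rewrite /mpoly_of_tensor /cub (raddf_sum (map_mpoly _)) (raddf_sum (meval x)).
apply: eq_bigr => i _; rewrite (raddf_sum (map_mpoly _)) (raddf_sum (meval x)).
apply: eq_bigr => j _; rewrite (raddf_sum (map_mpoly _)) (raddf_sum (meval x)).
apply: eq_bigr => k _; rewrite /= map_mpolyZ !rmorphM /= !map_mpolyX mevalZ.
by rewrite !mevalM !mevalXU.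
Qed.

Lemma meval_deriv_tensor x l :
  2%:R * (map_mpoly intr (mderiv l (mpoly_of_tensor c))).@[x] = bil x x l.
Proof.
rewrite /mpoly_of_tensor (raddf_sum (mderiv l)) (raddf_sum (map_mpoly _)) (raddf_sum (meval x)).
rewrite mulr_sumr; apply: eq_bigr => i _.
rewrite (raddf_sum (mderiv l)) (raddf_sum (map_mpoly _)) (raddf_sum (meval x)).
rewrite mulr_sumr; apply: eq_bigr => j _.
rewrite (raddf_sum (mderiv l)) (raddf_sum (map_mpoly _)) (raddf_sum (meval x)).
rewrite mulr_sumr; apply: eq_bigr => k _.
have dX a : (map_mpoly intr (mderiv l (mpolyX int (mnm1 a)))).@[x] = unitv l a :> K.
  rewrite mderivX map_mpolyZ map_mpolyX mevalZ mnm1E /unitv.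
  case: eqP => [->|_]; last by rewrite mul0r.
  rewrite mul1r (_ : mnm_sub (mnm1 l) (mnm1 l) = mnm0) ?mpolyX0 ?meval1 //.
  by apply/mnmP => b; rewrite mnmBE mnm0E subnn.
have ED p q : (map_mpoly intr (p + q)).@[x] =
    (map_mpoly intr p).@[x] + (map_mpoly intr q).@[x] :> K.
  by rewrite rmorphD mevalD.
have EM p q : (map_mpoly intr (p * q)).@[x] =
    (map_mpoly intr p).@[x] * (map_mpoly intr q).@[x] :> K.
  by rewrite rmorphM mevalM.
have EX a : (map_mpoly intr (mpolyX int (mnm1 a))).@[x] = x a :> K.
  by rewrite map_mpolyX mevalXU.
rewrite /= mderivZ !mderivM map_mpolyZ mevalZ !(ED, EM, dX, EX) /=.
by ring.
Qed.

End Forms.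

Lemma bil_intr (K : comNzRingType) n (c : tensor n) (h k : 'I_n -> int) l :
  bil c (fun i => (h i)%:~R) (fun i => (k i)%:~R) l = (bil c h k l)%:~R :> K.
Proof.
rewrite /bil /tri rmorph_sum; apply: eq_bigr => i _; rewrite rmorph_sum.
apply: eq_bigr => j _; rewrite rmorph_sum; apply: eq_bigr => m _.
have uE a : unitv K l a = (unitv int l a)%:~R by rewrite /unitv; case: eqP.
by rewrite /= !uE !(intrM, intrD) intz.
Qed.

Lemma bil_bound n (c : tensor n) : exists C : nat, forall (h k : 'I_n -> int) l (H Q : nat),
  (forall i, `|h i| <= H%:Z) -> (forall i, `|k i| <= Q%:Z) ->
  `|bil c h k l| <= (C * H * Q)%N%:Z.
Proof.
exists (\sum_i \sum_j \sum_k `|c i j k| * 6)%N => h k l H Q hH kQ.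
rewrite -mulnA -natz natrM natr_sum mulr_suml.
apply: le_trans (ler_norm_sum _ _ _) _; apply: ler_sum => i _.
rewrite natr_sum mulr_suml.
apply: le_trans (ler_norm_sum _ _ _) _; apply: ler_sum => j _.
rewrite natr_sum mulr_suml.
apply: le_trans (ler_norm_sum _ _ _) _; apply: ler_sum => m _.
rewrite normrM intz natrM natz abszE -mulrA; apply: ler_wpM2l => //.
have u1 a : `|unitv int l a| <= 1 by rewrite /unitv; case: eqP.
have term a b d : `|unitv int l a * (h b * k d + k b * h d)| <= 2%:R * (H * Q)%N%:R.
  rewrite normrM -[leRHS]mul1r; apply: ler_pM => //.
  apply: le_trans (ler_normD _ _) _; rewrite !normrM natrM !natz.
  have h1 := ler_pM (normr_ge0 _) (normr_ge0 _) (hH b) (kQ d).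
  have h2 := ler_pM (normr_ge0 _) (normr_ge0 _) (kQ b) (hH d).
  apply: le_trans (lerD h1 h2) _; lia.
apply: le_trans (ler_normD _ _) _.
apply: le_trans (lerD (le_trans (ler_normD _ _) (lerD (term i j m) (term j i m))) (term m i j)) _.
by rewrite -!mulrDl.
Qed.

End CubicTensors.

(** * Counting points of grids *)

Section GridCount.
Variables (K : fieldType) (X : finType) (m : nat) (y : 'I_m -> X -> K).
Variables (J : finType) (g : J -> X -> K).

(** Functions are used in place of polynomials because the relations available hold only at the
    points of X. The number is an upper bound for a degree in the coordinates [y i]. *)
Inductive polfun : nat -> (X -> K) -> Prop :=
| polfun_const c : polfun 0 (fun=> c)
| polfun_var i : polfun 1 (y i)
| polfun_add d f1 f2 : polfun d f1 -> polfun d f2 -> polfun d (fun x => f1 x + f2 x)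
| polfun_mul d e f1 f2 : polfun d f1 -> polfun e f2 ->
    polfun (d + e) (fun x => f1 x * f2 x)
| polfun_le d e f1 : (d <= e)%N -> polfun d f1 -> polfun e f1
| polfun_ext d f1 f2 : f1 =1 f2 -> polfun d f1 -> polfun d f2.

Lemma polfun_sum (I : Type) (s : seq I) (P : pred I) d (f : I -> X -> K) :
  (forall i, P i -> polfun d (f i)) -> polfun d (fun x => \sum_(i <- s | P i) f i x).
Proof.
move=> hf; elim: s => [|i s IH].
  apply: (@polfun_ext _ (fun=> 0)); first by move=> x; rewrite big_nil.
  exact: polfun_le (leq0n _) (polfun_const 0).
case Pi: (P i); last first.
  by apply: polfun_ext IH => x; rewrite big_cons Pi.
apply: (@polfun_ext _ (fun x => f i x + \sum_(i <- s | P i) f i x)).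
  by move=> x; rewrite big_cons Pi.
by apply: polfun_add => //; apply: hf.
Qed.

Lemma polfun_prod (I : Type) (s : seq I) d (f : I -> X -> K) :
  (forall i, polfun d (f i)) -> polfun (size s * d) (fun x => \prod_(i <- s) f i x).
Proof.
move=> hf; elim: s => [|i s IH].
  apply: (@polfun_ext _ (fun=> 1)); first by move=> x; rewrite big_nil.
  exact: polfun_const.
apply: (@polfun_ext _ (fun x => f i x * \prod_(i <- s) f i x)).
  by move=> x; rewrite big_cons.
by rewrite mulSn; apply: polfun_mul.
Qed.

Lemma polfun_exp d f k : polfun d f -> polfun (k * d) (fun x => f x ^+ k).
Proof.
move=> hf; apply: (@polfun_ext _ (fun x => \prod_(i <- iota 0 k) f x)).
  by move=> x; rewrite big_const_seq count_predT size_iota iter_mulr_1.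
by rewrite -{1}(size_iota 0 k); apply: polfun_prod.
Qed.

Lemma polfun_scale d f c : polfun d f -> polfun d (fun x => c * f x).
Proof. by move=> hf; rewrite -[d]add0n; apply: polfun_mul => //; apply: polfun_const. Qed.

Lemma polfun_sub d f1 f2 : polfun d f1 -> polfun d f2 -> polfun d (fun x => f1 x - f2 x).
Proof.
move=> h1 h2; apply: (@polfun_ext _ (fun x => f1 x + -1 * f2 x)).
  by move=> x; rewrite mulN1r.
by apply: polfun_add => //; apply: polfun_scale.
Qed.

Variable N : nat.
(** Integrality of the coordinates over the [g j], with control of degrees: each use of the relation
    trades at least one degree in the [y i] for one factor [g j]. *)
Hypothesis integral_y : forall i, exists2 e, (e < N)%N &
  exists2 B : J -> X -> K, (forall j, polfun e (B j)) &
  forall x, y i x ^+ e.+1 = \sum_j B j x * g j x.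

Let yw (w : seq 'I_m) x := \prod_(i <- w) y i x.

Inductive wordspan (d : nat) : (X -> K) -> Prop :=
| wordspan_word w : (size w <= d)%N -> wordspan d (yw w)
| wordspan_lin a f1 f2 : wordspan d f1 -> wordspan d f2 ->
    wordspan d (fun x => a * f1 x + f2 x)
| wordspan_ext f1 f2 : f1 =1 f2 -> wordspan d f1 -> wordspan d f2.

Lemma wordspan0 d : wordspan d (fun=> 0).
Proof.
apply: (@wordspan_ext _ (fun x => -1 * yw [::] x + yw [::] x)).
  by move=> x; rewrite mulN1r addNr.
by apply: wordspan_lin; apply: wordspan_word.
Qed.

Lemma wordspan_mul d e f1 f2 : wordspan d f1 -> wordspan e f2 ->
  wordspan (d + e) (fun x => f1 x * f2 x).
Proof.
move=> h1; elim: h1 f2 => {f1} [w wd|a f1 f1' _ IH1 _ IH1'|f1 f1' E _ IH] f2 h2.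
- elim: h2 => {f2} [w' we|a f2 f2' _ IH2 _ IH2'|f2 f2' E _ IH].
  + apply: (@wordspan_ext _ (yw (w ++ w'))); first by move=> x; rewrite /yw big_cat.
    by apply: wordspan_word; rewrite size_cat leq_add.
  + apply: wordspan_ext (wordspan_lin a IH2 IH2') => x.
    by rewrite mulrDr mulrCA.
  + by apply: wordspan_ext IH => x; rewrite E.
- apply: wordspan_ext (wordspan_lin a (IH1 _ h2) (IH1' _ h2)) => x.
  by rewrite mulrDl mulrA.
- by apply: wordspan_ext (IH _ h2) => x; rewrite E.
Qed.

Lemma polfun_wordspan d f : polfun d f -> wordspan d f.
Proof.
elim=> {d f} [c|i|d f1 f2 _ h1 _ h2|d e f1 f2 _ h1 _ h2|d e f de _ h|d f1 f2 E _ h].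
- apply: (@wordspan_ext _ (fun x => c * yw [::] x + 0)).
    by move=> x; rewrite /yw big_nil mulr1 addr0.
  by apply: wordspan_lin; [apply: wordspan_word|apply: wordspan0].
- apply: (@wordspan_ext _ (yw [:: i])); first by move=> x; rewrite /yw big_seq1.
  exact: wordspan_word.
- by apply: wordspan_ext (wordspan_lin 1 h1 h2) => x; rewrite mul1r.
- exact: wordspan_mul.
- elim: h => {f} [w wd|a f f' _ IH _ IH'|f f' E _ IH].
  + by apply: wordspan_word; apply: leq_trans wd de.
  + exact: wordspan_lin.
  + exact: wordspan_ext E IH.
- exact: wordspan_ext E h.
Qed.

Let bmon d (u : {ffun 'I_m -> 'I_N} * {ffun J -> 'I_d.+1}) x :=
  \prod_i y i x ^+ u.1 i * \prod_j g j x ^+ u.2 j.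

Inductive redspan (d : nat) : (X -> K) -> Prop :=
| redspan_mon (al : 'I_m -> nat) (be : J -> nat) :
    (forall i, al i < N)%N -> (forall j, be j <= d)%N ->
    redspan d (fun x => \prod_i y i x ^+ al i * \prod_j g j x ^+ be j)
| redspan0 : redspan d (fun=> 0)
| redspan_lin a f1 f2 : redspan d f1 -> redspan d f2 ->
    redspan d (fun x => a * f1 x + f2 x)
| redspan_ext f1 f2 : f1 =1 f2 -> redspan d f1 -> redspan d f2.

Lemma redspan_gen d j f : redspan d f -> redspan d.+1 (fun x => f x * g j x).
Proof.
elim=> {f} [al be hal hbe||a f1 f2 _ h1 _ h2|f1 f2 E _ h].
- apply: (redspan_ext _ (@redspan_mon _ al (fun k => be k + (k == j))%N hal _)).
    move=> x; rewrite -mulrA; congr (_ * _).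
    have -> : g j x = \prod_k g k x ^+ (k == j).
      by rewrite (bigD1 j) //= eqxx expr1 big1 ?mulr1 // => k /negPf->.
    by rewrite -big_split; apply: eq_bigr => k _; rewrite exprD.
  by move=> k; rewrite -addn1 leq_add // leq_b1.
- by apply: redspan_ext (redspan0 _) => x; rewrite mul0r.
- by apply: redspan_ext (redspan_lin a h1 h2) => x; rewrite mulrDl mulrA.
- by apply: redspan_ext h => x; rewrite E.
Qed.

Lemma redspan_sum d (f : J -> X -> K) : (forall j, redspan d (f j)) ->
  redspan d (fun x => \sum_j f j x).
Proof.
move=> hf; elim: (index_enum J) => [|j s IH].
  by apply: redspan_ext (redspan0 _) => x; rewrite big_nil.
by apply: redspan_ext (redspan_lin 1 (hf j) IH) => x; rewrite big_cons mul1r.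
Qed.

(** Induction on the degree. A word in which some letter occurs N times can be rewritten by
    [integral_y]. Since each new factor [g j] costs a degree in y, no exponent of a [g j] exceeds
    d. *)
Lemma wordspan_redspan d f : wordspan d f -> redspan d f.
Proof.
have [k] := ubnP d; elim: k d f => // k IHk d f; rewrite ltnS => dk.
elim=> {f} [w wd|a f1 f2 _ h1 _ h2|f1 f2 E _ h]; last 2 first.
- exact: redspan_lin.
- exact: redspan_ext E h.
have [small|] := boolP [forall i, (count_mem i w < N)%N].
  apply: (redspan_ext _ (@redspan_mon _ (fun i => count_mem i w) (fun=> 0%N) _ _)) => //.
    move=> x; rewrite [X in _ * X]big1 ?mulr1 /yw; last by move=> j _; rewrite expr0.
    elim: w {wd small} => [|a w IH]; first by rewrite big_nil big1.
    rewrite big_cons -IH.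
    have -> : y a x = \prod_l y l x ^+ (a == l).
      by rewrite (bigD1 a) //= eqxx expr1 big1 ?mulr1 // => l; rewrite eq_sym => /negPf->.
    by rewrite -big_split; apply: eq_bigr => l _; rewrite /= exprD.
  by move=> i; have /forallP := small; apply.
rewrite negb_forall => /existsP[ i]; rewrite -leqNgt => Ni.
have [e eN [B Bpol Beq]] := integral_y i.
have ew : (e.+1 <= count_mem i w)%N by apply: leq_trans Ni.
pose w' := nseq (count_mem i w - e.+1) i ++ seq.filter (predC (pred1 i)) w.
have ww' : perm_eq w (nseq e.+1 i ++ w').
  rewrite catA -nseqD subnKC //.
  have /all_pred1P := filter_all (pred1 i) w; rewrite size_filter => <-.
  by rewrite perm_sym perm_filterC.
have szw' : size w = (e.+1 + size w')%N.
  by rewrite (perm_size ww') size_cat size_nseq.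
have d0 : (0 < d)%N by apply: leq_trans wd; rewrite szw'.
rewrite -(prednK d0).
apply: (@redspan_ext _ (fun x => \sum_j (B j x * yw w' x) * g j x)).
  move=> x; rewrite {2}/yw (perm_big _ ww') big_cat big_nseq iter_mulr_1.
  rewrite -/(yw w' x) Beq /= mulr_suml; apply: eq_bigr => j _.
  by rewrite mulrAC.
apply: (@redspan_sum _ (fun j x => B j x * yw w' x * g j x)) => j.
apply: (@redspan_gen _ _ (fun x => B j x * yw w' x)); apply: IHk.
  by rewrite prednK.
apply: polfun_wordspan.
apply: (@polfun_le (e + size w' * 1)).
  by rewrite muln1 -ltnS prednK //; apply: leq_trans wd; rewrite szw' addSn.
by apply: polfun_mul => //; apply: polfun_prod => b; apply: polfun_var.
Qed.

(* Every function on a subset of a grid is a polynomial of degree at most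
   d = m * size S, and those are spanned by the y^al g^be with al < N, be <= d. *)
Lemma grid_count (S : seq K) :
    (forall x1 x2, (forall i, y i x1 = y i x2) -> x1 = x2) ->
    (forall i x, y i x \in S) ->
  (#|X| <= N ^ m * (m * size S).+1 ^ #|J|)%N.
Proof.
move=> y_inj yS; pose d := (m * size S)%N.
(* The Lagrange interpolant that is 1 at z and 0 at the other points of X; its degree is at most
   d. *)
pose D z x := \prod_(i <- enum 'I_m) \prod_(c <- S)
  (if c == y i z then 1 else (y i x - c) / (y i z - c)).
have Dpol z : polfun d (D z).
  rewrite /d -{1}(size_enum_ord m); apply: polfun_prod => i.
  rewrite -[size S]muln1; apply: polfun_prod => c; case: eqP => _.
    exact: polfun_le (leq0n _) (polfun_const 1).
  apply: (@polfun_ext _ (fun x => (y i z - c)^-1 * (y i x - c))).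
    by move=> x; rewrite mulrC.
  apply: polfun_scale; apply: polfun_sub; first exact: polfun_var.
  exact: polfun_le (leq0n _) (polfun_const c).
have Dxx x : D x x = 1.
  rewrite /D big1 // => i _; rewrite big1 // => c _.
  by case: eqP => // /eqP; rewrite eq_sym -subr_eq0 => /divff.
have Dzx z x : z != x -> D z x = 0.
  move=> zx; have [i yi] : exists i, y i x != y i z.
    apply: contrapT => H; move/eqP: zx; apply; apply: y_inj => i.
    by have [->|E] := eqVneq (y i x) (y i z); [|case: H; exists i].
  rewrite /D (bigD1_seq i) ?mem_enum ?enum_uniq //= (perm_big _ (perm_to_rem (yS i x))).
  by rewrite big_cons (negPf yi) subrr mul0r /= !mul0r.
have redP f : redspan d f -> exists c, forall x, f x = \sum_u c u * @bmon d u x.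
  elim=> {f} [al be hal hbe||a f1 f2 _ [c1 h1] _ [c2 h2]|f1 f2 E _ [c h]].
  - pose u : {ffun 'I_m -> 'I_N} * {ffun J -> 'I_d.+1} :=
      ([ffun i => Ordinal (hal i)], [ffun j => inord (be j)]).
    exists (fun v => (v == u)%:R) => x; rewrite (bigD1 u) //= eqxx mul1r.
    rewrite [X in _ + X]big1 ?addr0; last by move=> v /negPf->; rewrite mul0r.
    by congr (_ * _); apply: eq_bigr => k _; rewrite ffunE ?inordK ?ltnS.
  - by exists (fun=> 0) => x; rewrite big1 // => u _; rewrite mul0r.
  - exists (fun u => a * c1 u + c2 u) => x; rewrite h1 h2 mulr_sumr -big_split /=.
    by apply: eq_bigr => u _; rewrite mulrDl mulrA.
  - by exists c => x; rewrite -E.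
have /choice[c cP] : forall z, exists c, forall x, D z x = \sum_u c u * @bmon d u x.
  by move=> z; apply/redP/wordspan_redspan/polfun_wordspan.
pose U := ({ffun 'I_m -> 'I_N} * {ffun J -> 'I_d.+1})%type.
(* Expanding the interpolants over the spanning monomials factors the identity matrix of size [#|X|]
   through a space of dimension [#|{: U}|], which bounds [#|X|]. *)
pose A : 'M[K]_(#|X|, #|{: U}|) := \matrix_(a, b) c (enum_val a) (enum_val b).
pose B : 'M[K]_(#|{: U}|, #|X|) := \matrix_(a, b) bmon (enum_val a) (enum_val b).
have : A *m B = 1%:M.
  apply/matrixP => a b; rewrite !mxE.
  transitivity (D (enum_val a) (enum_val b)).
    rewrite cP [RHS](reindex_onto enum_val enum_rank) /=; last by move=> u _; rewrite enum_rankK.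
    by apply: eq_big => [u|u _]; rewrite ?enum_valK ?eqxx // !mxE.
  have [->|ab] := eqVneq a b; first by rewrite Dxx.
  by rewrite Dzx // (inj_eq enum_val_inj).
by move/mulmx1_min; rewrite card_prod !card_ffun !card_ord.
Qed.

End GridCount.

(** * Certificates for a pencil of two cubic forms *)

Section PencilCertificate.
Local Open Scope classical_set_scope.

Definition pencil_index n t := ((bool + 'I_n * 'I_n) + 'I_t)%type.

Definition pencil_family n t (F G : {mpoly int[n]}) (ls : 'I_t -> {mpoly int[n]})
    (j : pencil_index n t) : {mpoly int[n]} :=
  match j with
  | inl (inl b) => if b then F else G
  | inl (inr (a, b)) => mderiv a F * mderiv b G - mderiv b F * mderiv a G
  | inr l => ls l
  end.

Definition pencil_degree n t (j : pencil_index n t) : nat :=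
  match j with inl (inl _) => 3 | inl (inr _) => 4 | inr _ => 1 end.

(** One multiplier M and one bound N serve all variables, so that a single finite set of primes has
    to be excluded later. *)
Definition pencil_cert n t (F G : {mpoly int[n]}) (ls : 'I_t -> {mpoly int[n]})
    (N : nat) (M : int) : Prop :=
  forall i, exists e (A : pencil_index n t -> {mpoly int[n]}), [/\ (e < N)%N,
    forall j, (A j == 0) ||
      (pencil_degree j <= e)%N && (A j \is ishomog1 (e - pencil_degree j) mdeg) &
    M *: mpolyX int (mnm1 i) ^+ e = \sum_j A j * pencil_family F G ls j].

(** [bilinear_count] divides by the coefficient of the first form. Exchanging the two forms covers
    the case where only the other coefficient is nonzero. *)
Lemma pencil_cert_swap n t F G (ls : 'I_t -> {mpoly int[n]}) N M :
  pencil_cert F G ls N M -> pencil_cert G F ls N M.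
Proof.
move=> cert i; have [e [A [eN hA AE]]] := cert i.
pose s (j : pencil_index n t) : pencil_index n t :=
  match j with
  | inl (inl b) => inl (inl (~~ b))
  | inl (inr (a, b)) => inl (inr (b, a))
  | inr l => inr l
  end.
have sK : involutive s by case=> [[[]|[]]|].
have sd j : pencil_degree (s j) = pencil_degree j by case: j => [[|[]]|].
have sP j : pencil_family F G ls (s j) = pencil_family G F ls j.
  by case: j => [[[]|[a b]]|l] //=; rewrite [mderiv a F * _]mulrC [mderiv b F * _]mulrC.
exists e, (A \o s); split => // [j|]; first by rewrite /= -sd; apply: hA.
rewrite AE (reindex_inj (inv_inj sK)) /=.
by apply: eq_bigr => j _; rewrite sP.
Qed.

Lemma mderiv_homog n d i (p : {mpoly int[n]}) : homogeneous d.+1 p ->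
  homogeneous d (mderiv i p).
Proof.
move=> /dhomogP hp; apply/dhomogP => m; rewrite mcoeff_msupp mcoeff_deriv => pm.
have : mdeg (mnm_add m (mnm1 i)) = d.+1.
  apply: hp; rewrite mcoeff_msupp; apply: contraNneq pm => ->; by rewrite mul0rn.
by rewrite mdegD mdeg1 addn1 => -[].
Qed.

Lemma pencil_cert_exists (K : numClosedFieldType) n t (F G : {mpoly int[n]})
    (ls : 'I_t -> {mpoly int[n]}) :
    homogeneous 3 F -> homogeneous 3 G -> (forall l, homogeneous 1 (ls l)) ->
    (forall x : 'I_n -> K,
      (forall j, (map_mpoly intr (pencil_family F G ls j)).@[x] = 0) ->
      forall i, x i = 0) ->
  exists N M, M != 0 /\ pencil_cert F G ls N M.
Proof.
move=> hF hG hls P0.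
have hP j : homogeneous (pencil_degree j) (pencil_family F G ls j).
  case: j => [[[]|[a b]]|l] //=; apply: rpredB.
    by apply: (@dhomogM _ _ _ 2 _ 2); apply: mderiv_homog.
  by apply: (@dhomogM _ _ _ 2 _ 2); apply: mderiv_homog.
have /choice[e /choice[M /choice[A AP]]] := integral_certificate hP P0.
exists (\max_i (e i)).+1, (\prod_i M i); split.
  by apply/prodf_neq0 => i _; have [] := AP i.
move=> i; have [_ hA AE] := AP i.
exists (e i), (fun j => (\prod_(k | k != i) M k) *: A i j); split.
- by rewrite ltnS (leq_bigmax i).
- move=> j; have /orP[/eqP->|/andP[h1 h2]] := hA j; first by rewrite scaler0 eqxx.
  by rewrite h1 /= orbC; apply/orP; left; apply: dhomogZ.
- rewrite (bigD1 i) //= mulrC -scalerA AE scaler_sumr.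
  by apply: eq_bigr => j _; rewrite scalerAl.
Qed.

End PencilCertificate.

(** * Counting the zeros of the bilinear system *)

Section BilinearCount.

Lemma polfun_meval (K : fieldType) (X : finType) m (y : 'I_m -> X -> K) n
    (v : 'I_n -> X -> K) d (p : {mpoly int[n]}) :
  (forall i, polfun y 1 (v i)) -> homogeneous d p ->
  polfun y d (fun x => (map_mpoly intr p).@[fun i => v i x]).
Proof.
move=> vpol hp.
apply: (@polfun_ext _ _ _ _ _ (fun x => \sum_(m <- msupp p | m \in msupp p)
  (mcoeff m p)%:~R * \prod_(i <- flatten [seq nseq (m i) i | i <- enum 'I_n]) v i x)).
  move=> x; rewrite -big_seq [in RHS](mpolyE p) (raddf_sum (map_mpoly _)) (raddf_sum (meval _)).
  apply: eq_bigr => a _; rewrite /= map_mpolyZ map_mpolyX mevalZ mevalX; congr (_ * _).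
  rewrite big_flatten big_map big_enum /=; apply: eq_bigr => i _.
  by rewrite big_nseq iter_mulr_1.
apply: polfun_sum => a ap; apply: polfun_scale.
have -> : d = (size (flatten [seq nseq (a i) i | i <- enum 'I_n]) * 1)%N.
  rewrite muln1 size_flatten /shape -map_comp sumnE big_map big_enum /=.
  have <- : mdeg a = d by have /dhomogP := hp; apply.
  rewrite mdegE.
  by apply: eq_bigr => i _; rewrite /= size_nseq.
by apply: polfun_prod => i; apply: vpol.
Qed.

(* On the locus where the bilinear system of a1 F + a2 G vanishes at (h, k), the
   values at h of all members of the pencil family are combinations of
   h - k, the linear forms, and G. *)
Theorem bilinear_count n t cF cG (ls : 'I_t -> {mpoly int[n]}) N M
    (K : fieldType) (X : finType) (h k : 'I_n -> X -> K) (a1 a2 : K) (S : seq K) :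
  pencil_cert (mpoly_of_tensor cF) (mpoly_of_tensor cG) ls N M ->
  (forall l, homogeneous 1 (ls l)) ->
  M%:~R != 0 :> K -> 6%:R != 0 :> K -> a1 != 0 ->
  (forall x l, a1 * bil cF (h^~ x) (k^~ x) l + a2 * bil cG (h^~ x) (k^~ x) l = 0) ->
  (forall x1 x2, (forall i, h i x1 = h i x2 /\ k i x1 = k i x2) -> x1 = x2) ->
  (forall i x, h i x \in S /\ k i x \in S) ->
  (#|X| <= N ^ (n + n) * ((n + n) * size S).+1 ^ (n + t + 1))%N.
Proof.
move=> cert hls M0 six0 a10 bil0 hk_inj hkS.
have two0 : 2%:R != 0 :> K.
  by apply: contraNneq six0 => two0; rewrite (natrM _ 2 3) two0 mul0r.
pose y (i : 'I_(n + n)) := match split i with inl a => h a | inr b => k b end.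
have yl a : y (lshift n a) = h a by rewrite /y -[lshift n a]/(unsplit (inl a)) unsplitK.
have yr a : y (rshift n a) = k a by rewrite /y -[rshift n a]/(unsplit (inr a)) unsplitK.
have hpol a : polfun y 1 (h a) by rewrite -yl; apply: polfun_var.
have kpol a : polfun y 1 (k a) by rewrite -yr; apply: polfun_var.
have polc c d : polfun y d (fun=> c) by apply: polfun_le (leq0n _) (polfun_const _ c).
(* The number n + t + 1 of these generators is the exponent of the side of the grid in the final
   count. *)
pose J := (('I_n + 'I_t) + unit)%type.
pose g (j : J) x : K :=
  match j with
  | inl (inl m) => h m x - k m x
  | inl (inr l) => (map_mpoly intr (ls l)).@[h^~ x]
  | inr _ => cub cG (h^~ x)
  end.
pose ba x m l := a1 * bil cF (h^~ x) (unitv K m) l + a2 * bil cG (h^~ x) (unitv K m) l.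
have bilpol c (m l : 'I_n) : polfun y 1 (fun x => bil c (h^~ x) (unitv K m) l).
  apply: (@polfun_ext _ _ _ _ _ (fun x => \sum_j bil c (unitv K j) (unitv K m) l * h j x)).
    by move=> x; rewrite bilC bil_unitv; apply: eq_bigr => j _; rewrite bilC mulrC.
  by apply: polfun_sum => j _; apply: polfun_scale.
have bapol m l : polfun y 1 (fun x => ba x m l).
  by apply: polfun_add; apply: polfun_scale.
(* Since B_a(h, k) = 0, the vector B_a(h, h) equals B_a(h, h - k), a combination of the generators
   [h m - k m]. *)
have grad x l : a1 * bil cF (h^~ x) (h^~ x) l + a2 * bil cG (h^~ x) (h^~ x) l =
    \sum_m ba x m l * (h m x - k m x).
  have E c : bil c (h^~ x) (h^~ x) l - bil c (h^~ x) (k^~ x) l =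
      \sum_m (h m x - k m x) * bil c (h^~ x) (unitv K m) l.
    by rewrite -bilBr bil_unitv.
  transitivity (a1 * (bil cF (h^~ x) (h^~ x) l - bil cF (h^~ x) (k^~ x) l) +
      a2 * (bil cG (h^~ x) (h^~ x) l - bil cG (h^~ x) (k^~ x) l)).
    by rewrite !mulrBr addrACA -opprD bil0 subr0.
  rewrite !E !mulr_sumr -big_split /=; apply: eq_bigr => m _.
  by rewrite /ba; ring.
pose PK j x : K := (map_mpoly intr (pencil_family (mpoly_of_tensor cF) (mpoly_of_tensor cG) ls j)).@[h^~ x].
have reduce j : exists2 C : J -> X -> K,
    (forall i, polfun y (pencil_degree j).-1 (C i)) &
    forall x, PK j x = \sum_i C i x * g i x.
  have bigJ (C : J -> X -> K) x : \sum_i C i x * g i x =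
      (\sum_m C (inl (inl m)) x * (h m x - k m x)) +
      (\sum_l C (inl (inr l)) x * (map_mpoly intr (ls l)).@[h^~ x]) +
      C (inr tt) x * cub cG (h^~ x).
    rewrite !big_sumType /=; congr (_ + _).
    by rewrite (bigD1 tt) //= big_pred0 ?addr0 // => -[].
  case: j => [[[]|[b d]]|l] /=.
  (* Euler's identity for a1 F + a2 G expresses 6 a1 F through B_a(h, h) and G. *)
  - pose Cf (i : J) (x : X) : K := match i with
      | inl (inl m) => (6%:R * a1)^-1 * \sum_l h l x * ba x m l
      | inl (inr l) => 0
      | inr _ => - (a2 / a1) end.
    exists Cf.
      rewrite /Cf; case=> [[m|l]|u] //; apply: polfun_scale; apply: polfun_sum => l _.
      by rewrite -[2%N]/(1 + 1)%N; apply: polfun_mul.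
    move=> x; rewrite (bigJ Cf) /Cf [X in _ + X + _]big1 ?addr0 /=; last by move=> l _; rewrite mul0r.
    rewrite /PK /= meval_tensor.
    apply: (mulfI (mulf_neq0 six0 a10)).
    have -> : 6%:R * a1 * cub cF (h^~ x) =
        \sum_l h l x * (\sum_m ba x m l * (h m x - k m x)) - a2 * (6%:R * cub cG (h^~ x)).
      under eq_bigr => l _ do
        rewrite -grad mulrDr [X in X + _]mulrCA [X in _ + X]mulrCA.
      by rewrite big_split /= -!mulr_sumr -!euler_tensor; ring.
    rewrite mulrDr; congr (_ + _); last first.
      by field.
    rewrite mulr_sumr; under eq_bigr => l _ do rewrite mulr_sumr.
    rewrite exchange_big; apply: eq_bigr => m _ /=.
    rewrite mulrA mulrA mulfV ?mulf_neq0 // mul1r mulr_suml.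
    by apply: eq_bigr => l _; rewrite mulrA.
  - pose Cf (i : J) (x : X) : K := match i with inr _ => 1 | _ => 0 end.
    exists Cf; first by rewrite /Cf; case=> [[m|l]|u].
    move=> x; rewrite (bigJ Cf) /Cf big1 ?add0r; last by move=> m _; rewrite mul0r.
    rewrite big1 ?add0r; last by move=> m _; rewrite mul0r.
    by rewrite mul1r /PK /= meval_tensor.
  (* Replacing a1 dF by a1 dF + a2 dG does not change a1 times the minor, so the minor is a
     combination of gradients of a1 F + a2 G, which [dE] reduces to the generators. *)
  - pose dG j x : K := (map_mpoly intr (mderiv j (mpoly_of_tensor cG))).@[h^~ x].
    pose Cf (i : J) (x : X) : K := match i with
      | inl (inl m) => (2%:R * a1)^-1 * (ba x m b * dG d x - ba x m d * dG b x)
      | _ => 0 end.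
    exists Cf.
      rewrite /Cf; case=> [[m|l]|u] //; apply: polfun_scale.
      have dGpol j : polfun y 2 (dG j).
        apply: (@polfun_ext _ _ _ _ _ (fun x => 2%:R^-1 * \sum_m h m x * bil cG (h^~ x) (unitv K m) j)).
          move=> x; rewrite /dG; apply: (mulfI two0).
          by rewrite meval_deriv_tensor mulVKf // bil_unitv.
        apply: polfun_scale; apply: polfun_sum => m' _.
        by rewrite -[2%N]/(1 + 1)%N; apply: polfun_mul.
      by rewrite -[3%N]/(1 + 2)%N; apply: polfun_sub; apply: polfun_mul.
    move=> x; rewrite (bigJ Cf) /Cf [X in _ + X + _]big1 ?addr0 /=; last by move=> l _; rewrite mul0r.
    rewrite mul0r addr0.
    pose dF j : K := (map_mpoly intr (mderiv j (mpoly_of_tensor cF))).@[h^~ x].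
    have dE j : 2%:R * (a1 * dF j + a2 * dG j x) = \sum_m ba x m j * (h m x - k m x).
      rewrite -grad -!meval_deriv_tensor -/(dF j) -/(dG j x).
      by rewrite mulrDr ![2%:R * (_ * _)]mulrCA.
    have -> : PK (inl (inr (b, d))) x = dF b * dG d x - dF d * dG b x.
      by rewrite /PK /= rmorphB !rmorphM mevalB !mevalM.
    apply: (mulfI (mulf_neq0 two0 a10)).
    have elim2 (a b' u v w z : K) :
        2%:R * a * (u * z - v * w) =
        (2%:R * (a * u + b' * w)) * z - (2%:R * (a * v + b' * z)) * w by ring.
    have pull (c' u v w z e : K) : c' != 0 ->
        u * e * z - v * e * w = c' * (c'^-1 * (u * z - v * w) * e).
      by move=> c0; rewrite mulrA mulrA mulfV // mul1r; ring.
    rewrite (elim2 _ a2) !dE !mulr_suml -sumrB mulr_sumr; apply: eq_bigr => m _.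
    by apply: pull; apply: mulf_neq0.
  - pose Cf (i : J) (x : X) : K := match i with inl (inr l') => (l' == l)%:R | _ => 0 end.
    exists Cf.
      by rewrite /Cf; case=> [[m|l']|u].
    move=> x; rewrite (bigJ Cf) /Cf big1 ?add0r; last by move=> m _; rewrite mul0r.
    rewrite mul0r addr0 (bigD1 l) //= eqxx mul1r big1 ?addr0 //.
    by move=> l' /negPf->; rewrite mul0r.
have {reduce} /choice[C CP] : forall j, exists C, (forall i, polfun y (pencil_degree j).-1 (C i)) /\
    forall x, PK j x = \sum_i C i x * g i x.
  by move=> j; have [C h1 h2] := reduce j; exists C.
(* The certificate for the e-th power is multiplied by [h a]. Its terms then have degree at most 1 +
   (e - d) + (d - 1) = e, as [integral_y] asks, and the exponent e + 1 is positive even for e =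
   0. *)
have h_int a : exists2 e, (e < N)%N & exists2 B : J -> X -> K,
    (forall j, polfun y e (B j)) & forall x, h a x ^+ e.+1 = \sum_j B j x * g j x.
  have [e [A [eN hA AE]]] := cert a; exists e => //.
  exists (fun j x => M%:~R^-1 * \sum_i h a x * (map_mpoly intr (A i)).@[h^~ x] * C i j x).
    move=> j; apply: polfun_scale; apply: polfun_sum => i _.
    have [->|Ai0] := eqVneq (A i) 0.
      by apply: polfun_ext (polc 0 e) => x; rewrite rmorph0 meval0 mulr0 mul0r.
    have := hA i; rewrite (negPf Ai0) /= => /andP[de homA].
    have d0 : (0 < pencil_degree i)%N by case: (i) => [[|[]]|].
    apply: (@polfun_le _ _ _ _ (1 + (e - pencil_degree i) + (pencil_degree i).-1)); first by lia.
    apply: polfun_mul; last by have [] := CP i.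
    by apply: polfun_mul => //; apply: polfun_meval.
  move=> x; apply: (mulfI M0).
  have E : M%:~R * h a x ^+ e = \sum_i (map_mpoly intr (A i)).@[h^~ x] * PK i x.
    have := congr1 (fun p => (map_mpoly intr p).@[h^~ x] : K) AE.
    rewrite map_mpolyZ mevalZ rmorphXn /= map_mpolyX rmorphXn /= mevalXU => ->.
    rewrite (raddf_sum (map_mpoly _)) (raddf_sum (meval _)); apply: eq_bigr => i _.
    by rewrite /= rmorphM mevalM.
  rewrite exprS mulrCA E !mulr_sumr.
  under eq_bigr => i _ do rewrite (CP i).2 !mulr_sumr.
  rewrite exchange_big; apply: eq_bigr => j _ /=.
  rewrite mulrA mulrA mulfV // mul1r mulr_suml; apply: eq_bigr => i _.
  by rewrite !mulrA.
apply: leq_trans (@grid_count K X (n + n) y J g N _ S _ _) _.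
- move=> i; rewrite -(splitK i); case: (split i) => a /=; first by rewrite yl.
  rewrite yr; have [e eN [B Bpol BE]] := h_int a; exists e => //.
  (* The relation for k follows from that for h, since h^(e+1) - k^(e+1) is divisible by the
     generator h - k. *)
  exists (fun j x => B j x - (j == inl (inl a))%:R * \sum_(i < e.+1) h a x ^+ (e - i) * k a x ^+ i).
    move=> j; apply: polfun_sub => //; apply: polfun_scale; apply: polfun_sum => i' _.
    apply: (@polfun_le _ _ _ _ ((e - i') * 1 + i' * 1)); first by have := ltn_ord i'; lia.
    by apply: polfun_mul; apply: polfun_exp.
  move=> x; under eq_bigr => j _ do rewrite mulrBl.
  rewrite sumrB -BE [X in _ - X](bigD1 (inl (inl a))) //= eqxx mul1r.
  rewrite [X in _ - (_ + X)]big1 ?addr0; last by move=> j /negPf->; rewrite !mul0r.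
  by rewrite mulrC -subrXX opprB addrC subrK.
- move=> x1 x2 E; apply: hk_inj => i; split.
    by have := E (lshift n i); rewrite yl.
  by have := E (rshift n i); rewrite yr.
- move=> i x; rewrite -(splitK i); case: (split i) => a /=; rewrite ?yl ?yr.
    by have [] := hkS a x.
  by have [] := hkS a x.
- by rewrite !card_sum !card_ord card_unit.
Qed.

End BilinearCount.

(** * Weyl differencing of complete sums *)

Section CompleteSums.
Variables (n q : nat).
Hypothesis q_gt0 : (0 < q)%N.

Local Notation residues := {ffun 'I_n -> 'I_q}.

Definition lift_res (x : residues) (i : 'I_n) : int := (x i : nat)%:Z.

Lemma res_lt (a : int) : (`|(a %% q%:Z)%Z|%N < q)%N.
Proof. by have := ltz_pmod a (d := q%:Z); have := modz_ge0 a (d := q%:Z); lia. Qed.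

Definition red_res (v : 'I_n -> int) : residues := [ffun i => Ordinal (res_lt (v i))].

Definition eqmodv (u v : 'I_n -> int) := forall i, (u i = v i %[mod q%:Z])%Z.

Lemma lift_redE v i : lift_res (red_res v) i = (v i %% q%:Z)%Z.
Proof. by rewrite /lift_res ffunE /= gez0_abs // modz_ge0; lia. Qed.

Lemma lift_red v : eqmodv (lift_res (red_res v)) v.
Proof. by move=> i; rewrite lift_redE modz_mod. Qed.

Lemma red_lift x : red_res (lift_res x) = x.
Proof.
apply/ffunP => i; apply: val_inj; rewrite ffunE /= /lift_res modz_small ?absz_nat //.
by have := ltn_ord (x i); lia.
Qed.

Lemma red_eq u v : eqmodv u v -> red_res u = red_res v.
Proof. by move=> uv; apply/ffunP => i; apply: val_inj; rewrite !ffunE /= uv. Qed.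

Definition periodic (T : Type) (f : ('I_n -> int) -> T) :=
  forall u v, eqmodv u v -> f u = f v.

Lemma ressum_shift (V : zmodType) (f : ('I_n -> int) -> V) (v : 'I_n -> int) :
  periodic f ->
  \sum_x f (fun i => lift_res x i + v i) = \sum_x f (lift_res x).
Proof.
move=> fper; pose s w (x : residues) := red_res (fun i => lift_res x i + w i).
have sK w w' : (forall i, w i + w' i = 0) -> cancel (s w) (s w').
  move=> ww x; rewrite /s -[RHS]red_lift; apply: red_eq => i.
  rewrite -modzDml lift_redE modz_mod modzDml -addrA ww addr0 //.
rewrite [RHS](reindex_onto (s v) (s (fun i => - v i))) /=; last first.
  by move=> x _; apply: sK => i; rewrite addNr.
apply: eq_big => [x|x _]; first by rewrite sK ?eqxx // => i; rewrite subrr.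
by apply: fper => i; rewrite lift_redE modz_mod.
Qed.

Variables (C : numClosedFieldType) (e : int -> C).
Hypothesis eD : forall a b, e (a + b) = e a * e b.
Hypothesis e_norm : forall a, `|e a| = 1.
Hypothesis e_eq1 : forall a, (e a == 1) = (q%:Z %| a)%Z.

Lemma char_neq0 a : e a != 0.
Proof. by rewrite -normr_eq0 e_norm oner_eq0. Qed.

Lemma char0 : e 0 = 1.
Proof. by apply/eqP; rewrite e_eq1 dvdz0. Qed.

Lemma charN a : e (- a) = (e a)^*.
Proof.
apply: (mulfI (char_neq0 a)); rewrite -eD subrr char0.
by rewrite -normCK e_norm expr1n.
Qed.

Lemma char_mod a b : (a = b %[mod q%:Z])%Z -> e a = e b.
Proof.
move/eqP; rewrite eqz_mod_dvd => /[!(=^~ e_eq1)] /eqP E.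
by rewrite -[a](subrK b) eD E mul1r.
Qed.

(** For a complete sum the shift runs over all residues and periodicity permits the change of
    variable, so differencing is an identity. *)
Lemma van_der_corput (f : ('I_n -> int) -> int) :
    (forall u v, eqmodv u v -> (f u = f v %[mod q%:Z])%Z) ->
  `|\sum_x e (f (lift_res x))| ^+ 2 =
  \sum_h \sum_x e (f (fun i => lift_res x i + lift_res h i) - f (lift_res x)).
Proof.
move=> fper; rewrite normCK rmorph_sum /= mulr_suml.
transitivity (\sum_x \sum_y e (f (lift_res y)) * (e (f (lift_res x)))^*).
  rewrite exchange_big /=; apply: eq_bigr => x _; rewrite mulr_sumr.
  by apply: eq_bigr => y _.
rewrite exchange_big /= [RHS]exchange_big /=.
rewrite exchange_big /=; apply: eq_bigr => x _.
under eq_bigr => y _ do rewrite -charN -eD.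
rewrite -(@ressum_shift _ (fun v => e (f v - f (lift_res x))) (lift_res x)).
  by apply: eq_bigr => h _; congr (e (f _ - _)); apply/funext => i; rewrite addrC.
by move=> u v uv; apply: char_mod; rewrite -modzDml (fper u v uv) modzDml.
Qed.

Lemma modz_congr_sum (I : Type) (s : seq I) (P : pred I) (f g : I -> int) :
  (forall i, P i -> (f i = g i %[mod q%:Z])%Z) ->
  (\sum_(i <- s | P i) f i = \sum_(i <- s | P i) g i %[mod q%:Z])%Z.
Proof.
move=> fg; apply/eqP; rewrite eqz_mod_dvd -sumrB.
elim/big_ind: _ => [|x y|i Pi]; [exact: dvdz0|exact: rpredD|].
by rewrite -eqz_mod_dvd; apply/eqP/fg.
Qed.

(** Shifting coordinate l by 1 multiplies the sum by [e (b l)]. If q does not divide [b l] this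
    factor is not 1, and the sum vanishes. *)
Lemma linear_sum_le (b : 'I_n -> int) (c : int) :
  `|\sum_x e (\sum_l lift_res x l * b l + c)| <=
  (q ^ n * [forall l, (q%:Z %| b l)%Z])%:R.
Proof.
have [|/existsP[l bl]] := boolP [forall l, (q%:Z %| b l)%Z].
  move=> _; rewrite muln1; apply: le_trans (ler_norm_sum _ _ _) _.
  under eq_bigr do rewrite e_norm.
  by rewrite sumr_const card_ffun !card_ord.
rewrite muln0 (_ : \sum_x _ = 0) ?normr0 //.
pose f (v : 'I_n -> int) := e (\sum_l v l * b l + c).
have fper : periodic f.
  move=> u v uv; apply: char_mod; rewrite -modzDml.
  rewrite (@modz_congr_sum _ _ _ _ (fun l => v l * b l)) ?modzDml // => i _.
  by rewrite -modzMml uv modzMml.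
have := @ressum_shift _ f (unitv int l) fper.
have -> : \sum_x f (fun i => lift_res x i + unitv int l i) = e (b l) * \sum_x f (lift_res x).
  rewrite mulr_sumr; apply: eq_bigr => x _; rewrite /f -eD; congr e.
  rewrite addrA; congr (_ + _); under eq_bigr => i _ do rewrite mulrDl.
  rewrite big_split addrC /=; congr (_ + _).
  rewrite (bigD1 l) //= /unitv eqxx mul1r big1 ?addr0 // => i /negPf->.
  by rewrite mul0r.
move/eqP; rewrite -subr_eq0 -{2}[\sum_x _]mul1r -mulrBl mulf_eq0 subr_eq0 e_eq1.
by rewrite (negPf bl) => /eqP.
Qed.

Variable c : tensor n.

Lemma modz_congrB (a a' b b' : int) : (a = a' %[mod q%:Z])%Z ->
  (b = b' %[mod q%:Z])%Z -> (a - b = a' - b' %[mod q%:Z])%Z.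
Proof.
move=> /eqP + /eqP; rewrite !eqz_mod_dvd => ha hb; apply/eqP; rewrite eqz_mod_dvd.
have -> : a - b - (a' - b') = (a - a') - (b - b') by ring.
exact: rpredB.
Qed.

Lemma cub_mod (u v : 'I_n -> int) : eqmodv u v -> (cub c u = cub c v %[mod q%:Z])%Z.
Proof.
move=> uv; do 3!(apply: modz_congr_sum => ? _).
have mulm (a a' b b' : int) : (a = a' %[mod q%:Z])%Z -> (b = b' %[mod q%:Z])%Z ->
    (a * b = a' * b' %[mod q%:Z])%Z.
  by move=> aa bb; rewrite -modzMm aa bb modzMm.
by apply: (mulm) => //; apply: (mulm); [apply: (mulm)|]; apply: uv.
Qed.

Definition kernel_res (h : residues) : {set residues} :=
  [set k | [forall l, (q%:Z %| bil c (lift_res h) (lift_res k) l)%Z]].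

Definition diff_sum (h : residues) : C :=
  \sum_x e (cub c (fun i => lift_res x i + lift_res h i) - cub c (lift_res x)).

Lemma weyl_step1 : `|\sum_x e (cub c (lift_res x))| ^+ 2 <= \sum_h `|diff_sum h|.
Proof.
rewrite van_der_corput; last exact: cub_mod.
(* The order of C is partial. The sum is known to be real because it equals a squared modulus. *)
have E : \sum_h diff_sum h \is Num.real.
  rewrite -(van_der_corput cub_mod) ; exact: ger0_real (exprn_ge0 _ (normr_ge0 _)).
exact: le_trans (real_ler_norm E) (ler_norm_sum _ _ _).
Qed.

Lemma weyl_step2 h : `|diff_sum h| ^+ 2 <= (q ^ n * #|kernel_res h|)%:R.
Proof.
pose f (v : 'I_n -> int) := cub c (fun i => v i + lift_res h i) - cub c v.
have fper u v : eqmodv u v -> (f u = f v %[mod q%:Z])%Z.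
  move=> uv; apply: modz_congrB; apply: cub_mod => // i.
  by rewrite -modzDml uv modzDml.
have vdc := van_der_corput fper.
have -> : `|diff_sum h| ^+ 2 = `|\sum_k \sum_x e (f (fun i => lift_res x i + lift_res k i) - f (lift_res x))|.
  rewrite -[LHS]ger0_norm ?exprn_ge0 //; congr (`| _ |); exact: vdc.
apply: le_trans (ler_norm_sum _ _ _) _.
have -> : (q ^ n * #|kernel_res h|)%:R = \sum_k (q ^ n * (k \in kernel_res h))%:R :> C.
  by rewrite -natr_sum -big_distrr -sum1_card [in LHS]big_mkcond.
apply: ler_sum => k _.
have := linear_sum_le (bil c (lift_res h) (lift_res k))
  (cub c (fun i => lift_res h i + lift_res k i) - cub c (lift_res h) - cub c (lift_res k)).
congr (`| _ | <= _).
  apply: eq_bigr => x _; congr e; rewrite -tri_bil -tri_polar /f.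
  rewrite (_ : (fun i => lift_res x i + lift_res k i + lift_res h i) =
    (fun i => lift_res x i + lift_res h i + lift_res k i)); first by ring.
  by apply/funext => i; rewrite addrAC.
by rewrite inE.
Qed.

End CompleteSums.

(** * Shrinking *)

Section Shrinking.

Definition comb_tensor n (a1 a2 : int) (cF cG : tensor n) : tensor n :=
  fun i j k => a1 * cF i j k + a2 * cG i j k.

Lemma cub_comb (K : comNzRingType) n a1 a2 (cF cG : tensor n) (x : 'I_n -> K) :
  cub (comb_tensor a1 a2 cF cG) x = a1%:~R * cub cF x + a2%:~R * cub cG x.
Proof.
by rewrite /cub !sum3M sum3D; apply: sum3_eq => i j k; rewrite intrD !intrM; ring.
Qed.

Lemma bil_comb (K : comNzRingType) n a1 a2 (cF cG : tensor n) (h k : 'I_n -> K) l :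
  bil (comb_tensor a1 a2 cF cG) h k l = a1%:~R * bil cF h k l + a2%:~R * bil cG h k l.
Proof.
by rewrite /bil /tri !sum3M sum3D; apply: sum3_eq => i j m; rewrite intrD !intrM; ring.
Qed.

Local Notation box n P := {ffun 'I_n -> 'I_(P.*2.+1)}.

Definition box_val n P (v : box n P) (i : 'I_n) : int := (v i : nat)%:Z - P%:Z.

Lemma box_val_le n P (v : box n P) i : `|box_val v i| <= P%:Z.
Proof. by rewrite /box_val; have := ltn_ord (v i); lia. Qed.

Lemma box_val_inj n P : injective (@box_val n P).
Proof.
move=> u v uv; apply/ffunP => i; apply: val_inj.
by have := congr1 (fun f => f i) uv; rewrite /box_val => /addIr [].
Qed.

(** Cut the residues into cells of side P. Within a cell, subtracting a fixed member of [L] maps the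
    members of [L] injectively into the box, because [L] is closed under differences. The power
    counts the cells. *)
Lemma pigeonhole_box n q P (L : ('I_n -> int) -> bool) : (0 < q)%N -> (0 < P)%N ->
    (forall u v, L u -> L v -> L (fun i => u i - v i)) ->
  (#|[set x : {ffun 'I_n -> 'I_q} | L (lift_res x)]| <=
   (q %/ P).+1 ^ n * #|[set v : box n P | L (box_val v)]|)%N.
Proof.
move=> q0 P0 LB; set A := [set x | _].
have cell_lt (a : 'I_q) : (a %/ P < (q %/ P).+1)%N.
  by rewrite ltnS leq_div2r // ltnW.
pose phi (x : {ffun 'I_n -> 'I_q}) : {ffun 'I_n -> 'I_(q %/ P).+1} :=
  [ffun i => Ordinal (cell_lt (x i))].
rewrite -sum1_card (partition_big phi predT) //=.
have -> : ((q %/ P).+1 ^ n = #|{: {ffun 'I_n -> 'I_(q %/ P).+1}}|)%N.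
  by rewrite card_ffun !card_ord.
rewrite -sum_nat_const; apply: leq_sum => d _.
pose Ad := [pred x | (x \in A) && (phi x == d)].
apply: (@leq_trans #|Ad|); first by rewrite -sum1_card.
have [x0 /andP[x0A /eqP x0d]|] := pickP Ad; last by move/eq_card0->.
have close (x : {ffun 'I_n -> 'I_q}) i : x \in Ad ->
    `|lift_res x i - lift_res x0 i| < P%:Z.
  move=> /andP[_ /eqP xd]; have : phi x i = phi x0 i by rewrite xd x0d.
  rewrite !ffunE => -[]; rewrite /lift_res.
  have := divn_eq (x i) P; have := divn_eq (x0 i) P.
  have := ltn_pmod (x i) P0; have := ltn_pmod (x0 i) P0.
  move: (x i %% P)%N (x0 i %% P)%N (x i %/ P)%N (x0 i %/ P)%N => r r0 s s0 hr hr0 -> -> ->.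
  lia.
pose psi (x : {ffun 'I_n -> 'I_q}) : box n P := [ffun i => inord (absz (lift_res x i - lift_res x0 i + P%:Z))].
have psiE x i : x \in Ad -> box_val (psi x) i = lift_res x i - lift_res x0 i.
  move=> xA; rewrite /box_val ffunE; have := close x i xA.
  move: (lift_res x i - _) => z hz.
  by rewrite inordK; lia.
rewrite -(card_in_image (f := psi)); last first.
  move=> x y xA yA xy; apply/ffunP => i; apply: val_inj.
  have := psiE x i xA; rewrite xy psiE // => /addIr; rewrite /lift_res => -[] E.
  exact: esym E.
apply: subset_leq_card; apply/fintype.subsetP => v /fintype.imageP[x xA ->]; rewrite inE.
have -> : box_val (psi x) = fun i => lift_res x i - lift_res x0 i.
  by apply/funext => i; rewrite psiE.
by move: xA x0A; rewrite !inE => /andP[Lx _] Lx0; apply: LB.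
Qed.

Lemma dvdz_forallB n q (B B' : 'I_n -> int) : [forall l, (q%:Z %| B l)%Z] ->
  [forall l, (q%:Z %| B' l)%Z] -> [forall l, (q%:Z %| B l - B' l)%Z].
Proof. by move=> /forallP h /forallP h'; apply/forallP => l; apply: rpredB. Qed.

Lemma card_swap (T1 T2 : finType) (r : T1 -> T2 -> bool) :
  (\sum_a #|[set b | r a b]| = \sum_b #|[set a | r a b]|)%N.
Proof.
under eq_bigr => a _ do rewrite -sum1_card big_mkcond.
rewrite exchange_big /=; apply: eq_bigr => b _.
by rewrite -sum1_card [RHS]big_mkcond; apply: eq_bigr => a _; rewrite !inE.
Qed.

Lemma card_pairs (T1 T2 : finType) (r : T1 -> T2 -> bool) :
  #|[set uv : T1 * T2 | r uv.1 uv.2]| = (\sum_u #|[set v | r u v]|)%N.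
Proof.
under [RHS]eq_bigr => u _ do rewrite -sum1_card.
by rewrite pair_big_dep -sum1_card /=; apply: eq_bigl => -[u v]; rewrite !inE.
Qed.

(** [pigeonhole_box] is used twice: for fixed h the condition is closed under differences in k, and
    then for a fixed short k it is closed under differences in h. *)
Lemma shrink_count n q P (c : tensor n) : (0 < q)%N -> (0 < P)%N ->
  (\sum_h #|@kernel_res n q c h| <= (q %/ P).+1 ^ (n + n) *
   #|[set uv : box n P * box n P |
      [forall l, (q%:Z %| bil c (box_val uv.1) (box_val uv.2) l)%Z]]|)%N.
Proof.
move=> q0 P0; set D := (q %/ P).+1.
apply: (@leq_trans (\sum_h D ^ n * #|[set v : box n P |
    [forall l, (q%:Z %| bil c (@lift_res n q h) (box_val v) l)%Z]]|)).
  apply: leq_sum => h _.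
  apply: (@pigeonhole_box n q P (fun k => [forall l, (q%:Z %| bil c (lift_res h) k l)%Z])) => //.
  move=> u v hu hv; have := dvdz_forallB hu hv.
  by move=> /forallP H; apply/forallP => l; rewrite bilBr.
rewrite -big_distrr expnD -mulnA leq_mul2l; apply/orP; right => /=.
rewrite (card_swap (fun h v => [forall l, (q%:Z %| bil c (@lift_res n q h) (box_val v) l)%Z])).
apply: (@leq_trans (\sum_v D ^ n * #|[set u : box n P |
    [forall l, (q%:Z %| bil c (box_val u) (@box_val n P v) l)%Z]]|)).
  apply: leq_sum => v _.
  apply: (@pigeonhole_box n q P (fun h => [forall l, (q%:Z %| bil c h (box_val v) l)%Z])) => //.
  move=> u u' hu hu'; have := dvdz_forallB hu hu'.
  by move=> /forallP H; apply/forallP => l; rewrite bilBl.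
rewrite -big_distrr leq_mul2l; apply/orP; right => /=.
rewrite -(card_swap (fun u v => [forall l, (q%:Z %| bil c (@box_val n P u) (@box_val n P v) l)%Z])).
by rewrite -(card_pairs (fun u v => [forall l, (q%:Z %| bil c (@box_val n P u) (@box_val n P v) l)%Z])).
Qed.

(** Dirichlet's argument: the q multiples of (a1, a2) modulo q fall into fewer than q cells of side
    m. Two share a cell, and their difference is again a multiple modulo q. *)
Lemma small_multiple q m (a1 a2 : nat) : (0 < q)%N -> (0 < m)%N ->
    gcdn (gcdn a1 a2) q = 1%N -> ((q %/ m).+1 ^ 2 < q)%N ->
  exists b1 b2 : int, [/\ (b1 != 0) || (b2 != 0), `|b1| < m%:Z, `|b2| < m%:Z &
    forall X Y, (q%:Z %| a1%:Z * X + a2%:Z * Y)%Z -> (q%:Z %| b1 * X + b2 * Y)%Z].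
Proof.
move=> q0 m0 cop Dq; set D := (q %/ m).+1 in Dq.
have cell_lt a : (a %% q %/ m < D)%N.
  by rewrite ltnS leq_div2r // ltnW // ltn_pmod.
pose psi (c : 'I_q) : 'I_D * 'I_D := (Ordinal (cell_lt (c * a1)%N), Ordinal (cell_lt (c * a2)%N)).
have [c [c' [cc' E]]] : exists c c', c != c' /\ psi c = psi c'.
  apply: contrapT => H; have : injective psi.
    by move=> c c' E; apply/eqP; apply: contrapT => /negP cc'; apply: H; exists c, c'.
  move=> /leq_card; rewrite card_prod !card_ord leqNgt => /negP; apply.
  by rewrite -mulnn in Dq.
wlog lt_cc' : c c' cc' E / (c' < c)%N.
  move=> H; have [||cc''] := ltngtP c c'; [move=> lt|move=> lt|].
  - by apply: (H c' c) => //; rewrite eq_sym.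
  - exact: (H c c').
  - by move/eqP: cc'; case; apply: val_inj.
pose b a := ((c * a) %% q)%N%:Z - ((c' * a) %% q)%N%:Z : int.
have bsmall a : ((c * a) %% q %/ m = (c' * a) %% q %/ m)%N -> `|b a| < m%:Z.
  rewrite /b; set x := ((c * a) %% q)%N; set y := ((c' * a) %% q)%N.
  have := divn_eq x m; have := divn_eq y m.
  have := ltn_pmod x m0; have := ltn_pmod y m0.
  move: (x %% m)%N (y %% m)%N (x %/ m)%N (y %/ m)%N => r r0 s s0 hr hr0 -> -> ->.
  lia.
have bmod a X : (q%:Z %| b a * X - (c - c')%N%:Z * (a%:Z * X))%Z.
  rewrite mulrA -mulrBl; apply: dvdz_mulr.
  rewrite /b; have := divn_eq (c * a) q; have := divn_eq (c' * a) q.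
  move: (c * a %% q)%N (c' * a %% q)%N (c * a %/ q)%N (c' * a %/ q)%N => r r' s s' E' E''.
  apply/dvdzP; exists (s'%:Z - s%:Z).
  rewrite -subzn 1?ltnW // mulrBl -!PoszM E' E'' !PoszD !PoszM; ring.
exists (b a1), (b a2); split.
(* If both differences vanished, q would divide (c - c') gcd(a1, a2), hence c - c' by coprimality;
   but 0 < c - c' < q. *)
- apply: contraT; rewrite negb_or !negbK => /andP[/eqP b10 /eqP b20].
  have dv a : b a = 0 -> (q %| (c - c') * a)%N.
    by move=> ba; have := bmod a 1; rewrite ba mul0r sub0r mulr1 -PoszM dvdzE abszN.
  have : (q %| (c - c') * gcdn a1 a2)%N.
    by rewrite muln_gcdr dvdn_gcd (dv _ b10) (dv _ b20).
  rewrite Gauss_dvdl; last by rewrite /coprime gcdnC cop.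
  move/dvdn_leq; rewrite subn_gt0 => /(_ lt_cc').
  by rewrite leqNgt (leq_ltn_trans (leq_subr _ _)).
- by apply: bsmall; have [] := congr1 fst E.
- by apply: bsmall; have [] := congr1 snd E.
- move=> X Y H; rewrite -(subrK ((c - c')%N%:Z * (a1%:Z * X + a2%:Z * Y)) (_ + _)).
  apply: rpredD; last by apply: dvdz_mull.
  by rewrite mulrDr opprD addrACA; apply: rpredD; apply: bmod.
Qed.

End Shrinking.

(** * Counting kernel pairs modulo q *)

Section KernelCounts.
Variables (n t N : nat) (M : int) (cF cG : tensor n) (ls : 'I_t -> {mpoly int[n]}).
Hypothesis cert : pencil_cert (mpoly_of_tensor cF) (mpoly_of_tensor cG) ls N M.
Hypothesis hls : forall l, homogeneous 1 (ls l).
Hypothesis M_neq0 : M != 0.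
Hypothesis codim : (n + t + 1 + 33 <= n + n)%N.

Local Notation box n P := {ffun 'I_n -> 'I_(P.*2.+1)}.

Lemma comb_tensorC n' a1 a2 (c1 c2 : tensor n') :
  comb_tensor a1 a2 c1 c2 = comb_tensor a2 a1 c2 c1.
Proof. by do 3!apply/funext => ?; rewrite /comb_tensor addrC. Qed.

Lemma box_count_aux (c1 c2 : tensor n) (b1 b2 : int) P :
    pencil_cert (mpoly_of_tensor c1) (mpoly_of_tensor c2) ls N M -> b1 != 0 ->
  (#|[set uv : box n P * box n P |
      [forall l, bil (comb_tensor b1 b2 c1 c2) (box_val uv.1) (box_val uv.2) l == 0]]|
   <= N ^ (n + n) * ((n + n) * P.*2.+1).+1 ^ (n + t + 1))%N.
Proof.
move=> cert12 b10; set A := [set uv | _].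
rewrite -card_sig.
pose X := {uv : box n P * box n P | uv \in A}.
pose h i (x : X) : rat := (box_val (sval x).1 i)%:~R.
pose k i (x : X) : rat := (box_val (sval x).2 i)%:~R.
pose S : seq rat := [seq (i%:Z - P%:Z)%:~R | i <- iota 0 P.*2.+1].
have -> : ((n + n) * P.*2.+1)%N = ((n + n) * size S)%N by rewrite size_map size_iota.
have memS (v : box n P) i : (box_val v i)%:~R \in S.
  by apply/mapP; exists (v i : nat) => //; rewrite mem_iota /= add0n ltn_ord.
apply: (@bilinear_count n t c1 c2 ls N M rat X h k b1%:~R b2%:~R S) => //.
- by rewrite intr_eq0.
- by rewrite intr_eq0.
- move=> [uv uvA] l /=; have := uvA; rewrite inE => /forallP/(_ l)/eqP.
  move/(congr1 (fun z : int => z%:~R : rat)).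
  by rewrite bil_comb /h /k /= !bil_intr !intz intrD !intrM.
- move=> [[u v] uvA] [[u' v'] uvA'] E; apply: val_inj => /=.
  by congr (_, _); apply: box_val_inj; apply/funext => i; have [h1 h2] := E i;
    apply: (@intr_inj rat).
- by move=> i x; split; apply: memS.
Qed.

Lemma box_count (b1 b2 : int) P : (b1 != 0) || (b2 != 0) ->
  (#|[set uv : box n P * box n P |
      [forall l, bil (comb_tensor b1 b2 cF cG) (box_val uv.1) (box_val uv.2) l == 0]]|
   <= N ^ (n + n) * ((n + n) * P.*2.+1).+1 ^ (n + t + 1))%N.
Proof.
move=> /orP[b10|b20]; first exact: box_count_aux.
by rewrite comb_tensorC; apply: box_count_aux => //; apply: pencil_cert_swap.
Qed.

Lemma box_size_le m P : (0 < P)%N -> (((m + m) * P.*2.+1).+1 <= (6 * m).+1 * P)%N.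
Proof.
move=> P0; rewrite -muln2 mulSn.
have -> : (6 * m * P = (m + m) * P * 2 + (m + m) * P)%N by ring.
have := leq_pmulr (m + m) P0; rewrite mulnS mulnA.
by move: ((m + m) * P)%N => mP; lia.
Qed.

(** [s] stands for q^(1/4). The saving is the excess of 2n over the exponent n + t + 1 of
    [box_count], at least 33 by [codim]. *)
Lemma kernel_count : exists C : nat, forall q a1 a2 s, (0 < s)%N ->
    gcdn (gcdn a1 a2) q = 1%N -> (s ^ 4 < q)%N -> (q <= 16 * s ^ 4)%N ->
  ((\sum_h #|@kernel_res n q (comb_tensor a1%:Z a2%:Z cF cG) h|) * s ^ 33
    <= C * q ^ (n + n))%N.
Proof.
have [C1 C1P] := bil_bound cF; have [C2 C2P] := bil_bound cG.
(* [small_multiple] is used with m = 17 s^2: from q <= 16 s^4 one gets q / m < s^2, so there are at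
   most s^4 < q cells. With P = s / kap the values of the new bilinear forms are at most 17 s^2 (C1
   + C2) P^2 <= s^4 < q, so divisibility by q means vanishing. *)
pose kap := (17 * (C1 + C2)).+1; pose e := (n + t + 1)%N.
pose C3 := (2 ^ (n + n) * N ^ (n + n) * (6 * n).+1 ^ e)%N.
exists (kap ^ 33 + C3 * (2 * kap) ^ 33)%N => q a1 a2 s s0 cop sq qs.
set c := comb_tensor _ _ _ _; set NN := (\sum_h _)%N.
have q0 : (0 < q)%N by apply: leq_ltn_trans sq.
(* Covers s < kap, where P would be 0. *)
have NN_triv : (NN <= q ^ (n + n))%N.
  rewrite expnD; apply: (@leq_trans (\sum_(h : {ffun 'I_n -> 'I_q}) q ^ n)).
    apply: leq_sum => h _; apply: leq_trans (max_card _) _.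
    by rewrite card_ffun !card_ord.
  by rewrite sum_nat_const card_ffun !card_ord.
rewrite mulnDl; have [sk|ks] := ltnP s kap.
  apply: (@leq_trans (kap ^ 33 * q ^ (n + n))); last exact: leq_addr.
  by rewrite mulnC leq_mul // leq_exp2r // ltnW.
apply: (@leq_trans (C3 * (2 * kap) ^ 33 * q ^ (n + n))); last exact: leq_addl.
pose P := (s %/ kap)%N.
have P0 : (0 < P)%N by rewrite divn_gt0.
have kP : (kap * P <= s)%N by rewrite mulnC leq_divM.
have skP : (s <= 2 * kap * P)%N.
  have := ltn_ceil s (isT : (0 < kap)%N); rewrite -/P => /ltnW/leq_trans; apply.
  by rewrite mulnC [(2 * kap)%N]mulnC -mulnA leq_mul2l mul2n -addnn -addn1 leq_add2l P0 orbT.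
have [b1 [b2 [b0 b1m b2m bP]]] : exists b1 b2 : int, [/\ (b1 != 0) || (b2 != 0),
    `|b1| < (17 * s ^ 2)%N%:Z, `|b2| < (17 * s ^ 2)%N%:Z &
    forall X Y, (q%:Z %| a1%:Z * X + a2%:Z * Y)%Z -> (q%:Z %| b1 * X + b2 * Y)%Z].
  apply: small_multiple => //; first by rewrite muln_gt0 expn_gt0 s0.
  apply: leq_ltn_trans sq; rewrite (expnM s 2 2) leq_exp2r //.
  rewrite ltn_divLR; last by rewrite muln_gt0 expn_gt0 s0.
  apply: leq_ltn_trans qs _; rewrite (expnD s 2 2) mulnCA ltn_mul2l expn_gt0 s0 /=.
  by rewrite ltn_mul2r expn_gt0 s0.
have small (u v : box n P) l : (q%:Z %| bil c (box_val u) (box_val v) l)%Z ->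
    bil (comb_tensor b1 b2 cF cG) (box_val u) (box_val v) l == 0.
  rewrite !bil_comb !intz => /bP => qd.
  have B1 := C1P _ _ l P P (box_val_le u) (box_val_le v).
  have B2 := C2P _ _ l P P (box_val_le u) (box_val_le v).
  set X := bil cF _ _ l in B1 qd *; set Y := bil cG _ _ l in B2 qd *.
  apply: contraLR qd => nz; rewrite dvdzE; apply/negP => /dvdn_leq.
  rewrite absz_gt0 nz => /(_ isT); apply/negP; rewrite -ltnNge -ltz_nat abszE.
  apply: le_lt_trans (ler_normD _ _) _; rewrite !normrM.
  apply: le_lt_trans (lerD (ler_pM (normr_ge0 _) (normr_ge0 _) (ltW b1m) B1)
    (ler_pM (normr_ge0 _) (normr_ge0 _) (ltW b2m) B2)) _.
  rewrite -!PoszM -PoszD ltz_nat; apply: leq_ltn_trans sq.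
  have cP : (17 * (C1 + C2) * (P * P) <= s ^ 2)%N.
    rewrite -mulnn; apply: leq_trans (leq_mul kP kP).
    by rewrite [X in (_ <= X)%N]mulnACA leq_mul2r; apply/orP; right; apply: leq_trans (leq_pmulr _ _).
  have := leq_mul (leqnn (s ^ 2)) cP; rewrite (expnD s 2 2).
  move/(leq_trans _); apply; apply: eq_leq.
  by move: (s ^ 2)%N => s2; ring.
have D2 : ((q %/ P).+1 * P <= 2 * q)%N.
  rewrite mulSn mul2n -addnn leq_add ?leq_divM //.
  apply: leq_trans (ltnW sq); apply: leq_trans (leq_div _ _) _.
  by rewrite -{1}(expn1 s) leq_pexp2l.
have NNP : (NN <= (q %/ P).+1 ^ (n + n) *
    (N ^ (n + n) * ((n + n) * P.*2.+1).+1 ^ e))%N.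
  apply: leq_trans (shrink_count c q0 P0) _; rewrite leq_mul2l; apply/orP; right.
  apply: leq_trans (box_count P b0); apply: subset_leq_card; apply/fintype.subsetP => uv.
  by rewrite !inE => /forallP H; apply/forallP => l; apply: small.
(* With the extra factor P^e, [codim] allows P^(33 + e) to be replaced by P^(2n), which absorbs the
   denominators of the number of cells and leaves (2q)^(2n). *)
have : (NN * P ^ 33 * P ^ e <= C3 * q ^ (n + n) * P ^ e)%N.
  rewrite -mulnA -expnD addnC.
  apply: (@leq_trans (NN * P ^ (n + n))); first by rewrite leq_mul2l leq_pexp2l ?orbT.
  apply: leq_trans (leq_mul NNP (leqnn _)) _.
  rewrite mulnAC -expnMn.
  have le1 := box_size_le n P0.
  apply: (@leq_trans ((2 * q) ^ (n + n) * (N ^ (n + n) * ((6 * n).+1 * P) ^ e))%N).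
    apply: leq_mul; last apply: leq_mul => //.
      have [->|n0] := posnP (n + n); first by rewrite !expn0.
      by rewrite (leq_exp2r _ _ n0).
    by rewrite leq_exp2r // /e addn1.
  rewrite !expnMn /C3.
  move: (2 ^ _)%N (q ^ _)%N (N ^ _)%N (_ ^ e)%N (P ^ e)%N => A1 A2 A3 A4 A5.
  by apply: eq_leq; ring.
rewrite leq_pmul2r ?expn_gt0 ?P0 // => NNP33.
apply: (@leq_trans (NN * (2 * kap * P) ^ 33)); first by rewrite leq_mul2l leq_exp2r ?skP ?orbT.
rewrite expnMn; move: NNP33.
move: ((2 * kap) ^ 33)%N (P ^ 33)%N (q ^ (n + n))%N => A1 A2 A3 H.
by rewrite mulnCA [X in (_ <= X)%N]mulnAC [X in (_ <= X)%N]mulnC leq_mul2l H orbT.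
Qed.

End KernelCounts.

(** * Prime powers *)

Section PrimePowerKernels.

Lemma intr_Fp_eq0 p (z : int) : prime p -> (z%:~R == 0 :> 'F_p) = (p%:Z %| z)%Z.
Proof.
move=> pp; rewrite dvdzE /= [(p %| _)%N](dvdn_pcharf (pchar_Fp pp)).
case: z => m //; rewrite NegzE mulrNz oppr_eq0 abszN //.
Qed.

Variables (n : nat) (c : tensor n).

(** Here h is an integer vector, so that the same h can be read modulo p and modulo a power of p. *)
Definition kernel_at q (h : 'I_n -> int) : {set {ffun 'I_n -> 'I_q}} :=
  [set k | [forall l, (q%:Z %| bil c h (lift_res k) l)%Z]].

Lemma kernel_resE q (h : {ffun 'I_n -> 'I_q}) : kernel_res c h = kernel_at q (lift_res h).
Proof. by []. Qed.

Lemma bil_eqmodv q (h k k' : 'I_n -> int) l : eqmodv q k k' ->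
  (bil c h k l = bil c h k' l %[mod q%:Z])%Z.
Proof.
move=> kk'; rewrite !(bil_unitv c h) //; apply: modz_congr_sum => m _.
by rewrite -modzMml kk' modzMml.
Qed.

Lemma dvdz_eqmod q (a b : int) : (a = b %[mod q%:Z])%Z -> (q%:Z %| a)%Z = (q%:Z %| b)%Z.
Proof. by move=> ab; apply/dvdz_mod0P/dvdz_mod0P; rewrite ab. Qed.

Lemma kernel_at_eqmod q h h' : eqmodv q h h' -> kernel_at q h = kernel_at q h'.
Proof.
move=> hh; apply/setP => k; rewrite !inE; apply: eq_forallb => l.
by apply: dvdz_eqmod; rewrite ![bil c _ (lift_res k) l]bilC; apply: bil_eqmodv.
Qed.

(** Reduction modulo p lands in the kernel modulo p. Two elements of one fibre differ by p times a
    vector that lies in the kernel modulo q. *)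
Lemma kernel_step p q h : (0 < p)%N -> (0 < q)%N ->
  (#|kernel_at (p * q) h| <= #|kernel_at p h| * #|kernel_at q h|)%N.
Proof.
move=> p0 q0; have pq0 : (0 < p * q)%N by rewrite muln_gt0 p0.
pose phi (k : {ffun 'I_n -> 'I_(p * q)}) := red_res p0 (lift_res k).
have phiE k : eqmodv p (lift_res (phi k)) (lift_res k) by apply: lift_red.
rewrite -sum1_card (partition_big phi (mem (kernel_at p h))) /=; last first.
  move=> k; rewrite !inE => /forallP H; apply/forallP => l.
  rewrite (dvdz_eqmod (bil_eqmodv h l (phiE k))).
  by apply: dvdz_trans (H l); rewrite PoszM dvdz_mulr.
rewrite -sum_nat_const; apply: leq_sum => d _.
pose B := [pred k | (k \in kernel_at (p * q) h) && (phi k == d)].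
apply: (@leq_trans #|B|); first by rewrite -sum1_card.
have [k0 /andP[k0A /eqP k0d]|] := pickP B; last by move/eq_card0->.
pose psi (k : {ffun 'I_n -> 'I_(p * q)}) :=
  red_res q0 (fun i => ((lift_res k i - lift_res k0 i) %/ p%:Z)%Z).
have div k i : k \in B -> lift_res k i - lift_res k0 i =
    p%:Z * ((lift_res k i - lift_res k0 i) %/ p%:Z)%Z.
  move=> /andP[_ /eqP kd]; rewrite mulrC divzK // -eqz_mod_dvd; apply/eqP.
  by rewrite -(phiE k i) -(phiE k0 i) kd k0d.
rewrite -(card_in_image (f := psi)); last first.
  move=> k k' kB k'B E; rewrite -[k](red_lift pq0) -[k'](red_lift pq0).
  apply: red_eq => i; apply/eqP; rewrite eqz_mod_dvd.
  have -> : lift_res k i - lift_res k' i =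
    (lift_res k i - lift_res k0 i) - (lift_res k' i - lift_res k0 i) by ring.
  rewrite (div k) // (div k') // -mulrBr PoszM dvdz_mul // -eqz_mod_dvd.
  by have := congr1 (fun f => lift_res f i) E; rewrite /psi !(lift_redE q0) => /eqP.
apply: subset_leq_card; apply/fintype.subsetP => _ /fintype.imageP[k kB ->].
rewrite inE; apply/forallP => l.
rewrite (dvdz_eqmod (bil_eqmodv h l (lift_red q0 _))).
have [kA _] := andP kB.
have : ((p * q)%N%:Z %| bil c h (lift_res k) l - bil c h (lift_res k0) l)%Z.
  by move: kA k0A; rewrite !inE => /forallP H /forallP H0; apply: rpredB.
rewrite -bilBr (_ : (fun i => _ - _) = (fun i => p%:Z * ((lift_res k i - lift_res k0 i) %/ p%:Z)%Z)).
  by rewrite bilZr PoszM dvdz_mul2l //; lia.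
by apply/funext => i; apply: div.
Qed.

Lemma kernel_power p r h : (0 < p)%N -> (#|kernel_at (p ^ r) h| <= #|kernel_at p h| ^ r)%N.
Proof.
move=> p0; elim: r => [|r IH].
  apply: leq_trans (max_card _) _.
  by rewrite card_ffun !card_ord exp1n expn0.
rewrite !expnS; apply: leq_trans (kernel_step _ _ _) _; rewrite ?expn_gt0 ?p0 //.
by rewrite leq_mul2l IH orbT.
Qed.

(* A residue h outside this set contributes at most q^(n - 10) to the differenced
   sum, for every power q of p; the set itself has density O(p^-8). *)
Definition exceptional p : {set {ffun 'I_n -> 'I_p}} :=
  [set h | (p ^ (n - 20) < #|kernel_res c h|)%N].

Lemma card_exceptional_lift p r (p0 : (0 < p)%N) :
  (#|[set h : {ffun 'I_n -> 'I_(p ^ r.+1)} | red_res p0 (lift_res h) \in exceptional p]|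
   <= #|exceptional p| * p ^ (n * r))%N.
Proof.
set A := [set h | _].
have cell_lt (a : 'I_(p ^ r.+1)) : (a %/ p < p ^ r)%N by rewrite ltn_divLR // -expnSr.
pose phi (h : {ffun 'I_n -> 'I_(p ^ r.+1)}) :
    {ffun 'I_n -> 'I_p} * {ffun 'I_n -> 'I_(p ^ r)} :=
  (red_res p0 (lift_res h), [ffun i => Ordinal (cell_lt (h i))]).
have phi_inj : injective phi.
  move=> h h' [E1 E2]; apply/ffunP => i; apply: val_inj => /=.
  rewrite (divn_eq (h i) p) (divn_eq (h' i) p).
  have := congr1 (fun f : {ffun 'I_n -> 'I_(p ^ r)} => val (f i)) E2; rewrite !ffunE /= => ->.
  congr (_ + _)%N; have := congr1 (fun f => lift_res f i) E1.
  by rewrite !lift_redE /lift_res !modz_nat => -[].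
rewrite -(card_imset _ phi_inj).
have -> : (p ^ (n * r) = #|{: {ffun 'I_n -> 'I_(p ^ r)}}|)%N.
  by rewrite card_ffun !card_ord mulnC expnM.
rewrite -cardsT -cardsX; apply: subset_leq_card; apply/fintype.subsetP.
by move=> _ /imsetP[h hA ->]; rewrite inE; move: hA; rewrite !inE andbT.
Qed.

End PrimePowerKernels.

(** * Residues with a large kernel modulo a prime *)

Section ExceptionalCount.
Variables (n t N : nat) (M : int) (cF cG : tensor n) (ls : 'I_t -> {mpoly int[n]}).
Hypothesis cert : pencil_cert (mpoly_of_tensor cF) (mpoly_of_tensor cG) ls N M.
Hypothesis hls : forall l, homogeneous 1 (ls l).
Hypothesis M_neq0 : M != 0.
Hypothesis codim : (n + t + 1 + 33 <= n + n)%N.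

(** The grid is now all of F_p. That p does not divide 6M keeps the certificate and Euler's identity
    usable modulo p. *)
Lemma prime_kernel_aux (c1 c2 : tensor n) (a1 a2 : int) p : prime p ->
    ~~ (p%:Z %| (6 * M))%Z -> ~~ (p%:Z %| a1)%Z ->
    pencil_cert (mpoly_of_tensor c1) (mpoly_of_tensor c2) ls N M ->
  (\sum_h #|@kernel_res n p (comb_tensor a1 a2 c1 c2) h|
   <= N ^ (n + n) * ((n + n) * p).+1 ^ (n + t + 1))%N.
Proof.
move=> pp pM pa1 cert12; pose c := comb_tensor a1 a2 c1 c2.
rewrite /kernel_res -(card_pairs (fun h k => [forall l, (p%:Z %| bil c (@lift_res n p h) (@lift_res n p k) l)%Z])).
set A := [set uv | _]; rewrite -card_sig.
pose X := {uv : {ffun 'I_n -> 'I_p} * {ffun 'I_n -> 'I_p} | uv \in A}.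
pose h i (x : X) : 'F_p := (lift_res (sval x).1 i)%:~R.
pose k i (x : X) : 'F_p := (lift_res (sval x).2 i)%:~R.
have -> : ((n + n) * p)%N = ((n + n) * size (enum 'F_p))%N by rewrite -cardE card_Fp.
have mod_inj (u v : 'I_p) : (u : nat)%:Z%:~R = (v : nat)%:Z%:~R :> 'F_p -> u = v.
  move/eqP; rewrite -subr_eq0 -intrB intr_Fp_eq0 // -eqz_mod_dvd !modz_nat !modn_small //.
  by move=> /eqP[] E; apply: val_inj.
apply: (@bilinear_count n t c1 c2 ls N M 'F_p X h k a1%:~R a2%:~R (enum 'F_p)) => //.
- rewrite intr_Fp_eq0 //; apply: contra pM; exact: dvdz_mull.
- rewrite -[6%:R]/((6%:Z)%:~R) intr_Fp_eq0 //; apply: contra pM; exact: dvdz_mulr.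
- by rewrite intr_Fp_eq0.
- move=> [uv uvA] l /=; have := uvA; rewrite inE => /forallP/(_ l).
  rewrite -intr_Fp_eq0 // bil_comb !intz intrD !intrM => /eqP.
  by rewrite /h /k /= !bil_intr.
- move=> [[u v] uvA] [[u' v'] uvA'] E; apply: val_inj => /=.
  by congr (_, _); apply/ffunP => i; have [h1 h2] := E i; apply: mod_inj.
- by move=> i x; rewrite !mem_enum.
Qed.

(** Markov's inequality for the sum of the kernel sizes; with the threshold p^(n - 20), [codim]
    would even allow p^13 in place of p^8. A prime dividing 6M is at most |6M| and is absorbed in
    the constant. *)
Lemma exceptional_count : exists C : nat, forall p a1 a2, prime p ->
    gcdn (gcdn a1 a2) p = 1%N ->
  (#|exceptional (comb_tensor a1%:Z a2%:Z cF cG) p| * p ^ 8 <= C * p ^ n)%N.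
Proof.
pose e := (n + t + 1)%N; pose C1 := (N ^ (n + n) * (n + n).+1 ^ e)%N.
exists (C1 + absz (6 * M)%R ^ 8)%N => p a1 a2 pp cop; rewrite mulnDl.
have p0 := prime_gt0 pp.
set c := comb_tensor _ _ _ _.
have [pM|pM] := boolP (p%:Z %| 6 * M)%Z.
  apply: leq_trans (leq_addl _ _); rewrite mulnC leq_mul //.
    rewrite leq_exp2r // dvdn_leq // absz_gt0 mulf_neq0 //.
  by apply: leq_trans (max_card _) _; rewrite card_ffun !card_ord.
apply: leq_trans (leq_addr _ _).
have NN : (\sum_h #|@kernel_res n p c h| <= C1 * p ^ e)%N.
  apply: (@leq_trans (N ^ (n + n) * ((n + n) * p).+1 ^ e)%N); last first.
    rewrite -mulnA leq_mul2l -expnMn; apply/orP; right.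
    by rewrite leq_exp2r /e ?addn1 // mulSn addnC -addn1 leq_add2l.
  have [pa1|pa1] := boolP (p%:Z %| a1%:Z)%Z; last exact: prime_kernel_aux.
  rewrite /c comb_tensorC; apply: prime_kernel_aux => //; last exact: pencil_cert_swap.
  apply/negP => pa2; move: cop; rewrite !dvdzE /= in pa1 pa2.
  have /gcdn_idPr -> : (p %| gcdn a1 a2)%N by rewrite dvdn_gcd pa1.
  by move=> p1; rewrite p1 in pp.
have n20 : (20 <= n)%N by lia.
have : (#|exceptional c p| * p ^ (n - 20) <= C1 * p ^ e)%N.
  apply: leq_trans NN; rewrite -sum_nat_const [leqRHS](bigID (mem (exceptional c p))) /=.
  apply: leq_trans (leq_addr _ _); apply: leq_sum => h.
  by rewrite inE => /ltnW.
move=> H; rewrite -(@leq_pmul2r (p ^ (n - 20))) ?expn_gt0 ?p0 // mulnAC.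
apply: leq_trans (leq_mul H (leqnn _)) _; rewrite -[X in (X <= _)%N]mulnA -[X in (_ <= X)%N]mulnA.
by rewrite leq_mul2l -!expnD leq_pexp2l ?orbT // /e; lia.
Qed.

End ExceptionalCount.

(** * Combining the two kernel bounds *)

Section WeylOptimisation.
Variable (R : realFieldType).

(* Here [w ^+ 32] is [1 / q]: fractional powers of q are integral powers of w. *)
Lemma weyl_optimise (H : finType) (T K : H -> R) (A : {set H})
    (S qn w pi s C1 C2 : R) :
  0 <= S -> 0 < qn -> 0 < w -> w <= 1 -> 0 < pi -> 0 <= s -> 0 <= C1 -> 0 <= C2 ->
  (forall h, 0 <= T h) -> S ^+ 2 <= \sum_h T h ->
  (forall h, T h ^+ 2 <= qn * K h) ->
  (forall h, 0 <= K h) ->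
  (forall h, h \notin A -> K h <= qn * w ^+ 640) ->
  #|H|%:R = qn -> #|A|%:R <= C1 * qn * pi ^+ 8 ->
  (\sum_h K h) * s ^+ 33 <= C2 * qn ^+ 2 -> 1 <= 2%:R * s * w ^+ 8 ->
  S <= (1 + C1 + C2 * 2%:R ^+ 33) * qn * (w ^+ 129 + pi ^+ 2 * w ^+ 66).
Proof.
move=> S0 qn0 w0 w1 pi0 s0 C10 C20 T0 ST TK K0 KA cardH cardA sumK sw.
pose C := 1 + C1 + C2 * 2%:R ^+ 33.
have pw k : 0 <= w ^+ k by apply: exprn_ge0; apply: ltW.
have pp k : 0 <= pi ^+ k by apply: exprn_ge0; apply: ltW.
have C2p0 : 0 <= C2 * 2%:R ^+ 33 by rewrite mulr_ge0 // exprn_ge0.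
(* Multiplying by the 33rd power of [1 <= 2 * s * w ^+ 8] eliminates s; 264 = 8 * 33. *)
have sumK' : \sum_h K h <= C2 * 2%:R ^+ 33 * qn ^+ 2 * w ^+ 264.
  have sK0 : 0 <= \sum_h K h by apply: sumr_ge0.
  apply: (@le_trans _ _ ((\sum_h K h) * (2%:R * s * w ^+ 8) ^+ 33)).
    by rewrite ler_peMr // exprn_ege1.
  rewrite 2!exprMn -exprM -[(8 * 33)%N]/264%N.
  have -> : (\sum_h K h) * (2%:R ^+ 33 * s ^+ 33 * w ^+ 264) =
    (\sum_h K h) * s ^+ 33 * (2%:R ^+ 33 * w ^+ 264).
    by move: (2%:R ^+ 33) (s ^+ 33) (w ^+ 264) => x y z; ring.
  have -> : C2 * 2%:R ^+ 33 * qn ^+ 2 * w ^+ 264 = C2 * qn ^+ 2 * (2%:R ^+ 33 * w ^+ 264).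
    by move: (2%:R ^+ 33) (w ^+ 264) => x z; ring.
  by rewrite ler_wpM2r // mulr_ge0 // exprn_ge0 // ltW.
have outA : \sum_(h | h \notin A) T h <= qn ^+ 2 * w ^+ 320.
  have Tle h : h \notin A -> T h <= qn * w ^+ 320.
    move=> hA; rewrite -(@ler_pXn2r _ 2) ?nnegrE //; last by rewrite mulr_ge0 ?exprn_ge0 // ltW.
    apply: le_trans (TK h) _; rewrite exprMn -exprM -[(320 * 2)%N]/640%N expr2 -mulrA.
    by apply: ler_wpM2l; [exact: ltW|exact: KA].
  apply: le_trans (ler_sum _ Tle) _; rewrite sumr_const -mulr_natr.
  rewrite mulrAC expr2; apply: ler_wpM2r; first by rewrite exprn_ge0 // ltW.
  rewrite ler_wpM2l ?(ltW qn0) // -cardH ler_nat; exact: max_card.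
(* The parameter of the inequality 2T <= lam + T^2 / lam, a form of Cauchy-Schwarz without square
   roots. It is chosen so that both summands contribute a multiple of qn^2 pi^4 w^132. *)
pose lam := qn * pi ^- 4 * w ^+ 132.
have lam0 : 0 < lam by rewrite /lam !mulr_gt0 ?invr_gt0 ?exprn_gt0.
have inA : \sum_(h in A) T h <= (C1 + C2 * 2%:R ^+ 33) * (qn ^+ 2 * (pi ^+ 4 * w ^+ 132)).
  have T2 h : h \in A -> T h <= (lam + T h ^+ 2 / lam) / 2%:R.
    move=> _; rewrite ler_pdivlMr // -(ler_pM2r lam0) mulrDl divfK ?gt_eqF //.
    by have := sqr_ge0 (lam - T h); rewrite -subr_ge0; congr (_ <= _); ring.
  apply: le_trans (ler_sum _ T2) _; rewrite -mulr_suml big_split /= sumr_const -mulr_suml.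
  rewrite ler_pdivrMr // -[lam *+ _]mulr_natr.
  set B := qn ^+ 2 * (pi ^+ 4 * w ^+ 132).
  have pin0 : pi != 0 by rewrite gt_eqF.
  have wn0 : w ^+ 132 != 0 by rewrite expf_neq0 // gt_eqF.
  have t1 : lam * #|A|%:R <= C1 * B.
    apply: le_trans (ler_wpM2l (ltW lam0) cardA) _.
    rewrite le_eqVlt; apply/orP; left; apply/eqP.
    by rewrite /lam /B; move: (w ^+ 132) => z; field.
  have t2 : (\sum_(h in A) T h ^+ 2) / lam <= C2 * 2%:R ^+ 33 * B.
    rewrite ler_pdivrMr //.
    apply: (@le_trans _ _ (\sum_h qn * K h)).
      rewrite [leRHS](bigID (mem A)) /= -[leLHS]addr0; apply: lerD; first exact: ler_sum.
      by apply: sumr_ge0 => h _; rewrite mulr_ge0 // ltW.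
    rewrite -mulr_sumr; apply: le_trans (ler_wpM2l (ltW qn0) sumK') _.
    rewrite (exprD w 132 132) /lam /B le_eqVlt; apply/orP; left; apply/eqP.
    by move: (w ^+ 132) (C2 * 2%:R ^+ 33) => z D; field.
  have B0 : 0 <= B.
    by apply: mulr_ge0; [apply: exprn_ge0; apply: ltW|apply: mulr_ge0; [exact: pp|exact: pw]].
  have D0 : 0 <= (C1 + C2 * 2%:R ^+ 33) * B by rewrite mulr_ge0 // addr_ge0.
  apply: le_trans (lerD t1 t2) _; rewrite -mulrDl ler_peMr //.
  by rewrite ler1n.
have S2 : S ^+ 2 <= (1 + C1 + C2 * 2%:R ^+ 33) * qn ^+ 2 * (w ^+ 258 + pi ^+ 4 * w ^+ 132).
  apply: le_trans ST _; rewrite (bigID (mem A)) /=.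
  apply: le_trans (lerD inA outA) _.
  (* The bound off [A] is weakened to 258 = 2 * 129, since after the later factor q^2 / w = w^-65 a
     term w^129 becomes w^64 = q^-2. *)
  have w320 : w ^+ 320 <= w ^+ 258 by apply: ler_wiXn2l => //; exact: ltW.
  have q2 : 0 <= qn ^+ 2 by rewrite exprn_ge0 // ltW.
  have z0 : 0 <= pi ^+ 4 * w ^+ 132 by apply: mulr_ge0; [exact: pp|exact: pw].
  have y0 := pw 258%N.
  move: w320 z0 y0 q2 C2p0.
  move: (w ^+ 320) (w ^+ 258) (pi ^+ 4 * w ^+ 132) (qn ^+ 2) (C2 * 2%:R ^+ 33).
  move=> x y z q D xy z0 y0 q2 D0.
  have h1 : q * x <= q * y by rewrite ler_wpM2l.
  have h2 : 0 <= (C1 + D) * (q * y) by rewrite !mulr_ge0 // addr_ge0.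
  have h3 : 0 <= q * z by rewrite mulr_ge0.
  have -> : (1 + C1 + D) * q * (y + z) = (C1 + D) * (q * z) + q * y + ((C1 + D) * (q * y) + q * z) by ring.
  lra.
have C1le : 1 <= C by rewrite /C -addrA lerDl addr_ge0.
have rhs0 : 0 <= w ^+ 129 + pi ^+ 2 * w ^+ 66.
  by apply: addr_ge0; [exact: pw|apply: mulr_ge0; [exact: pp|exact: pw]].
rewrite -(@ler_pXn2r _ 2) ?nnegrE //; last first.
  by rewrite !mulr_ge0 // ?(ltW qn0) // -/C (le_trans _ C1le).
apply: le_trans S2 _; rewrite -/C 2!exprMn.
apply: ler_pM.
- by rewrite mulr_ge0 ?exprn_ge0 ?(ltW qn0) // (le_trans _ C1le).
- by apply: addr_ge0; [exact: pw|apply: mulr_ge0; [exact: pp|exact: pw]].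
- rewrite ler_wpM2r ?exprn_ge0 ?(ltW qn0) // expr2 ler_peMr // (le_trans _ C1le) //.
have -> : (w ^+ 129 + pi ^+ 2 * w ^+ 66) ^+ 2 =
    w ^+ 258 + (w ^+ 129 * (pi ^+ 2 * w ^+ 66)) *+ 2 + pi ^+ 4 * w ^+ 132.
  by rewrite sqrrD [(pi ^+ 2 * _) ^+ 2]exprMn -!exprM.
rewrite addrAC lerDl mulrn_wge0 //.
by apply: mulr_ge0; [exact: pw|apply: mulr_ge0; [exact: pp|exact: pw]].
Qed.

End WeylOptimisation.

(** * Additive characters and real-valued moduli *)

Section AdditiveCharacter.
Variable R : realType.
Local Notation C := R[i].

Lemma e_D q a b : e_ R q (a + b) = e_ R q a * e_ R q b.
Proof.
rewrite /e_ intrD mulrDr mulrDl cosD sinD; set x := _ / _; set y := _ / _.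
by apply/eqP; rewrite eq_complex /=; apply/andP; split; apply/eqP; ring.
Qed.

Lemma e_norm q a : `|e_ R q a| = 1.
Proof. by rewrite normc_def /= cos2Dsin2 sqrtr1. Qed.

(** With m the residue of a, cos (2 pi m / q) = 1 forces sin (pi m / q) = 0 by the double-angle
    formula, while 0 < m < q would place pi m / q strictly between 0 and pi. *)
Lemma e_eq1 q a : (0 < q)%N -> (e_ R q a == 1) = (q%:Z %| a)%Z.
Proof.
move=> q0; have qR : (q%:R : R) != 0 by rewrite pnatr_eq0 -lt0n.
have eZ0 : e_ R q 0 = 1 by rewrite /e_ mulr0 mul0r cos0 sin0.
have eq1 : e_ R q q%:Z = 1.
  by rewrite /e_ -[q%:Z%:~R]/(q%:R) mulfK // mulr_natl cos2pi sin2pi.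
have emul (k : nat) : e_ R q (k%:Z * q%:Z) = 1.
  elim: k => [|k IH]; first by rewrite mul0r.
  by rewrite -addn1 PoszD mulrDl mul1r e_D IH eq1 mulr1.
have eN b : e_ R q b = 1 -> e_ R q (- b) = 1.
  by move=> eb; have := e_D q b (- b); rewrite subrr eZ0 eb mul1r.
have emulz (z : int) : e_ R q (z * q%:Z) = 1.
  by case: z => k //; rewrite NegzE mulNr; apply: eN.
rewrite {1}(divz_eq a q%:Z) e_D emulz mul1r; apply/eqP/dvdz_mod0P => [|-> //].
have qz : 0 < q%:Z by rewrite ltz_nat.
have m0 := modz_ge0 a (lt0r_neq0 qz); have mq := ltz_pmod a qz.
move: (a %% q%:Z)%Z m0 mq => m m0 mq.
move=> /eqP; rewrite eq_complex /= => /andP[/eqP cos1 _].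
apply/eqP; rewrite -(@eqr_int R); apply: contraT => mn0.
have m_gt0 : 0 < (m%:~R : R) by rewrite lt0r mn0 ler0z.
have mq' : (m%:~R : R) < q%:R by rewrite -[q%:R]/(q%:Z%:~R) ltr_int.
have : 0 < sin (pi * m%:~R / q%:R : R).
  apply: sin_gt0_pi; rewrite !mulr_gt0 ?pi_gt0 ?invr_gt0 ?ltr0n //=.
  rewrite ltr_pdivrMr ?ltr0n // ltr_pM2l ?pi_gt0 //.
move: cos1; have -> : 2 * pi * m%:~R / q%:R = pi * m%:~R / q%:R + pi * m%:~R / q%:R :> R.
  by move: (m%:~R : R) (pi : R) => x y; field.
set t := pi * _ / _; rewrite cosD => c1.
have := cos2Dsin2 t; rewrite !expr2 => cs; move=> s0.
have : sin t * sin t = 0 by lra.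
by move/eqP; rewrite mulf_eq0 orbb gt_eqF.
Qed.

(** The norm of [R[i]] takes values in [R[i]], where the order is partial; this is the same number
    in [R]. *)
Definition cabs (z : C) : R := complex.Re `|z|.

Lemma cabsE z : (cabs z)%:C = `|z|.
Proof. by rewrite /cabs normc_def. Qed.

Lemma cabs_ge0 z : 0 <= cabs z.
Proof. by rewrite -lecR cabsE rmorph0; apply: normr_ge0. Qed.

Lemma cabsM z1 z2 : cabs (z1 * z2) = cabs z1 * cabs z2.
Proof. by apply: complexI; rewrite rmorphM /= !cabsE normrM. Qed.

Lemma cabs_le z (x : R) : (cabs z <= x) = (`|z| <= x%:C).
Proof. by rewrite -lecR cabsE. Qed.

Lemma cabs_sum (I : Type) (s : seq I) (P : pred I) (F : I -> C) :
  cabs (\sum_(i <- s | P i) F i) <= \sum_(i <- s | P i) cabs (F i).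
Proof.
rewrite cabs_le; have -> : (\sum_(i <- s | P i) cabs (F i))%:C = \sum_(i <- s | P i) `|F i|.
  by rewrite rmorph_sum; apply: eq_bigr => i _; exact: cabsE.
exact: ler_norm_sum.
Qed.

End AdditiveCharacter.

(** * The exponential sums to prime power moduli *)

Section PrimePowerBound.
Variable R : realType.

Lemma map_intr_id n (p : {mpoly int[n]}) : map_mpoly intr p = p.
Proof. by apply/mpolyP => m; rewrite mcoeff_map_mpoly; apply: intz. Qed.

Lemma exp_sum_tensor n q a1 a2 (cF cG : tensor n) :
  exp_sum R (mpoly_of_tensor cF) (mpoly_of_tensor cG) q a1 a2 =
  \sum_x e_ R q (cub (comb_tensor a1%:Z a2%:Z cF cG) (@lift_res n q x)).
Proof.
apply: eq_bigr => x _; congr e_; rewrite cub_comb !intz /eval_res.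
by rewrite -!meval_tensor !map_intr_id.
Qed.

(** The exponent 1/32 is half of the margin 33/16 - 2, and all savings in q become integral powers
    of this weight. *)
Definition wt (q : nat) : R := q%:R `^ (- 32%:R^-1).

Lemma wt_gt0 q : (0 < q)%N -> 0 < wt q.
Proof. by move=> q0; rewrite powR_gt0 // ltr0n. Qed.

Lemma wtX32 q : (0 < q)%N -> wt q ^+ 32 = q%:R^-1.
Proof.
move=> q0; rewrite /wt -powR_mulrn ?powR_ge0 // -powRrM mulNr mulVf ?pnatr_eq0 //.
by rewrite powR_inv1 // ler0n.
Qed.

Lemma wt_le1 q : (0 < q)%N -> wt q <= 1.
Proof.
move=> q0; rewrite -(@ler_pXn2r _ 32) ?nnegrE ?(ltW (wt_gt0 q0)) // wtX32 // expr1n.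
by rewrite invf_le1 ?ltr0n // ler1n.
Qed.

Lemma wtM q1 q2 : wt (q1 * q2) = wt q1 * wt q2.
Proof. by rewrite /wt natrM powRM ?ler0n. Qed.

Lemma fourth_root q : (1 < q)%N -> exists s, [/\ (0 < s)%N, (s ^ 4 < q)%N & (q <= 16 * s ^ 4)%N].
Proof.
move=> q1; have exs : exists s, (q <= s.+1 ^ 4)%N.
  by exists q; apply: leq_trans (leqnSn q) _; rewrite -{1}(expn1 q.+1) leq_pexp2l.
case: (ex_minnP exs) => -[|s] qs smin; first by rewrite exp1n leqNgt q1 in qs.
exists s.+1; split => //.
  by rewrite ltnNge; apply/negP => /smin; rewrite ltnn.
apply: leq_trans qs _; rewrite -[16%N]/(2 ^ 4)%N -expnMn leq_exp2r //; lia.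
Qed.

Variables (n t N : nat) (M : int) (cF cG : tensor n) (ls : 'I_t -> {mpoly int[n]}).
Hypothesis cert : pencil_cert (mpoly_of_tensor cF) (mpoly_of_tensor cG) ls N M.
Hypothesis hls : forall l, homogeneous 1 (ls l).
Hypothesis M_neq0 : M != 0.
Hypothesis codim : (n + t + 1 + 33 <= n + n)%N.

Lemma prime_power_bound : exists2 B : R, 0 <= B & forall p r a1 a2, prime p ->
    gcdn (gcdn a1 a2) (p ^ r.+1) = 1%N ->
  cabs (exp_sum R (mpoly_of_tensor cF) (mpoly_of_tensor cG) (p ^ r.+1) a1 a2) <=
  B * (p ^ r.+1)%:R ^+ n *
    (wt (p ^ r.+1) ^+ 129 + p%:R ^- 2 * wt (p ^ r.+1) ^+ 66).
Proof.
have [C1 C1P] := exceptional_count cert hls M_neq0 codim.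
have [C2 C2P] := kernel_count cert hls M_neq0 codim.
exists (1 + C1%:R + C2%:R * 2%:R ^+ 33).
  by rewrite !addr_ge0 ?mulr_ge0 ?exprn_ge0 // ler0n.
move=> p r a1 a2 pp cop; have p0 := prime_gt0 pp.
set q := (p ^ r.+1)%N; have q0 : (0 < q)%N by rewrite expn_gt0 p0.
have q1 : (1 < q)%N by rewrite -[1%N](exp1n r.+1) ltn_exp2r // prime_gt1.
have n20 : (20 <= n)%N by lia.
have [s [s0 sq qs]] := fourth_root q1.
set c := comb_tensor a1%:Z a2%:Z cF cG.
pose A := [set h : {ffun 'I_n -> 'I_q} | red_res p0 (lift_res h) \in exceptional c p].
have copp : gcdn (gcdn a1 a2) p = 1%N.
  by move/eqP: cop; rewrite -/(coprime _ _) coprime_pexpr // => /eqP.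
have E := exp_sum_tensor q a1 a2 cF cG.
have eD := @e_D R q; have eN := @e_norm R q; have e1 a := @e_eq1 R q a q0.
pose T (h : {ffun 'I_n -> 'I_q}) := cabs (diff_sum (e_ R q) c h).
pose K (h : {ffun 'I_n -> 'I_q}) : R := #|kernel_res c h|%:R.
have qn0 : 0 < (q%:R : R) ^+ n by rewrite exprn_gt0 // ltr0n.
have pn0 : (p%:R : R) != 0 by rewrite pnatr_eq0 -lt0n.
have -> : p%:R ^- 2 = (p%:R^-1 : R) ^+ 2 by rewrite exprVn.
have W := @weyl_optimise R _ T K A (cabs (exp_sum R (mpoly_of_tensor cF) (mpoly_of_tensor cG) q a1 a2)) (q%:R ^+ n) (wt q) p%:R^-1 s%:R C1%:R C2%:R.
apply: W => //.
- exact: cabs_ge0.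
- exact: wt_gt0.
- exact: wt_le1.
- by rewrite invr_gt0 ltr0n.
- by move=> h; apply: cabs_ge0.
- rewrite E -lecR rmorphXn /= cabsE.
  have -> : (\sum_h T h)%:C = \sum_(h : {ffun 'I_n -> 'I_q}) `|diff_sum (e_ R q) c h|.
    by rewrite rmorph_sum; apply: eq_bigr => h _; exact: cabsE.
  exact: weyl_step1.
- move=> h; rewrite -lecR rmorphXn /= cabsE.
  have -> : (q%:R ^+ n * K h)%:C = (q ^ n * #|kernel_res c h|)%N%:R :> R[i].
    by rewrite /K -natrX -natrM rmorph_nat.
  exact: weyl_step2.
- move=> h; rewrite !inE -leqNgt => hA.
  (* The reduction of h modulo p is not exceptional; [kernel_power] raises its bound p^(n - 20) to
     the power r + 1. *)
  have le1 : (#|kernel_res c h| <= q ^ (n - 20))%N.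
    rewrite kernel_resE; apply: leq_trans (kernel_power _ _ _ p0) _.
    rewrite /q -expnM mulnC expnM leq_exp2r //.
    by rewrite (kernel_at_eqmod c (h' := lift_res (red_res p0 (lift_res h)))) // => i; rewrite lift_red.
  apply: (@le_trans _ _ (q ^ (n - 20))%N%:R); first by rewrite ler_nat.
  rewrite -[640%N]/(32 * 20)%N exprM wtX32 // exprVn natrX.
  by rewrite ler_pdivlMr ?exprn_gt0 ?ltr0n // -exprD subnK.
- by rewrite card_ffun !card_ord natrX.
- rewrite exprVn ler_pdivlMr ?exprn_gt0 ?ltr0n // -!natrX -!natrM ler_nat.
  apply: leq_trans (leq_mul (card_exceptional_lift c r p0) (leqnn _)) _.
  rewrite mulnAC; apply: leq_trans (leq_mul (C1P p a1 a2 pp copp) (leqnn _)) _.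
  by rewrite -mulnA -expnD leq_mul2l /q -expnM mulSn [(r * n)%N]mulnC leqnn orbT.
- rewrite /K -natr_sum -!natrX -!natrM ler_nat.
  by apply: leq_trans (C2P q a1 a2 s s0 cop sq qs) _; rewrite leq_mul2l -expnM muln2 addnn leqnn orbT.
(* The fourth power of the claim is q <= 16 s^4. *)
- rewrite -(@ler_pXn2r _ 4) ?nnegrE //; last first.
    by rewrite !mulr_ge0 ?exprn_ge0 // ltW // wt_gt0.
  rewrite expr1n 2!exprMn -exprM -[(8 * 4)%N]/32%N wtX32 // ler_pdivlMr ?ltr0n // mul1r.
  by rewrite -!natrX -natrM ler_nat.
Qed.

End PrimePowerBound.

(** * Multiplicativity and the Euler product *)

Section Multiplicativity.
Variable R : realType.

Lemma e_mod q a b : (0 < q)%N -> (a = b %[mod q%:Z])%Z -> e_ R q a = e_ R q b.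
Proof.
move=> q0; apply: char_mod; first exact: (@e_D R q).
by move=> z; apply: (@e_eq1 R).
Qed.

Lemma e_scale q1 q2 a : (0 < q2)%N -> e_ R (q1 * q2) (q2%:Z * a) = e_ R q1 a.
Proof.
move=> q20; have q2n0 : (q2%:R : R) != 0 by rewrite pnatr_eq0 -lt0n.
rewrite /e_ intrM natrM -[q2%:Z%:~R]/(q2%:R).
have -> // : 2 * pi * (q2%:R * a%:~R) / (q1%:R * q2%:R) = 2 * pi * a%:~R / q1%:R :> R.
by rewrite invfM [q2%:R * _]mulrC !mulrA [_ / q1%:R]mulrAC mulfK.
Qed.

Variables (n : nat) (cF cG : tensor n).
Local Notation F := (mpoly_of_tensor cF).
Local Notation G := (mpoly_of_tensor cG).

Lemma exp_sum_mod q a1 a2 : (0 < q)%N ->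
  exp_sum R F G q (a1 %% q) (a2 %% q) = exp_sum R F G q a1 a2.
Proof.
move=> q0; rewrite !exp_sum_tensor; apply: eq_bigr => x _; apply: e_mod => //.
rewrite !cub_comb !intz -modzDm -[in RHS]modzDm; congr ((_ + _) %% _)%Z.
  by rewrite -modz_nat modzMml.
by rewrite -modz_nat modzMml.
Qed.

(** Chinese remainders with x = q2 y + q1 z. The cubic form becomes q2^3 c(y) + q1^3 c(z) modulo q1
    q2, and one factor q2 or q1 cancels against the modulus; hence the squares. *)
Lemma exp_sum_coprime q1 q2 a1 a2 : (0 < q1)%N -> (0 < q2)%N -> coprime q1 q2 ->
  exp_sum R F G (q1 * q2) a1 a2 =
  exp_sum R F G q1 (q2 ^ 2 * a1) (q2 ^ 2 * a2) *
  exp_sum R F G q2 (q1 ^ 2 * a1) (q1 ^ 2 * a2).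
Proof.
move=> q10 q20 cop; have q0 : (0 < q1 * q2)%N by rewrite muln_gt0 q10.
pose glue (yz : {ffun 'I_n -> 'I_q1} * {ffun 'I_n -> 'I_q2}) (i : 'I_n) : int :=
  q2%:Z * lift_res yz.1 i + q1%:Z * lift_res yz.2 i.
pose psi yz := red_res q0 (glue yz).
have psi_inj : injective psi.
  have cop' (u1 u2 : nat) (a b : int) : coprime u1 u2 ->
      (u2%:Z * a = u2%:Z * b %[mod u1%:Z])%Z -> (a = b %[mod u1%:Z])%Z.
    move=> cu /eqP; rewrite eqz_mod_dvd -mulrBr Gauss_dvdzr // => ?.
    by apply/eqP; rewrite eqz_mod_dvd.
  have modl (u1 u2 : nat) (a b : int) : (a = b %[mod (u1 * u2)%N%:Z])%Z ->
      (a = b %[mod u1%:Z])%Z.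
    move=> /eqP; rewrite eqz_mod_dvd PoszM => H; apply/eqP; rewrite eqz_mod_dvd.
    by apply: dvdz_trans H; apply: dvdz_mulr.
  have drop (u1 u2 a b : int) : (u2 * a + u1 * b = u2 * a %[mod u1])%Z.
    by rewrite -modzDmr modzMr addr0.
  have inj_res m (x y : {ffun 'I_n -> 'I_m}) : (0 < m)%N ->
      eqmodv m (lift_res x) (lift_res y) -> x = y.
    by move=> m0 xy; rewrite -(red_lift m0 x) -(red_lift m0 y); apply: red_eq.
  move=> [y z] [y' z'] E.
  have Ei i : (glue (y, z) i = glue (y', z') i %[mod (q1 * q2)%N%:Z])%Z.
    by rewrite -!(lift_redE q0) -/(psi _) E.
  congr (_, _).
    apply: inj_res => // i; apply: (cop' _ q2) => //.
    by have := modl _ _ _ _ (Ei i); rewrite /glue /= !drop.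
  apply: inj_res => // i; apply: (cop' _ q1); first by rewrite coprime_sym.
  have := Ei i; rewrite mulnC => /modl; rewrite /glue /= ![q2%:Z * _ + _]addrC.
  by rewrite !drop.
have psi_bij : bijective psi.
  by apply: inj_card_bij => //; rewrite card_prod !card_ffun !card_ord expnMn.
rewrite !exp_sum_tensor (reindex psi) /=; last exact: onW_bij.
rewrite mulr_suml; under [RHS]eq_bigr => y _ do rewrite mulr_sumr.
rewrite pair_big /=; apply: eq_bigr => -[y z] _ /=.
set c := comb_tensor _ _ _ _.
have comb_scale (k : nat) (x : 'I_n -> int) :
    cub (comb_tensor (k ^ 2 * a1)%N%:Z (k ^ 2 * a2)%N%:Z cF cG) x = k%:Z ^+ 2 * cub c x.
  rewrite /c !cub_comb !intz !PoszM; ring.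
rewrite !comb_scale -(e_scale q1 (q2 := q2)) // -(e_scale q2 (q2 := q1)) //.
rewrite [in X in _ = _ * X]mulnC -e_D; apply: e_mod => //.
apply: (@etrans _ _ (cub c (glue (y, z)) %% (q1 * q2)%N%:Z)%Z).
  by apply: cub_mod; apply: lift_red.
apply/eqP; rewrite eqz_mod_dvd.
(* Every term that mixes y and z contains both q1 and q2. *)
have -> : cub c (glue (y, z)) - (q2%:Z * (q2%:Z ^+ 2 * cub c (lift_res y)) +
     q1%:Z * (q1%:Z ^+ 2 * cub c (lift_res z))) =
  \sum_i \sum_j \sum_k (q1 * q2)%N%:Z * (c i j k * (
    q2%:Z * (lift_res y i * lift_res y j * lift_res z k + lift_res y i * lift_res z j * lift_res y k
      + lift_res z i * lift_res y j * lift_res y k)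
    + q1%:Z * (lift_res y i * lift_res z j * lift_res z k + lift_res z i * lift_res y j * lift_res z k
      + lift_res z i * lift_res z j * lift_res y k))).
  rewrite /cub !mulrA !sum3M sum3D sum3N sum3D; apply: sum3_eq => i j k.
  rewrite /glue /= intz PoszM; ring.
by rewrite -sum3M dvdz_mulr.
Qed.

End Multiplicativity.

Section EulerProduct.
Variable R : realType.

Lemma inv_square_sum k : \sum_(2 <= m < k) (m%:R ^- 2 : R) <= 1.
Proof.
(* The sharper bound telescopes, as 1/m^2 <= 1/(m - 1) - 1/m. *)
suff H : (2 <= k)%N -> \sum_(2 <= m < k) (m%:R ^- 2 : R) <= 1 - k.-1%:R^-1.
  have [k2|k2] := leqP 2 k.
    by apply: le_trans (H k2) _; rewrite gerBl invr_ge0 ler0n.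
  by rewrite big_geq // ltnW.
elim: k => // -[|[|k]] IH // _; first by rewrite big_geq // invr1 subrr.
rewrite big_nat_recr //= -lerBrDr; apply: le_trans (IH isT) _ => /=.
rewrite -addrA lerD2l -opprD lerN2.
have k0 : (0 : R) < k.+1%:R by rewrite ltr0n.
have -> : k.+2%:R = k.+1%:R + 1 :> R by rewrite -natr1.
move: (k.+1%:R : R) k0 => x x0.
have x10 : 0 < x + 1 by rewrite addr_gt0.
rewrite -subr_ge0.
have -> : x^-1 - ((x + 1)^-1 + (x + 1) ^- 2) = x^-1 * (x + 1) ^- 2.
  by field; rewrite !gt_eqF.
by rewrite mulr_ge0 ?invr_ge0 ?exprn_ge0 // ltW.
Qed.

(** An Euler product for submultiplicative g: the factor at p is at most 1 + D p^-2 <= expR (D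
    p^-2), and the sum of the exponents is at most D. *)
Lemma euler_sum_le (g : nat -> R) (D : R) : 0 <= D ->
    (forall q, 0 <= g q) -> g 1%N <= 1 ->
    (forall q1 q2, (0 < q1)%N -> (0 < q2)%N -> coprime q1 q2 ->
       g (q1 * q2)%N <= g q1 * g q2) ->
    (forall p N, prime p -> \sum_(1 <= r < N.+1) g (p ^ r)%N <= D * p%:R ^- 2) ->
  forall N, \sum_(1 <= q < N.+1) g q <= expR D.
Proof.
move=> D0 g0 g1 gM gp N.
pose smooth k (q : 'I_N.+1) := (0 < q)%N && all (fun p => p < k)%N (primes q).
(* Passing from k to k + 1 multiplies the sum over the integers with all prime
   factors below k by at most the Euler factor at k. *)
have step k : (1 < k)%N -> \sum_(q | smooth k q) g q <= expR (D * \sum_(2 <= m < k) m%:R ^- 2).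
  elim: k => // k IH; rewrite ltnS leq_eqVlt => /predU1P[<-|k1].
    rewrite big_geq // mulr0 expR0.
    rewrite (eq_bigl (fun q : 'I_N.+1 => q == 1%N :> nat)); last first.
      move=> q; apply/idP/idP => [/andP[q0 /allP pq]|/eqP q1]; last by rewrite /smooth q1.
      rewrite eqn_leq q0 andbT leqNgt; apply/negP => q1.
      have := pq (pdiv q); rewrite mem_primes pdiv_prime // q0 pdiv_dvd => /(_ isT).
      by rewrite ltnNge prime_gt1 // pdiv_prime.
    have [N0|Npos] := posnP N.
      by rewrite big_pred0 // => q; have := ltn_ord q; rewrite {2}N0 ltnS leqn0 => /eqP->.
    rewrite (big_pred1 (inord 1)); first by rewrite inordK.
    by move=> q; rewrite /= -val_eqE /= inordK.
  have {}IH := IH k1.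
  rewrite big_nat_recr //= mulrDr expRD.
  apply: le_trans (ler_wpM2r (expR_ge0 _) IH).
  have [kp|knp] := boolP (prime k); last first.
    rewrite (eq_bigl (smooth k)); last first.
      move=> q; rewrite /smooth; apply: andb_id2l => q0; apply: eq_in_all => p.
      rewrite mem_primes => /and3P[pp _ _]; rewrite ltnS leq_eqVlt.
      by case: eqP => // pk; rewrite -pk pp in knp.
    rewrite ler_peMr ?sumr_ge0 //.
    by rewrite -[leLHS]expR0 ler_expR mulr_ge0 // invr_ge0 exprn_ge0.
  (* Splits q into the exponent of k and the part prime to k. Pairs outside the image only enlarge
     the right-hand side. *)
  pose psi (q : 'I_N.+1) : 'I_N.+1 * 'I_N.+1 := (inord (logn k q), inord (q`_(k^'))%N).
  have part_le (q : 'I_N.+1) : (0 < q)%N -> (q`_(k^') < N.+1)%N.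
    by move=> q0; apply: leq_ltn_trans (ltn_ord q); apply: dvdn_leq => //; apply: dvdn_part.
  have logn_lt (q : 'I_N.+1) : (0 < q)%N -> (logn k q < N.+1)%N.
    move=> q0; apply: leq_ltn_trans (ltn_ord q); apply: ltnW.
    apply: leq_trans (ltn_expl _ (prime_gt1 kp)) _.
    by apply: dvdn_leq => //; apply: pfactor_dvdnn.
  have decomp (q : 'I_N.+1) : (0 < q)%N -> (k ^ logn k q * q`_(k^') = q)%N.
    by move=> q0; rewrite -p_part partnC.
  have psi_inj : {in smooth k.+1 &, injective psi}.
    move=> q q' /andP[q0 _] /andP[q'0 _] [/(congr1 val) E1 /(congr1 val) E2].
    rewrite /= !inordK ?logn_lt ?part_le // in E1 E2.
    by apply: val_inj; rewrite /= -(decomp q) // -(decomp q') // E1 E2.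
  apply: (@le_trans _ _ (\sum_(q | smooth k.+1 q) (g (k ^ (psi q).1)%N * g (psi q).2))).
    apply: ler_sum => q /andP[q0 _]; rewrite /psi /= !inordK ?logn_lt ?part_le //.
    rewrite -{1}(decomp q) //; apply: gM.
    - by rewrite expn_gt0 prime_gt0.
    - exact: part_gt0.
    - by rewrite -p_part; apply: coprime_partC.
  rewrite -(big_imset (fun rm : 'I_N.+1 * 'I_N.+1 => g (k ^ rm.1)%N * g rm.2)); last exact: psi_inj.
  apply: (@le_trans _ _ (\sum_(m | smooth k m) \sum_(r < N.+1) g (k ^ r)%N * g m)).
    rewrite exchange_big pair_big_dep /=.
    rewrite [leRHS](bigID (mem (psi @: smooth k.+1))) /= -[leLHS]addr0.
    apply: lerD; last by apply: sumr_ge0 => rm _; rewrite mulr_ge0.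
    rewrite le_eqVlt; apply/orP; left; apply/eqP; apply: eq_bigl => rm.
    apply/idP/idP => [rmI|/andP[]//]; rewrite rmI andbT.
    have /imsetP[q /andP[q0 qk] ->] := rmI.
    rewrite /smooth /= inordK ?part_le // part_gt0 /=.
    apply/allP => p; rewrite primes_part mem_filter => /andP[pk pq].
    have := allP qk p pq; rewrite ltnS leq_eqVlt; case: eqP => // pk'.
    by move: pk; rewrite pk' !inE eqxx.
  rewrite mulr_suml; apply: ler_sum => m _; rewrite -mulr_suml mulrC ler_wpM2l //.
  rewrite big_ord_recl expn0; apply: (@le_trans _ _ (1 + D * k%:R ^- 2)); last exact: expR_ge1Dx.
  apply: lerD => //; apply: le_trans (gp k N kp).
  by rewrite big_add1 /= big_mkord.
have -> : \sum_(1 <= q < N.+1) g q = \sum_(q | smooth N.+2 q) g q.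
  rewrite (eq_bigl (fun q : 'I_N.+1 => (0 < q)%N)); last first.
    move=> q; rewrite /smooth andb_idr // => q0; apply/allP => p.
    rewrite mem_primes => /and3P[_ _ /(dvdn_leq q0) pq].
    by rewrite ltnS (leq_trans pq) // ltnW // ltn_ord.
  by rewrite [RHS]big_mkcond [RHS]big_ord_recl /= add0r big_add1 big_mkord.
apply: le_trans (step _ _) _ => //; rewrite ler_expR -[leRHS]mulr1.
by rewrite ler_wpM2l // inv_square_sum.
Qed.

End EulerProduct.

(** * Summing the terms of the singular series *)

Section SingularTerms.
Variable R : realType.
Variables (n t N : nat) (M : int) (cF cG : tensor n) (ls : 'I_t -> {mpoly int[n]}).
Hypothesis cert : pencil_cert (mpoly_of_tensor cF) (mpoly_of_tensor cG) ls N M.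
Hypothesis hls : forall l, homogeneous 1 (ls l).
Hypothesis M_neq0 : M != 0.
Hypothesis codim : (n + t + 1 + 33 <= n + n)%N.

Local Notation F := (mpoly_of_tensor cF).
Local Notation G := (mpoly_of_tensor cG).

(** For submultiplicativity of a maximum it is enough that multiplying a by q2^2 preserves
    coprimality to q1. No bijection between residue pairs enters. *)
Definition max_sum (q : nat) : R :=
  \big[Num.max/0]_(a : 'I_q * 'I_q | gcdn (gcdn a.1 a.2) q == 1%N)
    cabs (exp_sum R F G q a.1 a.2).

Lemma max_sum_ge0 q : 0 <= max_sum q.
Proof. exact: bigmax_ge_id. Qed.

Lemma exp_sum_le_max q a1 a2 : (0 < q)%N -> gcdn (gcdn a1 a2) q = 1%N ->
  cabs (exp_sum R F G q a1 a2) <= max_sum q.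
Proof.
move=> q0 cop; rewrite -exp_sum_mod //.
pose a : 'I_q * 'I_q := (Ordinal (ltn_pmod a1 q0), Ordinal (ltn_pmod a2 q0)).
apply: (le_bigmax_cond 0 (fun a : 'I_q * 'I_q => cabs (exp_sum R F G q a.1 a.2)) (j := a)) => /=.
by rewrite gcdnAC gcdn_modl -gcdnA gcdn_modr [gcdn q a2]gcdnC gcdnA cop.
Qed.

Lemma exp_sum_trivial q a1 a2 : cabs (exp_sum R F G q a1 a2) <= (q%:R : R) ^+ n.
Proof.
apply: le_trans (cabs_sum _ _ _) _.
rewrite (eq_bigr (fun=> 1)); last by move=> x _; apply: complexI; rewrite cabsE e_norm.
by rewrite sumr_const card_ffun !card_ord natrX.
Qed.

Lemma max_sum_coprime q1 q2 : (0 < q1)%N -> (0 < q2)%N -> coprime q1 q2 ->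
  max_sum (q1 * q2) <= max_sum q1 * max_sum q2.
Proof.
move=> q10 q20 cop; apply: bigmax_le; first by rewrite mulr_ge0 ?max_sum_ge0.
move=> a /eqP; rewrite -/(coprime _ _) => /eqP; rewrite -/(coprime _ _) coprimeMr => /andP[c1 c2].
rewrite exp_sum_coprime // cabsM; apply: ler_pM; rewrite ?cabs_ge0 //.
  apply: exp_sum_le_max => //; rewrite -muln_gcdr; apply/eqP.
  by rewrite -/(coprime _ _) coprimeMl c1 andbT coprimeXl // coprime_sym.
apply: exp_sum_le_max => //; rewrite -muln_gcdr; apply/eqP.
by rewrite -/(coprime _ _) coprimeMl c2 andbT coprimeXl.
Qed.

(** The factor q^2 bounds the number of pairs a, and dividing by [wt R q] multiplies by q^(1/32). *)
Definition weighted (q : nat) : R := q%:R ^+ 2 / q%:R ^+ n * max_sum q / wt R q.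

Lemma weighted_ge0 q : 0 <= weighted q.
Proof. by rewrite /weighted !mulr_ge0 ?invr_ge0 ?exprn_ge0 ?max_sum_ge0 // powR_ge0. Qed.

Lemma wt_le p q : (0 < p)%N -> (p <= q)%N -> wt R q <= wt R p.
Proof.
move=> p0 pq; have q0 := leq_trans p0 pq.
rewrite -(@ler_pXn2r _ 32) ?nnegrE ?(ltW (wt_gt0 _ _)) // !wtX32 //.
by rewrite lef_pV2 ?posrE ?ltr0n // ler_nat.
Qed.

Lemma wtX q r : wt R (q ^ r) = wt R q ^+ r.
Proof.
elim: r => [|r IH]; first by rewrite expn0 expr0 /wt powR1.
by rewrite expnS wtM IH exprS.
Qed.

Lemma wt2_lt1 : wt R 2 < 1.
Proof.
rewrite -(@ltr_pXn2r _ 32) ?nnegrE ?(ltW (wt_gt0 _ _)) // wtX32 // expr1n.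
by rewrite invf_lt1 ?ltr1n // ltr0n.
Qed.

(** With w = [wt R q] one has q^2 = w^-64, so [prime_power_bound] becomes B (w^64 + p^-2 w). Here
    w^64 = q^-2, and what remains beside p^-2 is dominated by powers of [wt R 2], a geometric series
    independent of p. *)
Lemma weighted_prime_power : exists2 D : R, 0 <= D &
  forall p K, prime p -> \sum_(1 <= r < K.+1) weighted (p ^ r) <= D * p%:R ^- 2.
Proof.
have [B B0 BP] := prime_power_bound R cert hls M_neq0 codim.
have rho1 : 0 < 1 - wt R 2 by rewrite subr_gt0 wt2_lt1.
exists (2%:R * B / (1 - wt R 2)).
  by apply: mulr_ge0; [apply: mulr_ge0; rewrite ?ler0n|rewrite invr_ge0; apply: ltW].
move=> p K pp; have p0 := prime_gt0 pp; have pR : (0 : R) < p%:R by rewrite ltr0n.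
have pi0 : 0 <= (p%:R : R) ^- 2 by rewrite invr_ge0 exprn_ge0 // ltW.
have wp0 : 0 < wt R p := wt_gt0 R p0.
have each r : weighted (p ^ r.+1) <= 2%:R * B * p%:R ^- 2 * wt R 2 ^+ r.
  set q := (p ^ r.+1)%N; have q0 : (0 < q)%N by rewrite expn_gt0 p0.
  have qR : (0 : R) < q%:R by rewrite ltr0n.
  have w0 := wt_gt0 R q0; set w := wt R q in w0.
  have qw : q%:R = w ^- 32 :> R by rewrite /w wtX32 // invrK.
  have ms : max_sum q <= B * q%:R ^+ n * (w ^+ 129 + p%:R ^- 2 * w ^+ 66).
    apply: bigmax_le => [|a /eqP cop]; last exact: BP.
    apply: mulr_ge0; first by rewrite mulr_ge0 // exprn_ge0 // ltW.
    by apply: addr_ge0; [apply: exprn_ge0; exact: ltW|apply: mulr_ge0 => //; apply: exprn_ge0; exact: ltW].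
  have step1 : weighted q <= B * (w ^+ 64 + p%:R ^- 2 * w).
    rewrite /weighted -/w ler_pdivrMr // mulrAC ler_pdivrMr ?exprn_gt0 //.
    apply: (@le_trans _ _ (q%:R ^+ 2 * (B * q%:R ^+ n * (w ^+ 129 + p%:R ^- 2 * w ^+ 66)))).
      by rewrite ler_wpM2l // exprn_ge0 // ltW.
    rewrite (_ : w ^+ 129 = w ^+ 64 * w * w ^+ 64); last by rewrite -exprSr -exprD.
    rewrite (_ : w ^+ 66 = w * w * w ^+ 64); last by rewrite -expr2 -exprD.
    have -> : q%:R ^+ 2 = (w ^+ 64)^-1 :> R by rewrite qw exprVn -exprM.
    have : w ^+ 64 != 0 by rewrite expf_neq0 // gt_eqF.
    move: (w ^+ 64) (q%:R ^+ n) (p%:R ^- 2) => x y z x0.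
    rewrite le_eqVlt; apply/orP; left; apply/eqP; field; exact: x0.
  apply: le_trans step1 _.
  have wE : w = wt R p ^+ r.+1 by rewrite /w wtX.
  have wp1 : wt R p <= 1 := wt_le1 R p0.
  have wr : wt R p ^+ r <= wt R 2 ^+ r.
    apply: lerXn2r; rewrite ?nnegrE ?(ltW wp0) ?(ltW (wt_gt0 R _)) //.
    by apply: wt_le => //; apply: prime_gt1.
  have t1 : w ^+ 64 <= p%:R ^- 2 * wt R 2 ^+ r.
    have -> : w ^+ 64 = p%:R ^- 2 * (p%:R ^- 2) ^+ r.
      rewrite wE -exprM mulnC exprM -[64%N]/(32 * 2)%N [wt R p ^+ _]exprM wtX32 //.
      by rewrite -exprS -[p%:R ^- 2]exprVn.
    apply: ler_wpM2l => //; apply: le_trans wr; apply: lerXn2r; rewrite ?nnegrE ?(ltW wp0) //.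
    rewrite -exprVn -wtX32 // -exprM -[leRHS]expr1; apply: ler_wiXn2l => //; exact: ltW.
  have t2 : w <= wt R 2 ^+ r.
    by apply: le_trans wr; rewrite wE exprS ler_piMl // exprn_ge0 // ltW.
  have : B * (w ^+ 64 + p%:R ^- 2 * w) <=
      B * (p%:R ^- 2 * wt R 2 ^+ r + p%:R ^- 2 * wt R 2 ^+ r).
    by apply: ler_wpM2l => //; apply: lerD => //; apply: ler_wpM2l.
  by congr (_ <= _); ring.
rewrite big_add1 /= big_mkord.
apply: (@le_trans _ _ (\sum_(i < K) 2%:R * B * p%:R ^- 2 * wt R 2 ^+ i)).
  by apply: ler_sum => i _; apply: each.
rewrite -mulr_sumr.
have geom : \sum_(i < K) wt R 2 ^+ i <= (1 - wt R 2)^-1.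
  rewrite -(ler_pM2l rho1) mulfV ?gt_eqF //.
  have := subrX1 (wt R 2) K; rewrite -opprB -[X in _ = X * _]opprB mulNr => /oppr_inj <-.
  by rewrite gerBl exprn_ge0 // ltW // wt_gt0.
apply: (@le_trans _ _ (2%:R * B * p%:R ^- 2 * (1 - wt R 2)^-1)).
  by apply: ler_wpM2l => //; rewrite !mulr_ge0.
by rewrite [leRHS]mulrAC.
Qed.

Lemma singular_term_le q : (0 < q)%N ->
  cabs (singular_term R F G q) / wt R q <= weighted q.
Proof.
move=> q0; rewrite /weighted ler_pM2r ?invr_gt0 ?wt_gt0 //.
have qR : (0 : R) < q%:R by rewrite ltr0n.
have cq : cabs ((q%:R : R[i]) ^- n) = (q%:R ^+ n)^-1.
  by apply: complexI; rewrite cabsE normrV ?unitfE ?expf_neq0 ?pnatr_eq0 -?lt0n //;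
     rewrite normrX normr_nat fmorphV rmorphXn rmorph_nat.
rewrite /singular_term cabsM cq.
have -> : q%:R ^+ 2 / q%:R ^+ n * max_sum q = (q%:R ^+ n)^-1 * (max_sum q * q%:R ^+ 2).
  by rewrite -mulrA mulrCA [q%:R ^+ 2 * _]mulrC.
apply: ler_wpM2l; first by rewrite invr_ge0 exprn_ge0 // ltW.
apply: le_trans (cabs_sum _ _ _) _.
apply: (@le_trans _ _ (\sum_(a : 'I_q * 'I_q | gcdn (gcdn a.1 a.2) q == 1%N) max_sum q)).
  by apply: ler_sum => a /eqP cop; apply: exp_sum_le_max.
rewrite sumr_const -[max_sum q *+ _]mulr_natr; apply: ler_wpM2l; rewrite ?max_sum_ge0 // -natrX ler_nat.
by apply: leq_trans (max_card _) _; rewrite card_prod !card_ord mulnn.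
Qed.

Lemma singular_terms_bounded : exists E : R, forall K,
  \sum_(1 <= q < K.+1) cabs (singular_term R F G q) / wt R q <= E.
Proof.
have [D D0 DP] := weighted_prime_power.
exists (expR D) => K; apply: (@le_trans _ _ (\sum_(1 <= q < K.+1) weighted q)).
  by apply: ler_sum_nat => q /andP[q0 _]; apply: singular_term_le.
apply: euler_sum_le => //.
- exact: weighted_ge0.
- rewrite /weighted /wt powR1 invr1 mulr1 expr1n expr1n invr1 !mul1r.
  by apply: bigmax_le => // a _; apply: le_trans (exp_sum_trivial _ _ _) _; rewrite expr1n.
- move=> q1 q2 q10 q20 cop.
  have -> : weighted q1 * weighted q2 = (q1 * q2)%N%:R ^+ 2 / (q1 * q2)%N%:R ^+ n *
      (max_sum q1 * max_sum q2) / wt R (q1 * q2).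
    rewrite /weighted wtM natrM !exprMn !invfM.
    move: (q1%:R ^+ 2) (q2%:R ^+ 2) (q1%:R ^+ n)^-1 (q2%:R ^+ n)^-1 (wt R q1)^-1 (wt R q2)^-1.
    move=> x1 x2 x3 x4 x5 x6; ring.
  rewrite /weighted ler_pM2r ?invr_gt0 ?wt_gt0 ?muln_gt0 ?q10 //.
  apply: ler_wpM2l; first by rewrite mulr_ge0 ?invr_ge0 ?exprn_ge0.
  exact: max_sum_coprime.
Qed.

End SingularTerms.

(** * Convergence *)

Section WeightedSeries.
Variable R : realType.
Local Open Scope classical_set_scope.

Lemma cvg_cabs (u : nat -> R[i]) (l : R[i]) :
  (forall eps : R, 0 < eps -> exists K, forall m, (K <= m)%N -> cabs (l - u m) < eps) ->
  (u : nat -> R[i]^o) @ \oo --> (l : R[i]^o).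
Proof.
move=> H; apply/cvgrPdist_lt => /= eps eps0.
(* A positive element of [R[i]] is real. *)
have epsE : eps = (complex.Re eps)%:C.
  by move: eps0; rewrite ltcE /= => /andP[/eqP + _]; case: eps => x y /= ->.
have re0 : 0 < complex.Re eps by rewrite -ltcR -epsE.
have [K HK] := H _ re0; exists K => // m /= Km.
by rewrite epsE -cabsE ltcR; apply: HK.
Qed.

Lemma cabs_Re (z : R[i]) : `|complex.Re z| <= cabs z.
Proof. by rewrite -lecR cabsE; apply: normc_ge_Re. Qed.

Lemma cabs_Im (z : R[i]) : `|complex.Im z| <= cabs z.
Proof.
rewrite /cabs normc_def /= -sqrtr_sqr ler_sqrt ?addr_ge0 ?sqr_ge0 //.
by rewrite lerDr sqr_ge0.
Qed.

Lemma cabs_le_ReIm (z : R[i]) : cabs z <= `|complex.Re z| + `|complex.Im z|.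
Proof.
rewrite /cabs normc_def /=; set x := complex.Re z; set y := complex.Im z.
rewrite -[leRHS]ger0_norm ?addr_ge0 // -sqrtr_sqr ler_sqrt ?sqr_ge0 //.
rewrite sqrrD !real_normK ?num_real // addrAC lerDl.
by rewrite mulrn_wge0 // mulr_ge0.
Qed.

Variables (a : nat -> R[i]) (w : nat -> R) (E : R).
Hypothesis w_gt0 : forall q, (0 < q)%N -> 0 < w q.
Hypothesis w_le1 : forall q, (0 < q)%N -> w q <= 1.
Hypothesis w_decr : forall q q', (0 < q)%N -> (q <= q')%N -> w q' <= w q.
Hypothesis bounded : forall K, \sum_(1 <= q < K.+1) cabs (a q) / w q <= E.

(** Rankin's trick: past K every term is multiplied by [w K / w q >= 1], after which the bounded
    weighted sum takes over. *)
Lemma weighted_tail K L : (0 < K)%N -> (K <= L)%N ->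
  \sum_(K.+1 <= q < L.+1) cabs (a q) <= E * w K.
Proof.
move=> K0 KL; rewrite -ler_pdivrMr ?w_gt0 // mulr_suml.
apply: le_trans (bounded L); rewrite [leRHS](@big_cat_nat _ _ _ K.+1) //=.
rewrite -[leLHS]add0r; apply: lerD.
  by rewrite big_nat sumr_ge0 // => q /andP[q0 _]; rewrite mulr_ge0 ?cabs_ge0 // invr_ge0 ltW // w_gt0.
apply: ler_sum_nat => q /andP[Kq _]; apply: ler_wpM2l; first exact: cabs_ge0.
have q0 : (0 < q)%N by apply: leq_ltn_trans Kq.
by rewrite lef_pV2 ?posrE ?w_gt0 //; apply: w_decr => //; apply: ltnW.
Qed.

Lemma abs_bounded K : \sum_(1 <= q < K.+1) cabs (a q) <= E.
Proof.
apply: le_trans (bounded K); apply: ler_sum_nat => q /andP[q0 _].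
by rewrite ler_peMr ?cabs_ge0 // invf_ge1 ?w_gt0 ?w_le1.
Qed.

Lemma real_series_cvg (x : nat -> R) : (forall q, `|x q| <= cabs (a q)) ->
  cvgn (fun K => \sum_(1 <= q < K.+1) x q).
Proof.
move=> xa.
have -> : (fun K => \sum_(1 <= q < K.+1) x q) = series (fun k => x k.+1).
  by apply/funext => K; rewrite /series /= big_add1.
apply: normed_cvg.
apply: (@nondecreasing_is_cvgn _ (series (fun k => `|x k.+1|))).
  by apply/nondecreasing_seqP => k; rewrite seriesSr lerDl /=.
exists E => _ [k _ <-] /=; rewrite /series /=.
apply: le_trans (abs_bounded k); rewrite [leRHS]big_add1 /=.
by apply: ler_sum_nat => q _; apply: xa.
Qed.

(** Completeness is used in R, for the real and imaginary parts separately, both being dominated by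
    [cabs (a q)]. *)
Theorem weighted_series_cvg :
  cvgn ((fun K => \sum_(1 <= q < K.+1) `|a q|) : nat -> R[i]^o) /\
  forall K, (0 < K)%N ->
    `|\sum_(1 <= q < K.+1) a q - limn ((fun K => \sum_(1 <= q < K.+1) a q) : nat -> R[i]^o)|
      <= (E * w K)%:C.
Proof.
have dist (u : nat -> R) (l : R) : u @ \oo --> l -> forall eps, 0 < eps ->
    exists K, forall m, (K <= m)%N -> `|l - u m| < eps.
  by move=> /cvgrPdist_lt ul eps /ul[K _ HK]; exists K => m Km; apply: HK.
split.
  have absE q : `|(fun k => cabs (a k)) q| <= cabs (a q) by rewrite /= ger0_norm ?cabs_ge0.
  have /cvg_ex[l /= /dist cv] := real_series_cvg absE.
  apply/cvg_ex; exists (l%:C : R[i]^o); apply: cvg_cabs => eps eps0.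
  have [K HK] := cv _ eps0; exists K => m Km.
  have -> : \sum_(1 <= q < m.+1) `|a q| = (\sum_(1 <= q < m.+1) cabs (a q))%:C :> R[i].
    by rewrite rmorph_sum; apply: eq_bigr => q _; rewrite -cabsE.
  rewrite -ltcR cabsE -rmorphB /= -[`|_|]cabsE ltcR.
  apply: le_lt_trans (HK m Km); rewrite cabs_le normc_def /= expr0n addr0 sqrtr_sqr //.
have /cvg_ex[lr /= /dist cr] := real_series_cvg (fun q => cabs_Re (a q)).
have /cvg_ex[li /= /dist ci] := real_series_cvg (fun q => cabs_Im (a q)).
pose S K := \sum_(1 <= q < K.+1) a q.
have SRe K : complex.Re (S K) = \sum_(1 <= q < K.+1) complex.Re (a q).
  by rewrite /S (raddf_sum (@complex.Re R)).
have SIm K : complex.Im (S K) = \sum_(1 <= q < K.+1) complex.Im (a q).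
  by rewrite /S (raddf_sum (@complex.Im R)).
have SL eps : 0 < eps -> exists K, forall m, (K <= m)%N -> cabs (lr +i* li - S m) < eps.
  move=> eps0; have e2 : 0 < eps / 2%:R by rewrite divr_gt0.
  have [K1 H1] := cr _ e2; have [K2 H2] := ci _ e2.
  exists (maxn K1 K2) => m; rewrite geq_max => /andP[m1 m2].
  apply: le_lt_trans (cabs_le_ReIm _) _; rewrite [ltRHS](splitr eps).
  have -> : complex.Re (lr +i* li - S m) = lr - complex.Re (S m) by case: (S m).
  have -> : complex.Im (lr +i* li - S m) = li - complex.Im (S m) by case: (S m).
  by rewrite SRe SIm; apply: ltrD; [apply: H1|apply: H2].
have limS : limn (S : nat -> R[i]^o) = lr +i* li.
  apply: cvg_lim; last exact: cvg_cabs.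
  exact: norm_hausdorff.
move=> K K0; rewrite -/(S K) limS -cabs_le.
(* Up to eps the limit is replaced by one partial sum S m with m >= K, so the bound for finite tails
   applies. *)
apply/ler_addgt0Pr => eps eps0; have [m0 Hm] := SL _ eps0.
pose m := maxn K m0; have Km : (K <= m)%N by apply: leq_maxl.
have -> : S K - (lr +i* li) = - (\sum_(K.+1 <= q < m.+1) a q) - (lr +i* li - S m).
  have -> : S m = S K + \sum_(K.+1 <= q < m.+1) a q by rewrite /S -big_cat_nat.
  by move: (S K) (\sum_(_ <= _ < _) _) (lr +i* li) => x y z; ring.
rewrite cabs_le rmorphD /=; apply: le_trans (ler_normB _ _) _; rewrite normrN.
apply: lerD; last by rewrite -cabsE lecR ltW // Hm // leq_maxr.
rewrite -cabsE lecR; apply: le_trans (cabs_sum _ _ _) _.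
exact: weighted_tail.
Qed.

End WeightedSeries.

(** * From the dimension of the singular locus to the theorem *)

Section Assembly.
Local Open Scope classical_set_scope.

Lemma rank_col_mx2 (K : fieldType) n (u v : 'rV[K]_n) :
  (forall i j, u 0 i * v 0 j - u 0 j * v 0 i = 0) -> (\rank (col_mx u v) < 2)%N.
Proof.
move=> H; have [w sub] : exists w : 'rV[K]_n, (col_mx u v <= w)%MS.
  have [->|u0] := eqVneq u 0.
    by exists v; rewrite -addsmxE addsmx_sub sub0mx submx_refl.
  have [j uj] : exists j, u 0 j != 0.
    apply: contrapT => Hj; move/eqP: u0; apply; apply/rowP => j; rewrite mxE.
    by have [//|uj] := eqVneq (u 0 j) 0; case: Hj; exists j.
  exists u; rewrite -addsmxE addsmx_sub submx_refl /=.
  have -> : v = (v 0 j / u 0 j) *: u.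
    apply/rowP => i; rewrite mxE; apply: (mulfI uj).
    have /eqP := H i j; rewrite subr_eq0 => /eqP E.
    by rewrite mulrA [u 0 j * (_ / _)]mulrC divfK // [v 0 j * _]mulrC E.
  exact: scalemx_sub.
by rewrite ltnS (leq_trans (mxrankS sub)) // rank_leq_row.
Qed.

Lemma mderiv_map (K : comNzRingType) n (p : {mpoly int[n]}) i :
  mderiv i (map_mpoly intr p) = map_mpoly intr (mderiv i p) :> {mpoly K[n]}.
Proof.
apply/mpolyP => m; rewrite mcoeff_deriv !mcoeff_map_mpoly mcoeff_deriv.
exact: (esym (rmorphMn _ _ _)).
Qed.

Lemma gradient_map (K : fieldType) n (p : {mpoly int[n]}) (x : 'rV[K]_n) i :
  gradient (map_mpoly intr p) x 0 i = (map_mpoly intr (mderiv i p)).@[x 0].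
Proof. by rewrite mxE mderiv_map. Qed.

Lemma singular_locus_minors (K : fieldType) n (F G : {mpoly int[n]}) (x : 'rV[K]_n) :
  x != 0 -> (map_mpoly intr F).@[x 0] = 0 -> (map_mpoly intr G).@[x 0] = 0 ->
  (forall i j, (map_mpoly intr
     (mderiv i F * mderiv j G - mderiv j F * mderiv i G)).@[x 0] = 0) ->
  singular_locus (map_mpoly intr F) (map_mpoly intr G) x.
Proof.
move=> x0 Fx Gx minors; split => //; apply: rank_col_mx2 => i j.
rewrite -[RHS](minors i j) rmorphB !rmorphM mevalB !mevalM.
by congr (_ * _ - _ * _); apply: gradient_map.
Qed.

End Assembly.

Section CertificateFromDimension.
Local Open Scope classical_set_scope.

(** The set [Z] cut out by F, G and the minors is closed by construction and lies in the singular
    locus, so chains in [Z] are chains in the locus. On [Z] some linear form of the section is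
    nonzero, hence the enlarged family has only the trivial zero. *)
Lemma pencil_cert_of_dim (R : realType) n t (F G : {mpoly int[n]}) :
    homogeneous 3 F -> homogeneous 3 G ->
    (forall m, irreducible_chain (complex_singular_locus R F G) m -> (m < t)%N) ->
  exists (ls : 'I_t -> {mpoly int[n]}) N M, [/\ forall l, homogeneous 1 (ls l),
    M != 0 & pencil_cert F G ls N M].
Proof.
move=> hF hG chainS.
(* With no linear forms, the pencil family consists of F, G and the minors. *)
have nols : 'I_0 -> {mpoly int[n]} by case.
pose Pk := @pencil_family n 0 F G nols.
pose Z := [set x : 'rV[R[i]]_n | x != 0 /\
  forall p, range (fun j => map_mpoly intr (Pk j) : {mpoly R[i][n]}) p -> p.@[x 0] = 0].
have cZ : proj_closed Z.
  exists (range (fun j => map_mpoly intr (Pk j) : {mpoly R[i][n]})) => // _ [j _ <-].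
  exists (pencil_degree j); apply: map_homog; case: j => [[[]|[a b]]|[]] //=.
  by apply: rpredB; apply: (@dhomogM _ _ _ 2 _ 2); apply: mderiv_homog.
have Zsub : Z `<=` complex_singular_locus R F G.
  move=> x [x0 Zx]; have ev j : (map_mpoly intr (Pk j)).@[x 0] = 0 by apply: Zx; exists j.
  apply: singular_locus_minors => //.
  - exact: ev (inl (inl true)).
  - exact: ev (inl (inl false)).
  - by move=> i j; exact: ev (inl (inr (i, j))).
have [m [Y [Y1 Y2]]|ls [szls hls lsP]] := linear_section (t := t) cZ.
  apply: chainS; exists Y; split => // i im; have [irr YZ] := Y1 i im.
  by split => //; apply: subset_trans YZ Zsub.
pose lsf (l : 'I_t) := nth 0 ls l.
have hlsf l : homogeneous 1 (lsf l) by apply: hls; apply: mem_nth; rewrite szls.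
have [|N [M [M0 cert]]] := @pencil_cert_exists R[i] n t F G lsf hF hG hlsf.
  move=> x xP; suff x0 : (\row_j x j : 'rV[R[i]]_n) = 0.
    by move=> i; have /rowP/(_ i) := x0; rewrite !mxE.
  apply: contrapT => /eqP x0.
  have ev p : p.@[fun j => (\row_j x j : 'rV[R[i]]_n) 0 j] = p.@[x].
    by apply: meval_eq => j; rewrite mxE.
  have Zx : Z (\row_j x j).
    split => // _ [j _ <-]; rewrite ev.
    by case: j => [j|[]] //; have := xP (inl j); case: j => [[]|[]].
  have [l lls] := lsP _ Zx; rewrite ev => /eqP; apply.
  have il : (index l ls < t)%N by rewrite -szls index_mem.
  by have := xP (inr (Ordinal il)); rewrite /= /lsf /= nth_index.
by exists lsf, N, M.
Qed.

End CertificateFromDimension.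

Theorem theorem10p3 (R : realType) (n : nat) (F G : {mpoly int[n]}) (sigma : int)
    (hF : homogeneous 3 F) (hG : homogeneous 3 G)
    (hsigma : has_proj_dim (complex_singular_locus R F G) sigma)
    (hn : 35 <= n%:Z - sigma) :
  singular_series_abs_cvg R F G /\
  exists2 phi : R, 0 < phi &
    exists c : R, forall N : nat, (0 < N)%N ->
      `|singular_partial R F G N - singular_series R F G| <=
        (c * N%:R `^ (- phi))%:C.
Proof.
(* t = sigma + 1 in both cases: 0 for the empty locus, which has no chains as irreducible sets are
   non-empty, and [k.+1] otherwise. The second condition is then [hn]. *)
have [t chainS tn] : exists2 t : nat,
    (forall m, irreducible_chain (complex_singular_locus R F G) m -> (m < t)%N) &
    (n + t + 1 + 33 <= n + n)%N.
  case: hsigma => [[S0 sE]|[k [sE _ kmax]]].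
    exists 0%N; last by move: hn; rewrite sE; lia.
    move=> m [Y [/(_ 0%N isT)[[_ [y Yy] _] YS] _]].
    by have := YS y Yy; rewrite S0.
  exists k.+1; last by move: hn; rewrite sE; lia.
  by move=> m /kmax; rewrite ltnS.
have [ls [N [M [hls M0 cert]]]] := pencil_cert_of_dim hF hG chainS.
have [cF FE] := cubic_tensor hF; have [cG GE] := cubic_tensor hG.
rewrite FE GE in cert *.
have [E bounded] := singular_terms_bounded R cert hls M0 tn.
have [abs_cvg tail] := weighted_series_cvg (@wt_gt0 R) (@wt_le1 R) (@wt_le R) bounded.
split; first exact: abs_cvg.
(* 1/32 is the exponent in [wt], so the tail bound has the required form already. *)
by exists 32%:R^-1; [rewrite invr_gt0 ltr0n|exists E => K K0; apply: tail].
Qed.
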